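(* The categories $\mathrm{Rep}(\mathfrak{S})$ and $\mathrm{Rep}^{\mathrm{pol}}(\mathbf{GA})$ are equivalent.
   Context: Everything is over $\mathbf{C}$, and equivalence means equivalence of ($\mathbf{C}$-linear abelian) categories, with no compatibility with tensor products claimed. $\mathbf{V}=\mathbf{C}^\infty$ has basis $e_1,e_2,\dots$. $\mathfrak{S}=\mathfrak{S}(\infty)$ is the group of permutations of $\{1,2,\dots\}$ fixing all but finitely many elements, acting on $\mathbf{V}$ by permuting the $e_i$. $\mathrm{Rep}(\mathfrak{S})$ is the category of algebraic representations of $\mathfrak{S}$: subquotients of finite direct sums of the representations $\mathbf{V}^{\otimes n}$. $\mathbf{GA}(\infty)$ is the subgroup of $\mathbf{GL}(\infty)=\bigcup_d\mathbf{GL}(d)$ stabilizing the functional $\mathbf{t}=e_1^*\colon\mathbf{V}\to\mathbf{C}$. $\mathrm{Rep}^{\mathrm{pol}}(\mathbf{GA})$ is the category of polynomial representations of $\mathbf{GA}(\infty)$: subquotients of finite direct sums of the representations $\mathbf{V}^{\otimes n}$. *)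

(* Defs.v *)
From HB Require Import structures.
From mathcomp Require Import all_boot all_algebra.
From mathcomp Require Import boolp classical_sets functions cardinality fsbigop.
From mathcomp Require Import reals complex.

Set Implicit Arguments.
Unset Strict Implicit.
Unset Printing Implicit Defensive.

Import GRing.Theory.
Local Open Scope classical_set_scope.
Local Open Scope ring_scope.

Record lin_category (K : fieldType) := LinCategory {
  obj :> Type;
  mor : obj -> obj -> lmodType K;
  id_mor : forall A, mor A A;
  comp_mor : forall A B C, mor B C -> mor A B -> mor A C;
  comp1m : forall A B (f : mor A B), comp_mor (id_mor B) f = f;
  compm1 : forall A B (f : mor A B), comp_mor f (id_mor A) = f;
  compA : forall A B C D (h : mor C D) (g : mor B C) (f : mor A B),
    comp_mor h (comp_mor g f) = comp_mor (comp_mor h g) f;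
  comp_linearl : forall A B C (f : mor A B),
    linear (fun g : mor B C => comp_mor g f);
  comp_linearr : forall A B C (g : mor B C),
    linear (fun f : mor A B => comp_mor g f) }.

Arguments mor {K l}.
Arguments id_mor {K l}.
Arguments comp_mor {K l A B C}.

Record lin_functor (K : fieldType) (C D : lin_category K) := LinFunctor {
  fobj :> C -> D;
  fmap : forall A B : C, mor A B -> mor (fobj A) (fobj B);
  fmap1 : forall A, fmap (id_mor A) = id_mor (fobj A);
  fmapM : forall (A B E : C) (g : mor B E) (f : mor A B),
    fmap (comp_mor g f) = comp_mor (fmap g) (fmap f);
  fmap_linear : forall A B, linear (@fmap A B) }.

Arguments fmap {K C D} l {A B}.

Section Functors.
Variable K : fieldType.

Definition functor_id (C : lin_category K) : lin_functor C C :=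
  @LinFunctor K C C id (fun A B f => f) (fun=> erefl)
    (fun _ _ _ _ _ => erefl) (fun _ _ _ _ _ => erefl).

Section Comp.
Variables (C D E : lin_category K) (G : lin_functor D E) (F : lin_functor C D).

Lemma functor_comp1 (A : C) : fmap G (fmap F (id_mor A)) = id_mor (G (F A)).
Proof. by rewrite !fmap1. Qed.

Lemma functor_compM (A B X : C) (g : mor B X) (f : mor A B) :
  fmap G (fmap F (comp_mor g f)) = comp_mor (fmap G (fmap F g)) (fmap G (fmap F f)).
Proof. by rewrite !fmapM. Qed.

Lemma functor_comp_linear (A B : C) :
  linear (fun f : mor A B => fmap G (fmap F f)).
Proof. by move=> a u v /=; rewrite !fmap_linear. Qed.

Definition functor_comp : lin_functor C E :=
  LinFunctor functor_comp1 functor_compM functor_comp_linear.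
End Comp.

Definition is_iso (C : lin_category K) (A B : C) (f : mor A B) :=
  exists g : mor B A, comp_mor g f = id_mor A /\ comp_mor f g = id_mor B.

Definition naturally_isomorphic (C D : lin_category K) (F G : lin_functor C D) :=
  exists eta : forall A : C, mor (F A) (G A),
    (forall (A B : C) (f : mor A B),
       comp_mor (eta B) (fmap F f) = comp_mor (fmap G f) (eta A)) /\
    (forall A : C, is_iso (eta A)).

(* Linear equivalence. Kernels, cokernels and direct sums are determined by the
   underlying category, so this is also equivalence of abelian categories. *)
Definition equivalent (C D : lin_category K) :=
  exists (F : lin_functor C D) (G : lin_functor D C),
    naturally_isomorphic (functor_comp G F) (functor_id C) /\
    naturally_isomorphic (functor_comp F G) (functor_id D).

End Functors.

Record lin_action (K : fieldType) (G : groupType) (V : lmodType K) := LinAction {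
  lact :> G -> V -> V;
  lact_linear : forall g, linear (lact g);
  lact1 : forall v, lact 1%g v = v;
  lactM : forall g h v, lact (g * h)%g v = lact g (lact h v) }.

HB.instance Definition _ (K : fieldType) (G : groupType) (V : lmodType K)
    (a : lin_action G V) (g : G) :=
  GRing.isLinear.Build K V V *:%R (a g) (lact_linear a g).

Record rep (K : fieldType) (G : groupType) := Rep {
  rep_space :> lmodType K;
  raction : lin_action G rep_space }.

Section Representations.
Variables (K : fieldType) (G : groupType).
Implicit Types M N P : rep K G.

Definition equivariant_pred M N : pred (M -> N) :=
  fun f => `[< linear f /\ forall g v, f (raction M g v) = raction N g (f v) >].

Record rep_hom M N := RepHom {
  rep_hom_fun :> M -> N;
  rep_homP : equivariant_pred rep_hom_fun }.

HB.instance Definition _ M N := [isSub for @rep_hom_fun M N].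
HB.instance Definition _ M N := [Choice of rep_hom M N by <:].

Lemma equivariant_submod M N : submod_closed (@equivariant_pred M N).
Proof.
split.
  by apply/asboolP; split=> [a u v|g v] /=; rewrite ?linear0 ?scaler0 ?addr0.
move=> a f h /asboolP[fl fe] /asboolP[hl he]; apply/asboolP; split.
  move=> b u v; have -> w : (a *: f + h) w = a *: f w + h w by [].
  by rewrite fl hl !scalerDr !scalerA (mulrC b) addrACA.
move=> g v; have E w : (a *: f + h) w = a *: f w + h w by [].
by rewrite !E fe he linearP.
Qed.

HB.instance Definition _ M N :=
  GRing.SubChoice_isSubLmodule.Build K (M -> N) _ (rep_hom M N)
    (@equivariant_submod M N).

Lemma rep_hom_linear M N (f : rep_hom M N) : linear f.
Proof. by case/asboolP: (rep_homP f). Qed.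

Lemma rep_hom_equiv M N (f : rep_hom M N) g v :
  f (raction M g v) = raction N g (f v).
Proof. by case/asboolP: (rep_homP f) => _; apply. Qed.

Lemma rep_hom_ext M N (f h : rep_hom M N) : f =1 h -> f = h.
Proof. by move=> fh; apply/val_inj/funext. Qed.

Lemma rep_id_subproof M : equivariant_pred (id : M -> M).
Proof. by apply/asboolP. Qed.

Definition rep_id M := RepHom (rep_id_subproof M).

Lemma rep_comp_subproof M N P (h : rep_hom N P) (f : rep_hom M N) :
  equivariant_pred (h \o f : M -> P).
Proof.
apply/asboolP; split=> [a u v|g v] /=; first by rewrite !rep_hom_linear.
by rewrite !rep_hom_equiv.
Qed.

Definition rep_comp M N P (h : rep_hom N P) (f : rep_hom M N) :=
  RepHom (rep_comp_subproof h f).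

Section FullSubcategory.
Variable Q : rep K G -> Prop.

Definition rep_category : lin_category K.
Proof.
refine (@LinCategory K {M : rep K G | Q M}
  (fun A B => rep_hom (sval A) (sval B) : lmodType K)
  (fun A => rep_id (sval A))
  (fun A B C (h : rep_hom (sval B) (sval C)) f => rep_comp h f) _ _ _ _ _).
- by move=> A B f; apply: rep_hom_ext.
- by move=> A B f; apply: rep_hom_ext.
- by move=> A B C D h g f; apply: rep_hom_ext.
- by move=> A B C f a u v; apply: rep_hom_ext.
- by move=> A B C g a u v; apply: rep_hom_ext => x /=; rewrite rep_hom_linear.
Defined.
End FullSubcategory.

(* M is a quotient of a subobject of W, subobjects and quotients being given by
   injective and surjective morphisms. *)
Definition subquotient M W :=
  exists (N : rep K G) (i : rep_hom N W) (p : rep_hom N M),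
    injective i /\ (forall m : M, exists n : N, p n = m).

Definition rep0 : rep K G :=
  @Rep K G 'rV[K]_0 (@LinAction K G 'rV[K]_0 (fun _ v => v)
    (fun _ _ _ _ => erefl) (fun=> erefl) (fun _ _ _ => erefl)).

Section DirectSum.
Variables M N : rep K G.

Definition dsum_act (g : G) (x : M * N) : M * N :=
  (raction M g x.1, raction N g x.2).

Lemma dsum_act_linear g : linear (dsum_act g).
Proof. by move=> a u v; rewrite /dsum_act /= !linearP. Qed.

Lemma dsum_act1 x : dsum_act 1%g x = x.
Proof. by case: x => x y; rewrite /dsum_act /= !lact1. Qed.

Lemma dsum_actM g h x : dsum_act (g * h)%g x = dsum_act g (dsum_act h x).
Proof. by rewrite /dsum_act /= !lactM. Qed.

Definition dsum : rep K G :=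
  @Rep K G (M * N)%type (LinAction dsum_act_linear dsum_act1 dsum_actM).
End DirectSum.

End Representations.

(* The K-vector space with basis T: finitely supported functions T -> K. *)
Section FreeModule.
Variables (K : fieldType) (T : choiceType).

Definition finsupp_pred : pred (T -> K) :=
  fun f => `[< finite_set [set x | f x != 0] >].

Record freeMod := FreeMod {
  coef :> T -> K;
  coefP : finsupp_pred coef }.

HB.instance Definition _ := [isSub for coef].
HB.instance Definition _ := [Choice of freeMod by <:].

Lemma finsupp_zmod : zmod_closed finsupp_pred.
Proof.
split.
  apply/asboolP; rewrite (_ : [set _ | _] = set0) //.
  by apply/seteqP; split=> x //=; rewrite eqxx.
move=> f h /asboolP ff /asboolP fh; apply/asboolP.
apply: (@sub_finite_set _ _ ([set x | f x != 0] `|` [set x | h x != 0])).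
  move=> x /=; have -> : (f - h) x = f x - h x by [].
  by have [->|] := eqVneq (f x) 0; [rewrite sub0r oppr_eq0; right|left].
by rewrite finite_setU.
Qed.

HB.instance Definition _ :=
  GRing.SubChoice_isSubZmodule.Build (T -> K) _ freeMod finsupp_zmod.

Lemma finsupp_scale (a : K) (f : freeMod) : finsupp_pred (fun x => a * f x).
Proof.
have /asboolP ff := coefP f; apply/asboolP; apply: sub_finite_set ff => x /=.
by apply: contra => /eqP ->; rewrite mulr0.
Qed.

Definition freeMod_scale a f := FreeMod (finsupp_scale a f).

Lemma freeMod_scaleA a b f :
  freeMod_scale a (freeMod_scale b f) = freeMod_scale (a * b) f.
Proof. by apply/val_inj/funext => x /=; rewrite mulrA. Qed.
Lemma freeMod_scale1 : left_id 1 freeMod_scale.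
Proof. by move=> f; apply/val_inj/funext => x /=; rewrite mul1r. Qed.
Lemma freeMod_scaleDr : right_distributive freeMod_scale +%R.
Proof. by move=> a f h; apply/val_inj/funext => x /=; rewrite mulrDr. Qed.
Lemma freeMod_scaleDl f : {morph freeMod_scale^~ f : a b / a + b}.
Proof. by move=> a b; apply/val_inj/funext => x /=; rewrite mulrDl. Qed.

HB.instance Definition _ := GRing.Zmodule_isLmodule.Build K freeMod
  freeMod_scaleA freeMod_scale1 freeMod_scaleDr freeMod_scaleDl.

Lemma finsupp_delta (x : T) :
  finsupp_pred (fun y => (y == x)%:R).
Proof.
apply/asboolP; apply: (@sub_finite_set _ _ [set x]); last exact: finite_set1.
by move=> y /=; case: (eqVneq y x) => // _; rewrite eqxx.
Qed.

Definition evec (x : T) : freeMod := FreeMod (finsupp_delta x).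

(* The linear map sending [evec x] to b x. *)
Definition lin_ext (W : lmodType K) (b : T -> W) (f : freeMod) : W :=
  \sum_(x \in [set: T]) f x *: b x.

End FreeModule.

Arguments evec {K T}.

Section FreeModuleTheory.
Variables (K : fieldType) (T : choiceType).
Implicit Types (f h : freeMod K T) (W : lmodType K).

Lemma freeModP f h : f =1 h -> f = h.
Proof. by move=> fh; apply/val_inj/funext. Qed.

Lemma coefD f h x : (f + h) x = f x + h x. Proof. by []. Qed.
Lemma coefZ a f x : (a *: f) x = a * f x. Proof. by []. Qed.
Lemma coef0 x : (0 : freeMod K T) x = 0. Proof. by []. Qed.

Lemma coef_sum I (r : seq I) (P : pred I) (F : I -> freeMod K T) x :
  (\sum_(i <- r | P i) F i) x = \sum_(i <- r | P i) F i x.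
Proof. by elim/big_rec2: _ => [|i u v _ <-]. Qed.

Lemma evecE x y : (evec x : freeMod K T) y = (y == x)%:R.
Proof. by []. Qed.

Lemma freeMod_supp f : exists2 s : seq T, uniq s & forall x, x \notin s -> f x = 0.
Proof.
have /asboolP /finite_seqP[s sE] := coefP f.
exists (undup s); first exact: undup_uniq.
move=> x; rewrite mem_undup => xs; apply: contraNeq xs => fx.
by have : [set` s] x by rewrite -sE.
Qed.

Lemma lin_extE W (b : T -> W) f (s : seq T) : uniq s ->
  (forall x, x \notin s -> f x = 0) -> lin_ext b f = \sum_(x <- s) f x *: b x.
Proof.
move=> us sf; rewrite /lin_ext [RHS]fsbig_seq //; apply/esym.
by apply: fsbig_widen => // x [_ /= /negP xs] /=; rewrite sf ?scale0r.
Qed.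

Lemma lin_ext_linear W (b : T -> W) : linear (lin_ext b).
Proof.
move=> a f h; have [s _ sf] := freeMod_supp f; have [r _ rh] := freeMod_supp h.
have us := undup_uniq (s ++ r).
have nf x : x \notin undup (s ++ r) -> f x = 0.
  by rewrite mem_undup mem_cat negb_or => /andP[/sf].
have nh x : x \notin undup (s ++ r) -> h x = 0.
  by rewrite mem_undup mem_cat negb_or => /andP[_ /rh].
have nfh x : x \notin undup (s ++ r) -> (a *: f + h) x = 0.
  by move=> xs; rewrite coefD coefZ nf // nh // mulr0 addr0.
rewrite (lin_extE _ us nf) (lin_extE _ us nh) (lin_extE _ us nfh).
rewrite scaler_sumr -big_split; apply: eq_bigr => x _.
by rewrite coefD coefZ scalerDl scalerA.
Qed.

HB.instance Definition _ W (b : T -> W) :=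
  GRing.isLinear.Build K (freeMod K T) W *:%R (lin_ext b) (lin_ext_linear b).

Lemma lin_ext_evec W (b : T -> W) x : lin_ext b (evec x) = b x.
Proof.
rewrite (@lin_extE _ _ _ [:: x]) //.
  by rewrite big_seq1 evecE eqxx scale1r.
by move=> y; rewrite inE evecE => /negPf ->.
Qed.

Lemma freeMod_sum f (s : seq T) : uniq s ->
  (forall x, x \notin s -> f x = 0) -> f = \sum_(x <- s) f x *: evec x.
Proof.
move=> us sf; apply: freeModP => y; rewrite coef_sum.
have [ys|ys] := boolP (y \in s); last first.
  rewrite sf // big_seq big1 // => x xs; rewrite coefZ evecE.
  by case: eqVneq ys => [->|]; rewrite ?xs ?mulr0.
rewrite (bigD1_seq y) // coefZ evecE eqxx mulr1 big1 => [|x xy].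
  by rewrite [RHS]addr0.
by rewrite coefZ evecE eq_sym (negPf xy) mulr0.
Qed.

Lemma lin_ext_unique W (L : freeMod K T -> W) :
  linear L -> L =1 lin_ext (fun x => L (evec x)).
Proof.
move=> Ll f; pose HL := GRing.isLinear.Build K _ _ _ L Ll.
pose L' : {linear freeMod K T -> W} := HB.pack L HL.
have [s us sf] := freeMod_supp f.
rewrite (lin_extE _ us) // {1}(freeMod_sum us sf) -[L]/(L' : _ -> _) linear_sum.
by apply: eq_bigr => x _; rewrite linearZ.
Qed.

End FreeModuleTheory.

(* Indices start at 0: the i-th standard basis vector e_i of K^oo (i >= 1) is
   [evec i.-1]. *)
Notation Koo K := (freeMod K nat).

(* The n-th tensor power of K^oo: the basis vector indexed by s stands for
   evec (s 0) (x) ... (x) evec (s (n - 1)); see [pure_evec]. *)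
Notation tensor_pow K n := (freeMod K {ffun 'I_n -> nat}).

Section PureTensor.
Variables (K : fieldType) (n : nat).
Implicit Types v w : 'I_n -> Koo K.

Lemma supp_bound v : exists N, forall k i, (N <= i)%N -> v k i = 0.
Proof.
have bnd k : exists N, forall i, (N <= i)%N -> v k i = 0.
  have [s _ sv] := freeMod_supp (v k); exists (\max_(x <- s) x).+1 => i Ni.
  apply/sv/negP => si; move: Ni; rewrite leqNgt ltnS.
  by rewrite (leq_bigmax_seq i).
have [N NP] := choice bnd.
exists (\max_k N k) => k i Ni; apply: NP; apply: leq_trans Ni.
exact: leq_bigmax.
Qed.

Definition ffun_le N (f : {ffun 'I_n -> 'I_N}) : {ffun 'I_n -> nat} :=
  [ffun k => f k : nat].

Lemma ffun_le_inj N : injective (@ffun_le N).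
Proof.
by move=> f g /ffunP fg; apply/ffunP => k; apply/val_inj; have := fg k; rewrite !ffunE.
Qed.

Definition tbox N : seq {ffun 'I_n -> nat} :=
  [seq ffun_le f | f <- enum {: {ffun 'I_n -> 'I_N}}].

Lemma tbox_uniq N : uniq (tbox N).
Proof. by rewrite map_inj_uniq ?enum_uniq //; exact: ffun_le_inj. Qed.

Lemma mem_tbox N (s : {ffun 'I_n -> nat}) : (forall k, (s k < N)%N) -> s \in tbox N.
Proof.
move=> sN; apply/mapP; exists [ffun k => Ordinal (sN k)]; first by rewrite mem_enum.
by apply/ffunP => k; rewrite !ffunE.
Qed.

Lemma notin_tbox N (s : {ffun 'I_n -> nat}) :
  s \notin tbox N -> exists k, (N <= s k)%N.
Proof.
move=> sN; apply: contrapT => /forallNP H; case/negP: sN; apply: mem_tbox => k.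
by rewrite ltnNge; apply/negP/H.
Qed.

Lemma pure_finsupp v :
  finsupp_pred (fun s : {ffun 'I_n -> nat} => \prod_k v k (s k)).
Proof.
have [N vN] := supp_bound v.
apply/asboolP/(@sub_finite_set _ _ [set` tbox N]); last exact: finite_seq.
move=> s /= /eqP sv; apply: contrapT => /negP /notin_tbox[k kN]; apply: sv.
by rewrite (bigD1 k) //= vN // mul0r.
Qed.

(* The pure tensor v_0 (x) ... (x) v_(n-1). *)
Definition pure v : tensor_pow K n := FreeMod (pure_finsupp v).

Lemma pure_evec (s : {ffun 'I_n -> nat}) : pure (evec \o s) = evec s.
Proof.
apply: freeModP => t /=; have [->|ts] := eqVneq t s.
  by apply: big1 => k _; rewrite eqxx.
have /existsP[k kts] : [exists k, t k != s k].
  apply: contraNT ts => /existsPn ts; apply/eqP/ffunP => k.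
  by apply/eqP; have := ts k; rewrite negbK.
by rewrite (bigD1 k) //= (negPf kts) mul0r.
Qed.

Lemma pureE v (s : {ffun 'I_n -> nat}) : pure v s = \prod_k v k (s k).
Proof. by []. Qed.

(* L (x) ... (x) L for a linear endomorphism L, given on basis tensors; see
   [tensor_map_pure] for its value on arbitrary pure tensors. *)
Definition tensor_map (L : Koo K -> Koo K) : tensor_pow K n -> tensor_pow K n :=
  lin_ext (fun s : {ffun 'I_n -> nat} => pure (fun k => L (evec (s k)))).

Lemma tensor_map_pure (L : Koo K -> Koo K) v : linear L ->
  tensor_map L (pure v) = pure (L \o v).
Proof.
move=> Ll; have [N vN] := supp_bound v; apply: freeModP => t.
rewrite /tensor_map (lin_extE _ (tbox_uniq N)); last first.
  by move=> s /notin_tbox[k kN]; rewrite /= (bigD1 k) //= vN // mul0r.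
rewrite coef_sum big_map big_enum [RHS]pureE.
transitivity (\sum_(f : {ffun 'I_n -> 'I_N})
    \prod_k (v k (f k) * L (evec (f k : nat)) (t k))).
  apply: eq_bigr => f _; rewrite coefZ !pureE -big_split.
  by apply: eq_bigr => k _; rewrite ffunE.
rewrite -(bigA_distr_bigA (fun k (i : 'I_N) => v k i * L (evec (i : nat)) (t k))).
apply: eq_bigr => k _; rewrite [in RHS]/= (lin_ext_unique Ll (v k)).
rewrite (@lin_extE _ _ _ _ _ (iota 0 N)) ?iota_uniq //; last first.
  by move=> i; rewrite mem_iota add0n /= -leqNgt => /vN.
rewrite coef_sum; under [RHS]eq_bigr => i _ do rewrite coefZ.
by rewrite -(big_mkord xpredT (fun i => v k i * L (evec i) (t k)))
  /index_iota subn0.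
Qed.

End PureTensor.

Section TensorPowerRep.
Variables (K : fieldType) (G : groupType) (a : lin_action G (Koo K)) (n : nat).

Lemma tensor_act_linear g : linear (@tensor_map K n (a g)).
Proof. exact: lin_ext_linear. Qed.

Lemma tensor_act1 x : @tensor_map K n (a 1%g) x = x.
Proof.
rewrite /tensor_map [RHS](lin_ext_unique (L := id)) //.
congr (lin_ext _ x); apply/funext => s /=; rewrite -pure_evec; congr pure.
by apply/funext => k; rewrite lact1.
Qed.

Lemma tensor_actM g h x :
  tensor_map (a (g * h)%g) x = tensor_map (a g) (tensor_map (a h) x) :> tensor_pow K n.
Proof.
rewrite [RHS](lin_ext_unique (L := @tensor_map K n (a g) \o tensor_map (a h))).
  rewrite {1}/tensor_map; congr (lin_ext _ x); apply/funext => s /=.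
  rewrite -pure_evec tensor_map_pure; last exact: lact_linear.
  rewrite tensor_map_pure; last exact: lact_linear.
  by congr pure; apply/funext => k /=; rewrite lactM.
by move=> c u v; rewrite /= !tensor_act_linear.
Qed.

Definition tensor_rep : rep K G :=
  @Rep K G (tensor_pow K n) (LinAction tensor_act_linear tensor_act1 tensor_actM).

End TensorPowerRep.

Section TensorialCategory.
Variables (K : fieldType) (G : groupType) (a : lin_action G (Koo K)).

Definition tensor_dsum (ns : seq nat) : rep K G :=
  foldr (fun n M => dsum (tensor_rep a n) M) (rep0 K G) ns.

Definition tensorial_category : lin_category K :=
  rep_category (fun M : rep K G => exists ns, subquotient M (tensor_dsum ns)).

End TensorialCategory.

Section Bijections.
Variable T : choiceType.

Record bij := Bij {
  bij_fun :> T -> T;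
  bijP : `[< bijective bij_fun >] }.

HB.instance Definition _ := [isSub for bij_fun].
HB.instance Definition _ := [Choice of bij by <:].

Lemma bij_bijective (f : bij) : bijective f.
Proof. exact/asboolP/bijP. Qed.

Lemma bij_inv_subproof (f : bij) :
  exists g : bij, cancel f g /\ cancel g f.
Proof.
have [g fK gK] := bij_bijective f.
have gb : `[< bijective g >] by apply/asboolP; exists f.
by exists (Bij gb).
Qed.

Definition bij_inv (f : bij) : bij := sval (cid (bij_inv_subproof f)).

Lemma bij_invK (f : bij) : cancel f (bij_inv f).
Proof. by rewrite /bij_inv; case: cid => g []. Qed.

Lemma bij_Kinv (f : bij) : cancel (bij_inv f) f.
Proof. by rewrite /bij_inv; case: cid => g []. Qed.

Lemma bij_one_subproof : `[< bijective (@id T) >].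
Proof. by apply/asboolP; exists id. Qed.

Lemma bij_mul_subproof (f g : bij) : `[< bijective (f \o g) >].
Proof. by apply/asboolP; apply: bij_comp; exact: bij_bijective. Qed.

Definition bij_one := Bij bij_one_subproof.
Definition bij_mul (f g : bij) := Bij (bij_mul_subproof f g).

Lemma bij_ext (f g : bij) : f =1 g -> f = g.
Proof. by move=> fg; apply/val_inj/funext. Qed.

Lemma bij_mulA : associative bij_mul. Proof. by move=> f g h; apply: bij_ext. Qed.
Lemma bij_mul1 : left_id bij_one bij_mul. Proof. by move=> f; apply: bij_ext. Qed.
Lemma bij_1mul : right_id bij_one bij_mul. Proof. by move=> f; apply: bij_ext. Qed.
Lemma bij_mulV : left_inverse bij_one bij_inv bij_mul.
Proof. by move=> f; apply: bij_ext => x /=; rewrite bij_invK. Qed.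
Lemma bij_Vmul : right_inverse bij_one bij_inv bij_mul.
Proof. by move=> f; apply: bij_ext => x /=; rewrite bij_Kinv. Qed.

HB.instance Definition _ :=
  isGroup.Build bij bij_mulA bij_mul1 bij_1mul bij_mulV bij_Vmul.

End Bijections.

Definition finitary : pred (bij nat) :=
  fun s => `[< finite_set [set i | s i != i] >].

Lemma finitary_closed : group_closed finitary.
Proof.
split.
  apply/asboolP; rewrite (_ : [set _ | _] = set0) //.
  by apply/seteqP; split=> x //=; rewrite eqxx.
move=> s t /asboolP fs /asboolP ft; apply/asboolP.
apply: (@sub_finite_set _ _ ([set x | s x != x] `|` [set x | t x != x])).
  move=> x /=; have [tx|] := eqVneq (t x) x; last by right.
  by move=> st; left; move: st; rewrite -{1}tx bij_invK.
by rewrite finite_setU.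
Qed.

Record Sym_oo := MkSym_oo { sym_bij :> bij nat; symP : finitary sym_bij }.
HB.instance Definition _ := [isSub for sym_bij].
HB.instance Definition _ := [Choice of Sym_oo by <:].
HB.instance Definition _ :=
  SubChoice_isSubGroup.Build (bij nat) _ Sym_oo finitary_closed.

Section GeneralAffine.
Variable K : fieldType.

(* v lies in K^d, the span of the first d basis vectors. *)
Definition in_Kd (d : nat) (v : Koo K) := forall i, (d <= i)%N -> v i = 0.

(* GL(d), embedded in the automorphisms of K^oo as the group of linear
   automorphisms preserving K^d and fixing the remaining basis vectors. *)
Definition in_GLd (d : nat) (g : bij (Koo K)) :=
  [/\ linear g,
      forall v, in_Kd d v -> in_Kd d (g v) &
      forall i, (d <= i)%N -> g (evec i) = evec i].

Definition in_GLoo (g : bij (Koo K)) := exists d, in_GLd d g.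

(* The functional e_1^*. *)
Definition t_form (v : Koo K) : K := v 0%N.

Definition affine_pred : pred (bij (Koo K)) :=
  fun g => `[< in_GLoo g /\ forall v, t_form (g v) = t_form v >].

Lemma in_Kd_bound (v : Koo K) : exists d, in_Kd d v.
Proof.
have [N vN] := supp_bound (fun _ : 'I_1 => v); exists N; exact: vN ord0.
Qed.

Lemma in_GLd_tail d g (u : Koo K) : in_GLd d g ->
  (forall i, (i < d)%N -> u i = 0) -> g u = u.
Proof.
move=> [gl _ ge] u0; have [s us su] := freeMod_supp u.
rewrite (lin_ext_unique gl) [RHS](freeMod_sum us su) (lin_extE _ us su).
apply: eq_bigr => i _ /=; have [id|di] := ltnP i d; last by rewrite ge.
by rewrite u0 // !scale0r.
Qed.

Lemma in_GLd_widen d d' g : (d <= d')%N -> in_GLd d g -> in_GLd d' g.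
Proof.
move=> dd' gd; have [gl gK ge] := gd; split=> // [|i d'i]; last first.
  by apply: ge; apply: leq_trans d'i.
move=> v vd' i d'i; have [s us sv] := freeMod_supp v.
rewrite (lin_ext_unique gl) (lin_extE _ us sv) coef_sum big1 // => j _.
rewrite coefZ; have [d'j|jd'] := leqP d' j; first by rewrite vd' ?mul0r.
have [dj|jd] := leqP d j.
  rewrite ge // evecE; case: eqVneq d'i jd' => [->|]; last by rewrite mulr0.
  by rewrite leqNgt => /negPf ->.
rewrite gK ?mulr0 //; last by apply: leq_trans d'i.
move=> k dk; rewrite evecE; case: eqVneq dk jd => // ->.
by rewrite leqNgt => /negPf ->.
Qed.

Lemma in_GLd_inv d g : in_GLd d g -> in_GLd d g^-1%g.
Proof.
move=> gd; have [gl gK ge] := gd; split.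
- move=> a u v; apply: (bij_inj (bij_bijective g)).
  by rewrite gl !(bij_Kinv g).
- move=> v vd; set w := (g^-1%g v).
  have gw : g w = v by exact: bij_Kinv.
  pose w1 : Koo K := \sum_(i < d) w i *: evec (i : nat).
  have w1E i : w1 i = if (i < d)%N then w i else 0.
    rewrite coef_sum; case: ltnP => id.
      rewrite (bigD1 (Ordinal id)) //= big1 ?addr0 => [|j /eqP ij].
        by rewrite eqxx mulr1.
      case: eqVneq => [E|]; last by rewrite mulr0.
      by case: ij; apply/val_inj.
    rewrite big1 // => j _; rewrite coefZ evecE.
    by case: eqVneq id => [->|_ _]; rewrite ?mulr0 // leqNgt ltn_ord.
  have w2t : g (w - w1) = w - w1.
    apply: (in_GLd_tail gd) => i id.
    have -> : (w - w1) i = w i - w1 i by [].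
    by rewrite w1E id subrr.
  have w1d : in_Kd d w1 by move=> i; rewrite w1E leqNgt => /negPf ->.
  move=> i di; have : g (1 *: w1 + (w - w1)) i = 0.
    by rewrite scale1r addrC subrK gw; exact: vd.
  rewrite gl w2t scale1r coefD (gK _ w1d _ di) add0r.
  have -> : (w - w1) i = w i - w1 i by [].
  by rewrite w1d // subr0.
- by move=> i di; rewrite -{1}(ge i di); exact: bij_invK.
Qed.

Lemma affine_closed : group_closed affine_pred.
Proof.
split.
  by apply/asboolP; split=> //; exists 0%N; split.
move=> g h /asboolP[[d gd] gt] /asboolP[[d' hd] ht]; apply/asboolP; split.
  exists (maxn d d').
  have [gl gK ge] := in_GLd_widen (leq_maxl d d') gd.
  have [hl hK he] := in_GLd_inv (in_GLd_widen (leq_maxr d d') hd).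
  split=> [a u v|v vd|i di].
  - by rewrite /= hl gl.
  - by apply: gK; apply: hK.
  - by rewrite /= he // ge.
move=> v; rewrite -[(g * _)%g v]/(g (h^-1%g v)) gt -{2}(bij_Kinv h v).
by rewrite ht.
Qed.

Record GA_oo := MkGA_oo {
  genaff_bij :> bij (Koo K);
  genaffP : affine_pred genaff_bij }.
HB.instance Definition _ := [isSub for genaff_bij].
HB.instance Definition _ := [Choice of GA_oo by <:].
HB.instance Definition _ :=
  SubChoice_isSubGroup.Build (bij (Koo K)) _ GA_oo affine_closed.

Definition genaff_act (g : GA_oo) (v : Koo K) : Koo K := genaff_bij g v.

Lemma genaff_act_linear g : linear (genaff_act g).
Proof. by case/asboolP: (genaffP g) => -[d []]. Qed.

Lemma genaff_act1 v : genaff_act 1%g v = v.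
Proof. by rewrite /genaff_act [genaff_bij _]val1. Qed.

Lemma genaff_actM g h v : genaff_act (g * h)%g v = genaff_act g (genaff_act h v).
Proof. by rewrite /genaff_act [genaff_bij _]valM. Qed.

Definition genaff_action : lin_action GA_oo (Koo K) :=
  LinAction genaff_act_linear genaff_act1 genaff_actM.

Definition sym_act (s : Sym_oo) : Koo K -> Koo K :=
  lin_ext (fun i => evec (sym_bij s i)).

Lemma sym_act_linear s : linear (sym_act s).
Proof. exact: lin_ext_linear. Qed.

Lemma sym_act1 v : sym_act 1%g v = v.
Proof.
by rewrite /sym_act [sym_bij _]val1 [RHS](lin_ext_unique (L := id)).
Qed.

Lemma sym_actM s t v : sym_act (s * t)%g v = sym_act s (sym_act t v).
Proof.
rewrite [RHS](lin_ext_unique (L := sym_act s \o sym_act t)).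
  rewrite /sym_act [sym_bij (s * t)%g]valM; congr (lin_ext _ v).
  by apply/funext => i /=; rewrite !lin_ext_evec.
by move=> c x y; rewrite /= !sym_act_linear.
Qed.

Definition sym_action : lin_action Sym_oo (Koo K) :=
  LinAction sym_act_linear sym_act1 sym_actM.

End GeneralAffine.

Definition Rep_Sym (K : fieldType) : lin_category K :=
  tensorial_category (sym_action K).

Definition Rep_pol_GA (K : fieldType) : lin_category K :=
  tensorial_category (genaff_action K).

(* Main.v *)
Require Import Defs.
From mathcomp Require Import all_boot all_algebra reals complex.
From HB Require Import structures.
From mathcomp Require Import boolp classical_sets functions cardinality.
From mathcomp Require Import ring perm.

(**
For [n >= 0] let [Q n] be V^(x)n as a representation of GA, and [P n] the span in
V^(x)n of the e_s with [s] injective, as a representation of the symmetric group.  On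
both sides Hom([n], [m]) has a basis indexed by the injections [m] -> [n] (contraction
by the invariant functional t in the positions outside the range, resp. restriction of
s), so the [P n] and the [Q n] span the same category, the linearization of FI^op.
Moreover on both sides these objects are injective and every object embeds in a finite
sum of them.  Hence M |-> Hom_FI(Hom(M, P), Q) is an equivalence, with quasi-inverse
N |-> Hom_FI(Hom(N, Q), P).

For GA, injectivity reduces to linear algebra: a morphism to [Q n] is determined by one
coefficient, which is a functional on a multilinear weight space, and such functionals
extend.  That enough morphisms exist follows by polarization.  For the symmetric group,
a morphism to [P n] is again determined by one coefficient, a functional invariant under
the permutations fixing 0, ..., n-1.  Averaging over permutations of n, ..., N-1 shows
that it is a combination of functionals "sum of the coefficients x_s over the s with
given kernel and given values at given places", and moving labels far away removes those
that do not come from morphisms to [P n].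
*)

(** The axioms of [fi_model] involve only finitely many functionals at a time. Injectivity says that
    a morphism vanishing on the common kernel of finitely many others factors through them jointly,
    as for linear functionals. Separation says that a vector satisfying every relation valid on the
    image of N lies in that image; this is the embedding of quotients in element form, and it makes
    M exhaust its double dual.

    For GA the obstacle is the label 0: 1 + c E_jp preserves t only for j > 0, so only nonzero
    labels can be weighed or replaced, while 0 is the label that contraction by t evaluates. A
    single coefficient suffices for multilinear weights only; repeated labels have to be split
    first. For the symmetric group there is no torus, and some invariant functionals constrain only
    part of the n labels. Finite support of the values of a morphism is what rules these out.
    Characteristic 0 enters through interpolation, polarization and averaging. *)

Set Implicit Arguments.
Unset Strict Implicit.
Unset Printing Implicit Defensive.

Import GRing.Theory.
Local Open Scope ring_scope.

(** * Linear algebra *)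

Section LinearAlgebra.
Variable K : fieldType.
Implicit Types (N V : lmodType K).

Lemma scalar0 N (f : N -> K) : scalar f -> f 0 = 0.
Proof. by move=> fl; have := fl (- 1) 0 0; rewrite scaler0 addr0 mulN1r addNr. Qed.

Lemma scalarB N (f : N -> K) u v : scalar f -> f (u - v) = f u - f v.
Proof.
by move=> fl; rewrite addrC -scaleN1r fl mulN1r addrC.
Qed.

Lemma scalarZ N (f : N -> K) a u : scalar f -> f (a *: u) = a * f u.
Proof. by move=> fl; have := fl a u 0; rewrite (scalar0 fl) !addr0. Qed.

Lemma scalar_big N (f : N -> K) I (r : seq I) (P : pred I) (c : I -> K) (F : I -> N) :
  scalar f ->
  f (\sum_(i <- r | P i) c i *: F i) = \sum_(i <- r | P i) c i * f (F i).
Proof.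
move=> fl; elim/big_rec2: _ => [|i u v _ <-]; first exact: scalar0.
by rewrite fl.
Qed.

(** Elimination on the list of functionals, so [N] may have infinite dimension. If some x0 is killed
    by the others but not by [l i0], subtracting a multiple of [l i0] makes [lam] vanish at x0 and
    reduces to the rest; otherwise [l i0] already vanishes where the others do. *)
Lemma scalar_combination N (I : finType) (l : I -> N -> K) (lam : N -> K) :
  (forall i, scalar (l i)) -> scalar lam ->
  (forall x, (forall i, l i x = 0) -> lam x = 0) ->
  exists c : I -> K, forall x, lam x = \sum_i c i * l i x.
Proof.
move=> ll lamL lamK.
suff H (s : seq I) : uniq s -> forall lam : N -> K, scalar lam ->
    (forall x, (forall i, i \in s -> l i x = 0) -> lam x = 0) ->
    exists c : I -> K, forall x, lam x = \sum_(i <- s) c i * l i x.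
  have [|c cE] := H (index_enum I) (index_enum_uniq I) lam lamL; last by exists c.
  by move=> x lx; apply: lamK => i; apply: lx; exact: mem_index_enum.
elim: s {lam lamL lamK} => [_|i0 s IH /= /andP[i0s us]] lam lamL lamK.
  by exists (fun=> 0) => x; rewrite big_nil; apply: lamK.
have [[x0 [x0s x0n]]|nox] := pselect (exists x0,
    (forall i, i \in s -> l i x0 = 0) /\ l i0 x0 <> 0); last first.
  have [|c cE] := IH us lam lamL.
    move=> x xs; apply: lamK => i; rewrite inE => /predU1P[->|]; last exact: xs.
    by apply: contrapT => lx; case: nox; exists x.
  exists (fun i => if i == i0 then 0 else c i) => x.
  rewrite cE big_cons eqxx mul0r add0r; apply: eq_big_seq => i si.
  by case: eqP si i0s => // -> ->.
pose a := lam x0 / l i0 x0.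
have lami : scalar (fun x => lam x - a * l i0 x).
  by move=> b u v; rewrite lamL ll; rewrite mulrDr mulrBr opprD addrACA mulrCA.
have [|c cE] := IH us _ lami.
  move=> x xs; pose y := x - (l i0 x / l i0 x0) *: x0.
  have x0n' : l i0 x0 != 0 by apply/eqP.
  have ly : lam y = 0.
    apply: lamK => i; rewrite inE => /predU1P[->|si].
      by rewrite scalarB // scalarZ // divfK // subrr.
    by rewrite scalarB // scalarZ // (xs i si) (x0s i si) mulr0 subr0.
  move: ly; rewrite scalarB // scalarZ // => /eqP; rewrite subr_eq0 => /eqP ->.
  by rewrite /a; field.
exists (fun i => if i == i0 then a else c i) => x; rewrite big_cons eqxx.
rewrite -[lam x](subrK (a * l i0 x)) cE addrC; congr (_ + _).
by apply: eq_big_seq => i si; case: eqP si i0s => // -> ->.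
Qed.

(* Dual form: apply [scalar_combination] to [N x K], with [t] as the functional. *)
Lemma scalar_separation N (I : finType) (l : I -> N -> K) (w : I -> K) :
  (forall i, scalar (l i)) ->
  (forall c : I -> K, (forall x, \sum_i c i * l i x = 0) -> \sum_i c i * w i = 0) ->
  exists x, forall i, l i x = w i.
Proof.
move=> ll H; apply: contrapT => nox.
(* On the common zeros of the [l'], a nonzero second component would yield a solution. So that
   component is a combination of the [l']; its values at (x, 0) and (0, 1) then contradict [H]. *)
pose l' i (p : (N * K^o)%type) := l i p.1 - p.2 * w i.
have [|//|p pl|c cE] := @scalar_combination (N * K^o)%type I l' (fun p => p.2).
- move=> i a u v; rewrite /l' /= ll mulrDl -[a *: _]/(a * u.2) mulrBr mulrA opprD.
  by rewrite addrACA.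
- have [//|p2] := eqVneq p.2 0; case: nox; exists (p.2^-1 *: p.1) => i.
  have := pl i; rewrite /l' => /eqP; rewrite subr_eq0 => /eqP E.
  by rewrite scalarZ // E mulKf.
have c0 x : \sum_i c i * l i x = 0.
  transitivity (\sum_i c i * l' i (x, 0)); last by rewrite -cE.
  by apply: eq_bigr => i _; rewrite /l' /= mul0r subr0.
have /eqP := cE (0, 1); rewrite /l' /=.
under eq_bigr => i _ do rewrite scalar0 // mul1r sub0r mulrN.
by rewrite sumrN H // oppr0 oner_eq0.
Qed.

Fixpoint in_span V (e : seq V) (v : V) : Prop :=
  if e is x :: e' then exists c, in_span e' (v - c *: x) else v = 0.

Lemma in_spanD V (e : seq V) a u v :
  in_span e u -> in_span e v -> in_span e (a *: u + v).
Proof.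
elim: e u v => [|x e IH] u v /=; first by move=> -> ->; rewrite scaler0 addr0.
move=> [c uc] [d vd]; exists (a * c + d).
suff -> : a *: u + v - (a * c + d) *: x = a *: (u - c *: x) + (v - d *: x).
  exact: IH.
by rewrite scalerBr scalerDl opprD scalerA addrACA.
Qed.

Lemma in_span0 V (e : seq V) : in_span e 0.
Proof. by elim: e => //= x e IH; exists 0; rewrite scale0r subr0. Qed.

Lemma in_span_comb V (e : seq V) (v : V) :
  in_span e v -> exists c : 'I_(size e) -> K, v = \sum_i c i *: e`_i.
Proof.
elim: e v => [|x e IH] v /=; first by move=> ->; exists (fun=> 0); rewrite big_ord0.
move=> [c /IH[d dE]].
exists (fun i => if unlift ord0 i is Some j then d j else c).
rewrite big_ord_recl unlift_none /= -[LHS](subrK (c *: x)) dE addrC; congr (_ + _).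
by apply: eq_bigr => i _; rewrite liftK.
Qed.

(** Elimination of x: one element of [R] with a nonzero coefficient at x, if there is one, reduces
    all others to the intersection of [R] with the span of [e]. The list may be dependent, so the
    coefficient is that of some expression. *)
Lemma span_subspace V (e : seq V) (R : V -> Prop) :
  R 0 -> (forall a u v, R u -> R v -> R (a *: u + v)) ->
  (forall v, R v -> in_span e v) ->
  exists rs : seq V, (forall i : 'I_(size rs), R rs`_i) /\ (forall v, R v -> in_span rs v).
Proof.
elim: e R => [|x e IH] R R0 RD Re.
  by exists [::]; split=> //; case.
have RB a u v : R u -> R v -> R (v - a *: u) by move=> *; rewrite addrC -scaleNr; exact: RD.
pose R' v := R v /\ in_span e v.
have [|||rs [rsR rsS]] := IH R'; first by split=> //; exact: in_span0.
- by move=> a u v [? ?] [? ?]; split; [exact: RD|exact: in_spanD].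
- by move=> v [].
have [[r0 [r0R [c [c0 r0c]]]]|nor] := pselect (exists r0, R r0 /\ exists c, c <> 0 /\
    in_span e (r0 - c *: x)); last first.
  exists rs; split=> [i|v Rv]; first by have [] := rsR i.
  apply: rsS; split=> //; have [c vc] := Re _ Rv.
  have [c0|/eqP c0] := eqVneq c 0; first by move: vc; rewrite c0 scale0r subr0.
  by case: nor; exists v; split=> //; exists c.
exists (r0 :: rs); split.
  by case=> -[|i] //= ir; have [] := rsR (Ordinal (ir : (i < size rs)%N)).
move=> v Rv; have [d vd] := Re _ Rv; exists (d / c); apply: rsS; split; first exact: RB.
suff -> : v - (d / c) *: r0 = (- (d / c)) *: (r0 - c *: x) + (v - d *: x).
  exact: in_spanD.
rewrite scalerBr scalerA mulNr divfK; last exact/eqP.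
by rewrite !scaleNr opprK addrACA subrr addr0 addrC.
Qed.

End LinearAlgebra.

HB.instance Definition _ (K : fieldType) (G : groupType) (M N : rep K G) (f : rep_hom M N) :=
  GRing.isLinear.Build K M N *:%R f (rep_hom_linear f).

(** * Products and subobjects of representations *)

Section DependentProduct.
Variables (K : fieldType) (I : Type) (V : I -> lmodType K).

(** The index type is unrestricted because [nat_family] lives in a product over all morphisms from a
    representation to the generators. *)
Definition dprod := forall i, V i.

HB.instance Definition _ := gen_eqMixin dprod.
HB.instance Definition _ := gen_choiceMixin dprod.

Definition dprod_add (x y : dprod) : dprod := fun i => x i + y i.
Definition dprod_opp (x : dprod) : dprod := fun i => - x i.
Definition dprod_zero : dprod := fun=> 0.
Definition dprod_scale (a : K) (x : dprod) : dprod := fun i => a *: x i.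

Lemma dprod_ext (x y : dprod) : (forall i, x i = y i) -> x = y.
Proof. exact: functional_extensionality_dep. Qed.

Lemma dprod_addA : associative dprod_add.
Proof. by move=> x y z; apply: dprod_ext => i; exact: addrA. Qed.
Lemma dprod_addC : commutative dprod_add.
Proof. by move=> x y; apply: dprod_ext => i; exact: addrC. Qed.
Lemma dprod_add0 : left_id dprod_zero dprod_add.
Proof. by move=> x; apply: dprod_ext => i; exact: add0r. Qed.
Lemma dprod_addN : left_inverse dprod_zero dprod_opp dprod_add.
Proof. by move=> x; apply: dprod_ext => i; exact: addNr. Qed.
HB.instance Definition _ :=
  GRing.isZmodule.Build dprod dprod_addA dprod_addC dprod_add0 dprod_addN.

Lemma dprod_scaleA a b x : dprod_scale a (dprod_scale b x) = dprod_scale (a * b) x.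
Proof. by apply: dprod_ext => i; exact: scalerA. Qed.
Lemma dprod_scale1 : left_id 1 dprod_scale.
Proof. by move=> x; apply: dprod_ext => i; exact: scale1r. Qed.
Lemma dprod_scaleDr : right_distributive dprod_scale +%R.
Proof. by move=> a x y; apply: dprod_ext => i; exact: scalerDr. Qed.
Lemma dprod_scaleDl x : {morph dprod_scale^~ x : a b / a + b}.
Proof. by move=> a b; apply: dprod_ext => i; exact: scalerDl. Qed.
HB.instance Definition _ := GRing.Zmodule_isLmodule.Build K dprod
  dprod_scaleA dprod_scale1 dprod_scaleDr dprod_scaleDl.

End DependentProduct.

Section RepConstructions.
Variables (K : fieldType) (G : groupType).
Implicit Types M N : rep K G.

Lemma rep_homD M N (f h : rep_hom M N) x : (f + h) x = f x + h x.
Proof. by []. Qed.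

Lemma rep_homZ M N a (f : rep_hom M N) x : (a *: f) x = a *: f x.
Proof. by []. Qed.

Lemma rep_hom_scale M N (f : rep_hom M N) a x : f (a *: x) = a *: f x.
Proof. exact: linearZ. Qed.

Lemma rep_hom_bigsum M N (f : rep_hom M N) I (r : seq I) (P : pred I) (F : I -> M) :
  f (\sum_(i <- r | P i) F i) = \sum_(i <- r | P i) f (F i).
Proof. exact: linear_sum. Qed.

Lemma rep_hom0 M N x : (0 : rep_hom M N) x = 0.
Proof. by []. Qed.

Lemma rep_hom_sum M N I (r : seq I) (P : pred I) (F : I -> rep_hom M N) x :
  (\sum_(i <- r | P i) F i) x = \sum_(i <- r | P i) F i x.
Proof. by elim/big_rec2: _ => [|i u v _ <-]. Qed.

Definition mk_rep_hom M N (f : M -> N) (fl : linear f)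
    (fe : forall g v, f (raction M g v) = raction N g (f v)) : rep_hom M N :=
  @RepHom K G M N f (introT (asboolP _) (conj fl fe)).

Section Product.
Variables (I : Type) (M : I -> rep K G).

Definition dprod_action (g : G) (x : dprod (fun i => M i : lmodType K)) :
  dprod (fun i => M i : lmodType K) := fun i => raction (M i) g (x i).

Lemma dprod_action_linear g : linear (dprod_action g).
Proof. by move=> a u v; apply: dprod_ext => i; exact: lact_linear. Qed.
Lemma dprod_action1 x : dprod_action 1%g x = x.
Proof. by apply: dprod_ext => i; exact: lact1. Qed.
Lemma dprod_actionM g h x : dprod_action (g * h)%g x = dprod_action g (dprod_action h x).
Proof. by apply: dprod_ext => i; exact: lactM. Qed.

Definition dprod_rep : rep K G :=
  @Rep K G (dprod (fun i => M i : lmodType K))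
    (LinAction dprod_action_linear dprod_action1 dprod_actionM).

Definition dprod_proj i : rep_hom dprod_rep (M i) :=
  @mk_rep_hom dprod_rep (M i) (fun x : dprod _ => x i)
    (fun _ _ _ => erefl) (fun _ _ => erefl).

Definition dprod_map N (u : forall i, rep_hom N (M i)) : rep_hom N dprod_rep.
Proof.
refine (@mk_rep_hom N dprod_rep (fun x => (fun i => u i x) : dprod _) _ _).
- by move=> a x y; apply: dprod_ext => i; exact: rep_hom_linear.
- by move=> g x; apply: dprod_ext => i; exact: rep_hom_equiv.
Defined.

End Product.

Record subrep_pred M := SubrepPred {
  in_sub :> M -> Prop;
  in_sub0 : in_sub 0;
  in_subD : forall a u v, in_sub u -> in_sub v -> in_sub (a *: u + v);
  in_sub_act : forall g v, in_sub v -> in_sub (raction M g v) }.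

Section Subrep.
Variables (M : rep K G) (S : subrep_pred M).

Definition sub_pred : pred M := fun x => `[< S x >].

Record subrep_type := SubrepType { subrep_val :> M; subrep_valP : sub_pred subrep_val }.

HB.instance Definition _ := [isSub for subrep_val].
HB.instance Definition _ := [Choice of subrep_type by <:].

Lemma sub_pred_closed : submod_closed sub_pred.
Proof.
split; first by apply/asboolP; exact: in_sub0.
by move=> a u v /asboolP Su /asboolP Sv; apply/asboolP; exact: in_subD.
Qed.

HB.instance Definition _ :=
  GRing.SubChoice_isSubLmodule.Build K M _ subrep_type sub_pred_closed.

Lemma subrepP (x : subrep_type) : S (subrep_val x).
Proof. exact/asboolP/subrep_valP. Qed.

Definition mk_sub x (Sx : S x) : subrep_type := SubrepType (introT (asboolP _) Sx).

Definition subrep_act (g : G) (x : subrep_type) : subrep_type :=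
  mk_sub (in_sub_act g (subrepP x)).

Lemma subrep_act_linear g : linear (subrep_act g).
Proof. by move=> a u v; apply: val_inj; exact: lact_linear. Qed.
Lemma subrep_act1 x : subrep_act 1%g x = x.
Proof. by apply: val_inj; exact: lact1. Qed.
Lemma subrep_actM g h x : subrep_act (g * h)%g x = subrep_act g (subrep_act h x).
Proof. by apply: val_inj; exact: lactM. Qed.

Definition subrep : rep K G :=
  @Rep K G subrep_type (LinAction subrep_act_linear subrep_act1 subrep_actM).

Definition subrep_inc : rep_hom subrep M :=
  @mk_rep_hom subrep M subrep_val (fun _ _ _ => erefl) (fun _ _ => erefl).

Lemma subrep_inc_inj : injective subrep_inc.
Proof. exact: val_inj. Qed.

Definition corestrict N (f : rep_hom N M) (fS : forall x, S (f x)) : rep_hom N subrep.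
Proof.
refine (@mk_rep_hom N subrep (fun x => mk_sub (fS x)) _ _).
- by move=> a u v; apply: val_inj; exact: rep_hom_linear.
- by move=> g v; apply: val_inj; exact: rep_hom_equiv.
Defined.

End Subrep.

Definition ker_pred M N (f : rep_hom M N) : subrep_pred M.
Proof.
refine (@SubrepPred M (fun x => f x = 0) (linear0 _) _ _).
- by move=> a u v /= fu fv; rewrite rep_hom_linear fu fv scaler0 addr0.
- by move=> g v /= fv; rewrite rep_hom_equiv fv linear0.
Defined.

(* A list of pairs (a, g) stands for the element sum a g of the group algebra K[G]. *)
Definition gring_act M (r : seq (K * G)) (x : M) : M :=
  \sum_(p <- r) p.1 *: raction M p.2 x.

Lemma gring_act_hom M N (f : rep_hom M N) r x :
  f (gring_act r x) = gring_act r (f x).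
Proof.
rewrite /gring_act linear_sum; apply: eq_bigr => p _.
by rewrite linearZ /= rep_hom_equiv.
Qed.

Lemma gring_actP M r (a : K) (x y : M) :
  gring_act r (a *: x + y) = a *: gring_act r x + gring_act r y.
Proof.
rewrite /gring_act scaler_sumr -big_split; apply: eq_bigr => p _ /=.
by rewrite linearP scalerDr !scalerA mulrC.
Qed.

Lemma gring_act_cat M r s (x : M) :
  gring_act (r ++ s) x = gring_act r x + gring_act s x.
Proof. by rewrite /gring_act big_cat. Qed.

Lemma gring_act_scale M a r (x : M) :
  gring_act [seq (a * p.1, p.2) | p <- r] x = a *: gring_act r x.
Proof.
by rewrite /gring_act big_map scaler_sumr; apply: eq_bigr => p _; rewrite scalerA.
Qed.

Lemma gring_act_mul M r s (x : M) :
  gring_act [seq (p.1 * q.1, (p.2 * q.2)%g) | p <- r, q <- s] x =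
  gring_act r (gring_act s x).
Proof.
rewrite /gring_act big_allpairs_dep; apply: eq_bigr => p _.
rewrite linear_sum scaler_sumr; apply: eq_bigr => q _ /=.
by rewrite lactM linearZ scalerA.
Qed.

Lemma gring_act1 M g (x : M) : gring_act [:: (1, g)] x = raction M g x.
Proof. by rewrite /gring_act big_seq1 scale1r. Qed.

End RepConstructions.

Section HomComposition.
Variables (K : fieldType) (G : groupType).
Implicit Types M N P : rep K G.

Lemma rep_compDl M N P (g h : rep_hom N P) (f : rep_hom M N) a :
  rep_comp (a *: g + h) f = a *: rep_comp g f + rep_comp h f.
Proof. exact: rep_hom_ext. Qed.

Lemma rep_comp_suml M N P I (r : seq I) (Q : pred I) (c : I -> K)
    (e : I -> rep_hom N P) (f : rep_hom M N) :
  rep_comp (\sum_(i <- r | Q i) c i *: e i) f =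
  \sum_(i <- r | Q i) c i *: rep_comp (e i) f.
Proof. by apply: rep_hom_ext => x /=; rewrite !rep_hom_sum. Qed.

Lemma rep_comp_sumr M N P I (r : seq I) (Q : pred I) (c : I -> K)
    (e : I -> rep_hom M N) (f : rep_hom N P) :
  rep_comp f (\sum_(i <- r | Q i) c i *: e i) =
  \sum_(i <- r | Q i) c i *: rep_comp f (e i).
Proof.
apply: rep_hom_ext => x /=; rewrite !rep_hom_sum linear_sum.
by apply: eq_bigr => i _; rewrite /= linearZ.
Qed.

Lemma rep_compA M N P Q (h : rep_hom P Q) (g : rep_hom N P) (f : rep_hom M N) :
  rep_comp h (rep_comp g f) = rep_comp (rep_comp h g) f.
Proof. exact: rep_hom_ext. Qed.

Lemma in_span_bigsum (V : lmodType K) (e : seq V) I (r : seq I) (Q : pred I) (F : I -> V) :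
  (forall i, Q i -> in_span e (F i)) -> in_span e (\sum_(i <- r | Q i) F i).
Proof.
move=> eF; elim/big_ind: _ => //; first exact: in_span0.
by move=> x y xe ye; rewrite -[x]scale1r; exact: in_spanD.
Qed.

Lemma in_spanZ (V : lmodType K) (e : seq V) a v : in_span e v -> in_span e (a *: v).
Proof. by move=> ev; rewrite -[_ *: _]addr0; apply: in_spanD => //; exact: in_span0. Qed.

Lemma in_span_mem (V : lmodType K) (e : seq V) v : v \in e -> in_span e v.
Proof.
elim: e => //= x e IH; rewrite inE => /predU1P[->|/IH ve].
  by exists 1; rewrite scale1r subrr; exact: in_span0.
by exists 0; rewrite scale0r subr0.
Qed.

Lemma sum_dfwith (I : finType) (V : I -> lmodType K) (W : lmodType K)
    (h : forall i, V i -> W) (h0 : forall i, h i 0 = 0) a (q : V a) :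
  \sum_i h i (dfwith (fun i => 0 : V i) q i) = h a q.
Proof.
rewrite (bigD1 a) //= dfwith_in big1 ?addr0 // => i ia.
by rewrite dfwith_out 1?eq_sym // h0.
Qed.

(** Each [R n] lies in a finitely generated space of morphisms and only n < B matter, so finitely
    many generators test for all. This turns infinite systems of relations into finite families, the
    only kind that [fi_model] speaks of. *)
Lemma finite_subfamily (W : rep K G) (P : nat -> rep K G) (e : forall n, seq (rep_hom W (P n)))
    (R : forall n, rep_hom W (P n) -> Prop) (B : nat) :
  (forall n, R n 0) ->
  (forall n a u v, R n u -> R n v -> R n (a *: u + v)) ->
  (forall n v, R n v -> in_span (e n) v) ->
  (forall n v, (B <= n)%N -> R n v -> v = 0) ->
  exists (J : finType) (l : J -> nat) (r : forall b, rep_hom W (P (l b))),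
    (forall b, R (l b) (r b)) /\
    (forall q, (forall b, r b q = 0) -> forall n v, R n v -> v q = 0).
Proof.
move=> R0 RD Re RB.
pose rs n := sval (cid (span_subspace (R0 n) (@RD n) (Re n))).
have rsP n : (forall i : 'I_(size (rs n)), R n (rs n)`_i) /\
    (forall v, R n v -> in_span (rs n) v) := svalP (cid (span_subspace (R0 n) (@RD n) (Re n))).
pose J : finType := {n : 'I_B & 'I_(size (rs n))}.
exists J, (fun b : J => nat_of_ord (tag b)), (fun b : J => (rs (tag b))`_(tagged b)).
split=> [b|q rq n v Rv]; first by have [H _] := rsP (tag b); exact: H.
have [nB|Bn] := ltnP n B; last by rewrite (RB n v Bn Rv).
have [c ->] := in_span_comb ((rsP n).2 _ Rv).
rewrite rep_hom_sum big1 // => i _; rewrite rep_homZ.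
by have := rq (@Tagged _ (Ordinal nB) (fun n : 'I_B => 'I_(size (rs n))) i); rewrite /= => ->; rewrite scaler0.
Qed.

End HomComposition.

(** * Equivalences from injective generators *)

Section NaturalIso.
Variables (K : fieldType).

Lemma naturally_isomorphic_sym (C D : lin_category K) (F G : lin_functor C D) :
  naturally_isomorphic F G -> naturally_isomorphic G F.
Proof.
move=> [eta [etaN etaI]]; pose mu A := sval (cid (etaI A)).
have muP A : comp_mor (mu A) (eta A) = id_mor (F A) /\ comp_mor (eta A) (mu A) = id_mor (G A).
  exact: svalP (cid (etaI A)).
exists mu; split=> [A B f|A]; last first.
  by exists (eta A); have [? ?] := muP A.
have [mA1 mA2] := muP A; have [mB1 mB2] := muP B.
have E : comp_mor (comp_mor (mu B) (fmap G f)) (eta A) = fmap F f.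
  by rewrite -Defs.compA -etaN Defs.compA mB1 comp1m.
by rewrite -E -Defs.compA mA2 compm1.
Qed.

Lemma bijective_rep_iso (G : groupType) (M N : rep K G) (f : rep_hom M N) :
  injective f -> (forall y, exists x, f x = y) ->
  exists g : rep_hom N M, rep_comp g f = rep_id M /\ rep_comp f g = rep_id N.
Proof.
move=> fi fs; have [g gK] := choice fs.
have gl : linear g by move=> a u v; apply: fi; rewrite rep_hom_linear !gK.
have ge h v : g (raction N h v) = raction M h (g v).
  by apply: fi; rewrite rep_hom_equiv !gK.
exists (mk_rep_hom gl ge); split; apply: rep_hom_ext => x /=; last exact: gK.
by apply: fi; rewrite gK.
Qed.

End NaturalIso.

(* [gen n] plays the role of the injective object of Rep attached to the n-th
   principal injective FI-module: Hom([gen n], [gen m]) has a basis indexed by the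
   injections [m] -> [n]. *)
Record fi_model (K : fieldType) (G : groupType) (A : rep K G -> Prop) := FiModel {
  gen : nat -> rep K G;
  restr : forall n m, {ffun 'I_m -> 'I_n} -> rep_hom (gen n) (gen m);
  cf : forall n m, {ffun 'I_m -> 'I_n} -> rep_hom (gen n) (gen m) -> K;
  cf_linear : forall n m (j : {ffun 'I_m -> 'I_n}), scalar (cf j);
  cf_expand : forall n m (f : rep_hom (gen n) (gen m)),
    f = \sum_(j : {ffun 'I_m -> 'I_n} | injectiveb j) cf j f *: restr j;
  cf_restr : forall n m (j i : {ffun 'I_m -> 'I_n}), injectiveb j -> injectiveb i ->
    cf j (restr i) = (j == i)%:R;
  restr_id : forall n, restr [ffun i : 'I_n => i] = rep_id (gen n);
  restr_comp : forall n m p (j : {ffun 'I_m -> 'I_n}) (i : {ffun 'I_p -> 'I_m}),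
    injectiveb j -> injectiveb i ->
    rep_comp (restr i) (restr j) = restr [ffun x => j (i x)];
  gen_injective : forall (I : finType) (k : I -> nat) N
      (u : forall a, rep_hom N (gen (k a))) n (f : rep_hom N (gen n)),
    (forall x, (forall a, u a x = 0) -> f x = 0) ->
    exists F : forall a, rep_hom (gen (k a)) (gen n), forall x, f x = \sum_a F a (u a x);
  gen_separating : forall (I : finType) (k : I -> nat) N
      (u : forall a, rep_hom N (gen (k a))) (w : forall a, gen (k a)),
    (forall n (F : forall a, rep_hom (gen (k a)) (gen n)),
       (forall x, \sum_a F a (u a x) = 0) -> \sum_a F a (w a) = 0) ->
    exists x, forall a, u a x = w a;
  gen_embedding : forall M, A M <->
    exists (I : finType) (k : I -> nat) (u : forall a, rep_hom M (gen (k a))),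
      forall x, (forall a, u a x = 0) -> x = 0 }.

Arguments restr {K G A} _ {n m}.
Arguments cf {K G A} _ {n m}.

(** * The isomorphism between the two categories of generators *)

Section Transfer.
Variables (K : fieldType) (G1 G2 : groupType) (A1 : rep K G1 -> Prop) (A2 : rep K G2 -> Prop).
Variables (m1 : fi_model A1) (m2 : fi_model A2).

Definition transfer n m (f : rep_hom (gen m1 n) (gen m1 m)) : rep_hom (gen m2 n) (gen m2 m) :=
  \sum_(j : {ffun 'I_m -> 'I_n} | injectiveb j) cf m1 j f *: restr m2 j.

Lemma transfer_linear n m : linear (@transfer n m).
Proof.
move=> a u v; rewrite /transfer scaler_sumr -big_split; apply: eq_bigr => j _.
by rewrite cf_linear scalerDl scalerA.
Qed.

HB.instance Definition _ n m :=
  GRing.isLinear.Build K _ _ *:%R (@transfer n m) (@transfer_linear n m).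

Lemma transfer_bigsum n m I (r : seq I) (R : pred I) (f : I -> rep_hom (gen m1 n) (gen m1 m)) :
  transfer (\sum_(i <- r | R i) f i) = \sum_(i <- r | R i) transfer (f i).
Proof. exact: linear_sum. Qed.

Lemma transfer_restr n m (j : {ffun 'I_m -> 'I_n}) : injectiveb j ->
  transfer (restr m1 j) = restr m2 j.
Proof.
move=> ji; rewrite /transfer (bigD1 j) //= cf_restr // eqxx scale1r big1 ?addr0 //.
by move=> i /andP[ii ij]; rewrite cf_restr // (negPf ij) scale0r.
Qed.

Lemma transfer_id n : transfer (rep_id (gen m1 n)) = rep_id (gen m2 n).
Proof.
rewrite -!restr_id transfer_restr //.
by apply/injectiveP => x y; rewrite !ffunE.
Qed.

Lemma transfer_comp n m p (g : rep_hom (gen m1 m) (gen m1 p))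
    (f : rep_hom (gen m1 n) (gen m1 m)) :
  transfer (rep_comp g f) = rep_comp (transfer g) (transfer f).
Proof.
rewrite [in LHS](cf_expand g) [in LHS](cf_expand f) {2 3}/transfer.
rewrite !rep_comp_suml linear_sum; apply: eq_bigr => i ii /=.
rewrite linearZ /=; congr (_ *: _).
rewrite !rep_comp_sumr linear_sum; apply: eq_bigr => j ji /=.
rewrite linearZ /=; congr (_ *: _).
rewrite !restr_comp // transfer_restr //.
apply/injectiveP => x y; rewrite !ffunE => E.
exact: (injectiveP _ ii) (injectiveP _ ji _ _ E).
Qed.

End Transfer.

Lemma transferK (K : fieldType) (G1 G2 : groupType) (A1 : rep K G1 -> Prop)
    (A2 : rep K G2 -> Prop) (m1 : fi_model A1) (m2 : fi_model A2) n m :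
  cancel (@transfer _ _ _ _ _ m1 m2 n m) (@transfer _ _ _ _ _ m2 m1 n m).
Proof.
move=> f; rewrite {2}/transfer linear_sum [RHS]cf_expand; apply: eq_bigr => j ji /=.
by rewrite linearZ /= transfer_restr.
Qed.

(** * The functor to FI-linear families and its evaluation maps *)

Section Family.
Variables (K : fieldType) (G1 G2 : groupType) (A1 : rep K G1 -> Prop) (A2 : rep K G2 -> Prop).
Variables (m1 : fi_model A1) (m2 : fi_model A2).
Local Notation P := (gen m1).
Local Notation Q := (gen m2).
Local Notation T := (@transfer _ _ _ _ _ m1 m2 _ _).
Local Notation T' := (@transfer _ _ _ _ _ m2 m1 _ _).

Section Object.
Variable M : rep K G1.

Local Notation idx := {n & rep_hom M (P n)}.
Local Notation fam := (dprod_rep (fun i : idx => Q (tag i))).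

Definition at_hom (th : fam) n (f : rep_hom M (P n)) : Q n :=
  (th : dprod _) (existT (fun n => rep_hom M (P n)) n f).

Definition nat_family_pred : subrep_pred fam.
Proof.
refine (@SubrepPred _ _ fam (fun th =>
  (forall n a (f h : rep_hom M (P n)),
     at_hom th (a *: f + h) = a *: at_hom th f + at_hom th h) /\
  (forall n m (f : rep_hom M (P n)) (g : rep_hom (P n) (P m)),
     at_hom th (rep_comp g f) = T g (at_hom th f))) _ _ _).
- by split=> [n a f h|n m f g]; rewrite /at_hom /= ?linear0 // ?scaler0 ?addr0.
- move=> b u v [ul uc] [vl vc].
  have E n (f : rep_hom M (P n)) : at_hom (b *: u + v) f = b *: at_hom u f + at_hom v f.
    by [].
  split=> [n a f h|n m f g]; rewrite !E.
    by rewrite ul vl !scalerDr !scalerA (mulrC b) addrACA.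
  by rewrite uc vc rep_hom_linear.
- move=> g v [vl vc].
  have E n (f : rep_hom M (P n)) : at_hom (raction fam g v) f = raction (Q n) g (at_hom v f).
    by [].
  split=> [n a f h|n m f h].
    by rewrite !E vl lact_linear.
  by rewrite !E vc rep_hom_equiv.
Defined.

(* The space of FI-linear maps from the FI-module n |-> Hom(M, P n) to n |-> Q n. *)
Definition nat_family : rep K G2 := subrep nat_family_pred.

Definition ev n (f : rep_hom M (P n)) : rep_hom nat_family (Q n) :=
  rep_comp (dprod_proj _ (existT (fun n => rep_hom M (P n)) n f)) (subrep_inc _).

Lemma evD n a (f h : rep_hom M (P n)) : ev (a *: f + h) = a *: ev f + ev h.
Proof. by apply: rep_hom_ext => th; have [H _] := subrepP th; apply: H. Qed.

Lemma ev_comp n m (f : rep_hom M (P n)) (g : rep_hom (P n) (P m)) :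
  ev (rep_comp g f) = rep_comp (T g) (ev f).
Proof. by apply: rep_hom_ext => th; have [_ H] := subrepP th; apply: H. Qed.

HB.instance Definition _ n := GRing.isLinear.Build K _ _ *:%R (@ev n) (@evD n).

Lemma ev_bigsum n I (r : seq I) (R : pred I) (f : I -> rep_hom M (P n)) :
  ev (\sum_(i <- r | R i) f i) = \sum_(i <- r | R i) ev (f i).
Proof. exact: linear_sum. Qed.

Lemma nat_family_ext (s t : nat_family) : (forall n (f : rep_hom M (P n)), ev f s = ev f t) -> s = t.
Proof. by move=> st; apply/val_inj/dprod_ext => -[n f]; exact: st. Qed.

Lemma nat_family_mk (q : forall n, rep_hom M (P n) -> Q n) :
  (forall n a f h, q n (a *: f + h) = a *: q n f + q n h) ->
  (forall n m (f : rep_hom M (P n)) (g : rep_hom (P n) (P m)),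
     q m (rep_comp g f) = T g (q n f)) ->
  exists th, forall n f, @ev n f th = q n f.
Proof.
move=> ql qc; pose th : fam := (fun i : idx => q (tag i) (tagged i)) : dprod _.
have thP : nat_family_pred th by split=> *; [exact: ql|exact: qc].
by exists (mk_sub thP).
Qed.

End Object.

Definition nat_family_map M M' (u : rep_hom M M') : rep_hom (nat_family M) (nat_family M').
Proof.
pose w := @dprod_map _ _ _ (fun i : {n & rep_hom M' (P n)} => Q (tag i)) (nat_family M)
  (fun i => ev (rep_comp (tagged i) u)).
refine (@corestrict _ _ _ (nat_family_pred M') _ w _) => th. split=> [n a f h|n m f g].
  change (ev (rep_comp (a *: f + h) u) th = (a *: ev (rep_comp f u) + ev (rep_comp h u)) th).
  by rewrite rep_compDl evD.
change (ev (rep_comp (rep_comp g f) u) th = rep_comp (T g) (ev (rep_comp f u)) th).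
by rewrite -rep_compA ev_comp.
Defined.

Lemma ev_map M M' (u : rep_hom M M') n (f : rep_hom M' (P n)) th :
  ev f (nat_family_map u th) = ev (rep_comp f u) th.
Proof. by []. Qed.

Section Generated.
Variables (M : rep K G1) (I : finType) (k : I -> nat) (u : forall a, rep_hom M (P (k a))).
Hypothesis u_inj : forall x, (forall a, u a x = 0) -> x = 0.

(** The [u a] embed [M] into a finite sum of generators, and injectivity of [P n] extends [f] to
    that sum. *)
Lemma factor n (f : rep_hom M (P n)) :
  exists F : forall a, rep_hom (P (k a)) (P n), f = \sum_a rep_comp (F a) (u a).
Proof.
have [|F FE] := gen_injective (u := u) (f := f); first by move=> x /u_inj ->; rewrite linear0.
by exists F; apply: rep_hom_ext => x; rewrite FE rep_hom_sum.
Qed.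

Lemma ev_sum n (F : forall a, rep_hom (P (k a)) (P n)) th :
  ev (\sum_a rep_comp (F a) (u a)) th = \sum_a T (F a) (ev (u a) th).
Proof.
by rewrite ev_bigsum rep_hom_sum; apply: eq_bigr => a _; rewrite ev_comp.
Qed.

Lemma nat_family_inj (s t : nat_family M) : (forall a, ev (u a) s = ev (u a) t) -> s = t.
Proof.
move=> st; apply: nat_family_ext => n f; have [F ->] := factor f.
by rewrite !ev_sum; apply: eq_bigr => a _; rewrite st.
Qed.

(* By [factor] the [u a] generate n |-> Hom(M, P n), so an FI-linear map out of it is
   given by values on the [u a] that satisfy their relations. *)
Lemma nat_family_lift (q : forall a, Q (k a)) :
  (forall m (F : forall a, rep_hom (P (k a)) (P m)),
     \sum_a rep_comp (F a) (u a) = 0 -> \sum_a T (F a) (q a) = 0) ->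
  exists th, forall a, ev (u a) th = q a.
Proof.
move=> rel.
have rel2 m (F F' : forall a, rep_hom (P (k a)) (P m)) :
    \sum_a rep_comp (F a) (u a) = \sum_a rep_comp (F' a) (u a) ->
    \sum_a T (F a) (q a) = \sum_a T (F' a) (q a).
  move=> E; apply/eqP; rewrite -subr_eq0 -sumrB.
  rewrite -[X in _ == X](rel m (fun a => F a - F' a)).
    by apply/eqP/eq_bigr => a _; rewrite linearB.
  apply/eqP; rewrite (eq_bigr (fun a => rep_comp (F a) (u a) - rep_comp (F' a) (u a))).
    by rewrite sumrB E subrr.
  by move=> a _; apply: rep_hom_ext.
(* The value at [f] is read from a chosen factorization; [rel2] makes it independent of the choice,
   hence linear and natural. *)
pose Fc n f := sval (cid (@factor n f)).
have FcE n f : f = \sum_a rep_comp (Fc n f a) (u a) := svalP (cid (factor f)).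
have [||th thE] := @nat_family_mk M (fun n f => \sum_a T (Fc n f a) (q a)).
- move=> n a f h; rewrite (rel2 _ _ (fun b => a *: Fc n f b + Fc n h b)).
    rewrite scaler_sumr -big_split; apply: eq_bigr => b _.
    by rewrite linearP.
  rewrite -FcE {1}(FcE _ f) {1}(FcE _ h) scaler_sumr -big_split.
  by apply: eq_bigr => b _; apply: rep_hom_ext.
- move=> n m f g; rewrite (rel2 _ _ (fun b => rep_comp g (Fc n f b))).
    by rewrite linear_sum; apply: eq_bigr => b _; rewrite transfer_comp.
  rewrite -FcE {1}(FcE _ f); apply: rep_hom_ext => x /=.
  by rewrite !rep_hom_sum linear_sum.
exists th => a; rewrite thE.
(* Comparing the chosen factorization of [u a] with this trivial one gives the value [q a]. *)
pose d b : rep_hom (P (k b)) (P (k a)) := dfwith (fun b => 0 : rep_hom (P (k b)) (P (k a))) (rep_id (P (k a))) b.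
rewrite (rel2 _ _ d).
  rewrite (sum_dfwith (h := fun b f => T f (q b))); first by rewrite transfer_id.
  by move=> b; rewrite linear0.
rewrite -FcE (sum_dfwith (h := fun b f => rep_comp f (u b))); first exact: rep_hom_ext.
by move=> b; apply: rep_hom_ext.
Qed.

(** For fixed m the transferred relations form a subspace of a finitely generated space, and for m
    above all [k a] there are no injections, hence no nonzero transfers. Finitely many relations
    therefore imply all. *)
Lemma finite_relations :
  exists (J : finType) (l : J -> nat) (F : forall b a, rep_hom (P (k a)) (P (l b))),
    (forall b, \sum_a rep_comp (F b a) (u a) = 0) /\
    (forall q : forall a, Q (k a),
      (forall b, \sum_a T (F b a) (q a) = 0) ->
      forall m (H : forall a, rep_hom (P (k a)) (P m)),
        \sum_a rep_comp (H a) (u a) = 0 -> \sum_a T (H a) (q a) = 0).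
Proof.
pose W := dprod_rep (fun a => Q (k a)).
pose pr a : rep_hom W (Q (k a)) := dprod_proj _ a.
pose tot m (H : forall a, rep_hom (P (k a)) (P m)) : rep_hom W (Q m) :=
  \sum_a rep_comp (T (H a)) (pr a).
pose R m (v : rep_hom W (Q m)) :=
  exists H, \sum_a rep_comp (H a) (u a) = 0 /\ v = tot m H.
pose e m : seq (rep_hom W (Q m)) :=
  [seq rep_comp (restr m2 (tagged x)) (pr (tag x)) | x : {a : I & {ffun 'I_m -> 'I_(k a)}}].
have [||||J [l [r [rR rK]]]] := @finite_subfamily _ _ W Q e R (\max_a k a).+1.
- move=> m; exists (fun=> 0); split; first by rewrite big1 // => a _; apply: rep_hom_ext.
  rewrite /tot big1 // => a _.
  by apply: rep_hom_ext => x; rewrite /= linear0.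
- move=> m a v v' [H [H0 ->]] [H' [H'0 ->]]; exists (fun b => a *: H b + H' b); split.
    transitivity (a *: (\sum_b rep_comp (H b) (u b)) + \sum_b rep_comp (H' b) (u b)).
      rewrite scaler_sumr -big_split; apply: eq_bigr => b _; exact: rep_hom_ext.
    by rewrite H0 H'0 scaler0 addr0.
  rewrite /tot scaler_sumr -big_split; apply: eq_bigr => b _; rewrite linearP.
  exact: rep_hom_ext.
- move=> m v [H [_ ->]]; rewrite /tot; apply: in_span_bigsum => a _.
  rewrite /transfer rep_comp_suml; apply: in_span_bigsum => j _.
  apply/in_spanZ/in_span_mem/mapP.
  by exists (Tagged (fun a => {ffun 'I_m -> 'I_(k a)}) j); rewrite ?mem_enum.
- move=> m v Bm [H [_ ->]]; rewrite /tot big1 // => a _.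
  apply: rep_hom_ext => q /=; rewrite /transfer rep_hom_sum big1 // => j ji.
  have /leq_card := injectiveP _ ji; rewrite !card_ord => mk.
  have: (m < (\max_a k a).+1)%N by rewrite ltnS; apply: leq_trans mk (leq_bigmax a).
  by rewrite ltnNge Bm.
exists J, l, (fun b => sval (cid (rR b))); split.
  by move=> b; have [] := svalP (cid (rR b)).
move=> q qr m H H0; pose qW : W := (q : dprod (fun a => Q (k a) : lmodType K)).
have <- : tot m H qW = \sum_a T (H a) (q a) by rewrite rep_hom_sum.
apply: (rK qW) => [b|]; last by exists H.
by have [_ ->] := svalP (cid (rR b)); rewrite rep_hom_sum; exact: qr.
Qed.

(** By [finite_relations] and [nat_family_lift] the families are the common kernel of finitely many
    relations [r b] in the sum of the [Q (k a)]. The transferred factorization [g] of [f] vanishes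
    there, so injectivity of [Q n] writes it through the [r b]; transferring back writes [f] through
    relations that hold in [M]. *)
Lemma ev_eq0 n (f : rep_hom M (P n)) : ev f = 0 -> f = 0.
Proof.
move=> evf; have [c cE] := factor f.
have [J [l [F [F0 Fgen]]]] := finite_relations.
pose W := dprod_rep (fun a => Q (k a)).
pose pr a : rep_hom W (Q (k a)) := dprod_proj _ a.
pose r b : rep_hom W (Q (l b)) := \sum_a rep_comp (T (F b a)) (pr a).
pose g : rep_hom W (Q n) := \sum_a rep_comp (T (c a)) (pr a).
have gE (q : W) : g q = \sum_a T (c a) ((q : dprod _) a) by rewrite rep_hom_sum.
have rE b (q : W) : r b q = \sum_a T (F b a) ((q : dprod _) a) by rewrite rep_hom_sum.
have [|D DE] := gen_injective (u := r) (f := g).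
  move=> q rq; rewrite gE.
  have [|th thE] := @nat_family_lift (q : dprod _).
    by move=> m H; apply: Fgen => b; rewrite -[RHS](rq b) rE.
  transitivity (\sum_a T (c a) (ev (u a) th)).
    by apply: eq_bigr => a _; rewrite thE.
  by rewrite -ev_sum -cE evf.
have TcE a : T (c a) = \sum_b rep_comp (D b) (T (F b a)).
  apply: rep_hom_ext => q; rewrite rep_hom_sum.
  pose q' : W := (fun b => dfwith (fun a => 0 : Q (k a)) q b) : dprod _.
  transitivity (g q').
    by rewrite gE (sum_dfwith (h := fun b x => T (c b) x)) // => b; rewrite linear0.
  rewrite DE; apply: eq_bigr => b _; rewrite rE.
  by rewrite (sum_dfwith (h := fun a x => T (F b a) x)) // => b'; rewrite linear0.
rewrite cE (eq_bigr (fun a => \sum_b rep_comp (T' (D b)) (rep_comp (F b a) (u a)))).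
  rewrite exchange_big big1 // => b _.
  apply: rep_hom_ext => x; rewrite rep_hom_sum rep_hom0.
  transitivity (T' (D b) ((\sum_a rep_comp (F b a) (u a)) x)).
    by rewrite rep_hom_sum linear_sum.
  by rewrite F0 rep_hom0 linear0.
move=> a _; rewrite -[c a](transferK m2 (c a)) TcE transfer_bigsum.
apply: rep_hom_ext => x; rewrite /= !rep_hom_sum; apply: eq_bigr => b _.
by rewrite /= transfer_comp transferK.
Qed.

(** The [ev (u a)] embed [nat_family M], so injectivity of [Q n] factors [phi] through them; the
    factors transfer back to morphisms between the [P]. *)
Lemma ev_surj n (phi : rep_hom (nat_family M) (Q n)) : exists f, ev f = phi.
Proof.
have [|F FE] := gen_injective (u := fun a => ev (u a)) (f := phi).
  move=> th th0; suff -> : th = 0 by rewrite linear0.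
  by apply: nat_family_inj => a; rewrite th0 linear0.
exists (\sum_a rep_comp (T' (F a)) (u a)); apply: rep_hom_ext => th.
rewrite ev_sum FE; apply: eq_bigr => a _.
by rewrite -[in RHS](transferK m1 (F a)).
Qed.

End Generated.

Lemma nat_family_in M : A1 M -> A2 (nat_family M).
Proof.
move=> /(gen_embedding m1)[I [k [u ui]]]; apply/(gen_embedding m2).
exists I, k, (fun a => ev (u a)) => th th0.
by apply: (nat_family_inj ui) => a; rewrite th0 linear0.
Qed.

Definition nat_family_functor : lin_functor (rep_category A1) (rep_category A2).
Proof.
refine (@LinFunctor K (rep_category A1) (rep_category A2)
  (fun M => exist _ (nat_family (sval M)) (nat_family_in (svalP M)))
  (fun M N (f : rep_hom (sval M) (sval N)) => nat_family_map f) _ _ _).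
- move=> M; apply: rep_hom_ext => th; apply: nat_family_ext => n f.
  by rewrite ev_map; congr (ev _ th); apply: rep_hom_ext.
- move=> M N L g f; apply: rep_hom_ext => th; apply: nat_family_ext => n h.
  by rewrite ev_map -[RHS]/(ev (rep_comp (rep_comp h g) f) th); congr (ev _ th); apply: rep_hom_ext.
- move=> M N a f h; apply: rep_hom_ext => th; apply: nat_family_ext => n l.
  rewrite ev_map.
  have -> : rep_comp l (a *: f + h) = a *: rep_comp l f + rep_comp l h :> rep_hom (sval M) (P n).
    by apply: rep_hom_ext => x /=; rewrite linearP.
  by rewrite evD [RHS]linearP.
Defined.

End Family.

(** * Biduality and the natural isomorphism *)

Section Unit.
Variables (K : fieldType) (G1 G2 : groupType) (A1 : rep K G1 -> Prop) (A2 : rep K G2 -> Prop).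
Variables (m1 : fi_model A1) (m2 : fi_model A2).
Local Notation P := (gen m1).
Local Notation Q := (gen m2).
Local Notation F1 := (nat_family m1 m2).
Local Notation F2 := (nat_family m2 m1).

(** Since [ev] is bijective on morphisms to generators, x defines the family sending [ev f] to
    [f x]. For surjectivity, the values of y on the [ev (u a)] satisfy every relation among the
    [u a], so [gen_separating] realizes them by an x. *)
Lemma double_dual (M : rep K G1) : A1 M ->
  exists eta : rep_hom M (F2 (F1 M)),
    (forall n (f : rep_hom M (P n)) x,
       ev m1 (ev m2 f) (eta x) = f x) /\
    injective eta /\ (forall y, exists x, eta x = y).
Proof.
move=> /(gen_embedding m1)[I [k [u ui]]].
pose dual n phi : rep_hom M (P n) := sval (cid (@ev_surj _ _ _ _ _ m1 m2 M I k u ui n phi)).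
have dualK n phi : ev m2 (dual n phi) = phi := svalP (cid (ev_surj ui phi)).
have ev_inj n (f h : rep_hom M (P n)) : ev m2 f = ev m2 h -> f = h.
  move=> E; apply/eqP; rewrite -subr_eq0; apply/eqP/(ev_eq0 (m2 := m2) ui).
  by rewrite linearB /= E subrr.
have evK n f : dual n (ev m2 f) = f by apply: ev_inj; rewrite dualK.
have nat x : exists y : F2 (F1 M), forall n phi, ev m1 phi y = dual n phi x.
  apply: nat_family_mk => [n a f h|n m f g].
    have -> : dual n (a *: f + h) = a *: dual n f + dual n h.
      by apply: ev_inj; rewrite dualK evD !dualK.
    by [].
  have -> // : dual m (rep_comp g f) = rep_comp (transfer m1 g) (dual n f).
  by apply: ev_inj; rewrite dualK ev_comp dualK transferK.
have [eta etaE] := choice nat.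
have eta_lin : linear eta.
  move=> a x y; apply: nat_family_ext => n f.
  by rewrite etaE rep_hom_linear [RHS]rep_hom_linear !etaE.
have eta_eq g x : eta (raction M g x) = raction (F2 (F1 M)) g (eta x).
  by apply: nat_family_ext => n f; rewrite etaE !rep_hom_equiv etaE.
exists (mk_rep_hom eta_lin eta_eq); split; last split.
- by move=> n f x; rewrite -[LHS]/(ev m1 (ev m2 f) (eta x)) etaE evK.
- move=> x y /= E; apply/eqP; rewrite -subr_eq0; apply/eqP/ui => a.
  by rewrite linearB /= -(evK _ (u a)) -!etaE E subrr.
move=> y.
have [|x xE] := gen_separating (u := u) (w := fun a => ev m1 (ev m2 (u a)) y).
  move=> n F F0.
  have : ev m1 (ev m2 (\sum_a rep_comp (F a) (u a))) y = 0.
    have -> : \sum_a rep_comp (F a) (u a) = 0.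
      by apply: rep_hom_ext => x; rewrite rep_hom_sum F0.
    by rewrite !linear0.
  rewrite !ev_bigsum rep_hom_sum => E; rewrite -[RHS]E; apply: eq_bigr => a _.
  by rewrite !ev_comp transferK.
exists x; apply: nat_family_ext => n phi; rewrite -[LHS]/(ev m1 phi (eta x)) etaE.
have [F FE] := factor ui (dual n phi).
rewrite FE rep_hom_sum -[in RHS](dualK n phi) FE !ev_bigsum rep_hom_sum.
by apply: eq_bigr => a _; rewrite !ev_comp transferK /= xE.
Qed.

Lemma unit_iso : naturally_isomorphic
  (functor_comp (nat_family_functor m2 m1) (nat_family_functor m1 m2))
  (functor_id (rep_category A1)).
Proof.
apply: naturally_isomorphic_sym.
pose eta (M : rep_category A1) : rep_hom (sval M) (F2 (F1 (sval M))) :=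
  sval (cid (double_dual (svalP M))).
have etaP (M : rep_category A1) := svalP (cid (double_dual (svalP M))).
exists eta; split=> [M N f|M].
  apply: rep_hom_ext => x; apply: nat_family_ext => n phi.
  have [EN _] := etaP N; have [EM _] := etaP M.
  have /(gen_embedding m1)[I [k [u ui]]] := svalP N.
  have [h <-] := ev_surj ui phi.
  transitivity (h (f x)); first exact: EN.
  rewrite -[RHS]/(ev m1 (rep_comp (ev m2 h) (nat_family_map m1 m2 f)) (eta M x)).
  have -> : rep_comp (ev m2 h) (nat_family_map m1 m2 f) = ev m2 (rep_comp h f).
    exact: rep_hom_ext.
  by rewrite EM.
have [_ [inj surj]] := etaP M.
exact: bijective_rep_iso inj surj.
Qed.

End Unit.

Theorem fi_models_equivalent (K : fieldType) (G1 G2 : groupType)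
    (A1 : rep K G1 -> Prop) (A2 : rep K G2 -> Prop) :
  fi_model A1 -> fi_model A2 -> equivalent (rep_category A1) (rep_category A2).
Proof.
move=> m1 m2; exists (nat_family_functor m1 m2), (nat_family_functor m2 m1).
by split; exact: unit_iso.
Qed.

(** * Subquotients of sums of tensor powers *)

Section TensorialModels.
Variables (K : fieldType) (G : groupType) (act : lin_action G (Koo K)).
Local Notation V := (tensor_rep act).

Lemma tensor_dsum_components (ns : seq nat) :
  exists (I : finType) (k : I -> nat) (t : forall a, rep_hom (tensor_dsum act ns) (V (k a))),
    forall x, (forall a, t a x = 0) -> x = 0.
Proof.
elim: ns => [|n ns [I [k [t tK]]]].
  exists void, (fun x : void => match x with end), (fun x : void => match x with end).
  by move=> x _; apply/rowP => -[].
pose k' (o : option I) := if o is Some a then k a else n.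
pose f1 : rep_hom (tensor_dsum act (n :: ns)) (V n) :=
  @mk_rep_hom _ _ (dsum (V n) (tensor_dsum act ns)) (V n) fst (fun _ _ _ => erefl) (fun _ _ => erefl).
pose f2 : rep_hom (tensor_dsum act (n :: ns)) (tensor_dsum act ns) :=
  @mk_rep_hom _ _ (dsum (V n) (tensor_dsum act ns)) _ snd (fun _ _ _ => erefl) (fun _ _ => erefl).
exists (option I), k', (fun o => if o is Some a as o return rep_hom (tensor_dsum act (n :: ns)) (V (k' o)) then rep_comp (t a) f2 else f1).
move=> [x y] xy0; have -> : x = 0 by exact: xy0 None.
by have -> : y = 0 by apply: tK => a; exact: xy0 (Some a).
Qed.

Lemma tensor_dsum_map M (I : eqType) (k : I -> nat) (t : forall a, rep_hom M (V (k a))) (s : seq I) :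
  exists h : rep_hom M (tensor_dsum act (map k s)),
    forall x, h x = 0 -> forall a, a \in s -> t a x = 0.
Proof.
elim: s => [|b s [h hK]]; first by exists 0.
have fl : linear (fun x : M => (t b x, h x) : dsum (V (k b)) (tensor_dsum act (map k s))).
  by move=> c x y; rewrite !linearP.
have fe g (x : M) : (t b (raction M g x), h (raction M g x)) =
    raction (dsum (V (k b)) (tensor_dsum act (map k s))) g (t b x, h x).
  by rewrite !rep_hom_equiv.
exists (mk_rep_hom fl fe) => x /= [tx hx] a; rewrite inE => /predU1P[->//|].
exact: hK.
Qed.

(** * Reduction of the axioms of [fi_model] to statements about tensor powers *)

Variables (P : nat -> rep K G) (inc : forall n, rep_hom (P n) (V n)).
Hypothesis inc_inj : forall n, injective (inc n).
Variables (E : nat -> nat -> finType) (phi : forall k n, E k n -> rep_hom (V k) (P n)).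
Hypothesis phi0 : forall k n (i : E k n), (k < n)%N -> phi i = 0.
Hypothesis tensor_injective : forall (I : finType) (k : I -> nat) N
    (u : forall a, rep_hom N (V (k a))) n (f : rep_hom N (P n)),
  (forall x, (forall a, u a x = 0) -> f x = 0) ->
  exists c : forall a, E (k a) n -> K,
    forall x, f x = \sum_a \sum_i c a i *: phi i (u a x).
Hypothesis tensor_separating : forall (I : finType) (k : I -> nat) N
    (u : forall a, rep_hom N (V (k a))) (w : forall a, V (k a)),
  (forall n (F : forall a, rep_hom (V (k a)) (P n)),
     (forall x, \sum_a F a (u a x) = 0) -> \sum_a F a (w a) = 0) ->
  exists x, forall a, u a x = w a.

Lemma tensorial_injective (I : finType) (k : I -> nat) N
    (u : forall a, rep_hom N (P (k a))) n (f : rep_hom N (P n)) :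
  (forall x, (forall a, u a x = 0) -> f x = 0) ->
  exists F : forall a, rep_hom (P (k a)) (P n), forall x, f x = \sum_a F a (u a x).
Proof.
move=> uf.
have [|c cE] := tensor_injective (u := fun a => rep_comp (inc (k a)) (u a)) (f := f).
  move=> x ux; apply: uf => a; apply: (@inc_inj (k a)); rewrite linear0; exact: ux.
exists (fun a => rep_comp (\sum_i c a i *: phi i) (inc (k a))) => x.
by rewrite cE; apply: eq_bigr => a _; rewrite /= rep_hom_sum.
Qed.

Lemma tensorial_separating (I : finType) (k : I -> nat) N
    (u : forall a, rep_hom N (P (k a))) (w : forall a, P (k a)) :
  (forall n (F : forall a, rep_hom (P (k a)) (P n)),
     (forall x, \sum_a F a (u a x) = 0) -> \sum_a F a (w a) = 0) ->
  exists x, forall a, u a x = w a.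
Proof.
move=> H.
have [|x xE] := tensor_separating (u := fun a => rep_comp (inc (k a)) (u a))
    (w := fun a => inc (k a) (w a)).
  by move=> n F F0; apply: (H n (fun a => rep_comp (F a) (inc (k a)))).
by exists x => a; apply: (@inc_inj (k a)); exact: xE.
Qed.

(** In the forward direction M is N modulo the kernel of p. Morphisms from W to the generators that
    vanish on this kernel descend to M, finitely many suffice by [finite_subfamily], and separation
    applied to the kernel shows that they have no common zero but 0. *)
Lemma tensorial_embedding M :
  (exists ns, subquotient M (tensor_dsum act ns)) <->
  exists (I : finType) (k : I -> nat) (u : forall a, rep_hom M (P (k a))),
    forall x, (forall a, u a x = 0) -> x = 0.
Proof.
split; last first.
  move=> [I [k [u uK]]].
  have [h hK] := tensor_dsum_map (fun a => rep_comp (inc (k a)) (u a)) (enum I).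
  exists (map k (enum I)), M, h, (rep_id M); split; last by move=> m; exists m.
  move=> x y xy; apply/eqP; rewrite -subr_eq0; apply/eqP/uK => a.
  apply: (@inc_inj (k a)); rewrite [RHS]linear0.
  by apply: (hK (x - y)) => //; rewrite ?mem_enum // linearB /= xy subrr.
move=> [ns [N [i [p [i_inj p_surj]]]]].
have [I [k [t tK]]] := tensor_dsum_components ns.
pose u a := rep_comp (t a) i.
have uK x : (forall a, u a x = 0) -> x = 0.
  by move=> ux; apply: i_inj; rewrite linear0; apply: tK.
(* A mere set-theoretic section; [pK] below makes the descended maps linear and equivariant. *)
have [s sK] := choice p_surj.
pose W := dprod_rep (fun a => V (k a)).
pose pr a : rep_hom W (V (k a)) := dprod_proj _ a.
pose tot n (F : forall a, rep_hom (V (k a)) (P n)) : rep_hom W (P n) :=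
  \sum_a rep_comp (F a) (pr a).
pose uW x : W := (fun a => u a x) : dprod (fun a => V (k a) : lmodType K).
have totE n (F : forall a, rep_hom (V (k a)) (P n)) x : tot n F (uW x) = \sum_a F a (u a x).
  by rewrite rep_hom_sum.
pose R n (v : rep_hom W (P n)) := (exists F, v = tot n F) /\ (forall y, p y = 0 -> v (uW y) = 0).
pose e n : seq (rep_hom W (P n)) :=
  [seq rep_comp (phi (tagged x)) (pr (tag x)) | x : {a : I & E (k a) n}].
(* Injectivity for the identity family says that the [phi] span all morphisms from [V q] to
   [P n]. *)
have phi_span q n (F : rep_hom (V q) (P n)) : exists c, F = \sum_i c i *: phi (i : E q n).
  have [|c cE] := @tensor_injective unit (fun=> q) (V q) (fun=> rep_id _) n F.
    by move=> x /(_ tt) /= ->; rewrite linear0.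
  exists (c tt); apply: rep_hom_ext => x; rewrite cE rep_hom_sum.
  rewrite (bigD1 tt) //= addrC big1 ?add0r => [|[]//].
  by under eq_bigr do rewrite /=.
have [||||J [l [r [rR rK]]]] := @finite_subfamily _ _ W P e R (\max_a k a).+1.
- move=> n; split; last by [].
  exists (fun=> 0); rewrite /tot big1 // => a _; exact: rep_hom_ext.
- move=> n a v v' [[F FE] vp] [[F' F'E] v'p]; split.
    exists (fun b => a *: F b + F' b); rewrite FE F'E /tot scaler_sumr -big_split.
    by apply: eq_bigr => b _; apply: rep_hom_ext.
  by move=> y py; rewrite rep_homD rep_homZ vp // v'p // scaler0 addr0.
- move=> n v [[F ->] _]; apply: in_span_bigsum => a _; have [c ->] := phi_span _ _ (F a).
  rewrite rep_comp_suml; apply: in_span_bigsum => j _; apply/in_spanZ/in_span_mem/mapP.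
  by exists (Tagged (fun a => E (k a) n) j); rewrite ?mem_enum.
- move=> n v Bn [[F ->] _]; rewrite /tot big1 // => a _; have [c ->] := phi_span _ _ (F a).
  rewrite rep_comp_suml big1 // => j _; rewrite phi0.
    by apply: rep_hom_ext => x; rewrite /= scaler0.
  by apply: leq_ltn_trans Bn; exact: leq_bigmax.
have pK x y : p x = p y -> forall n (v : rep_hom W (P n)), R n v -> v (uW x) = v (uW y).
  move=> pxy n v [_ vp]; apply/eqP; rewrite -subr_eq0 -linearB /=.
  have -> : uW x - uW y = uW (x - y) by apply: dprod_ext => a; rewrite /uW linearB.
  by rewrite vp // linearB /= pxy subrr.
have uWP a x y : uW (a *: x + y) = a *: uW x + uW y.
  by apply: dprod_ext => b; rewrite /uW linearP.
have uWg g x : uW (raction N g x) = raction W g (uW x).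
  by apply: dprod_ext => b; rewrite /uW rep_hom_equiv.
have fl b : linear (fun m => r b (uW (s m))).
  move=> a m m'; rewrite -rep_hom_linear -uWP; apply: pK (rR b).
  by rewrite sK linearP /= !sK.
have fe b g m : r b (uW (s (raction M g m))) = raction (P (l b)) g (r b (uW (s m))).
  rewrite -rep_hom_equiv -uWg; apply: pK (rR b).
  by rewrite sK rep_hom_equiv sK.
exists J, l, (fun b => mk_rep_hom (fl b) (fe b)) => m m0.
have [|x xE] := tensor_separating (N := subrep (ker_pred p))
    (u := fun a => rep_comp (u a) (subrep_inc _)) (w := fun a => u a (s m)).
  move=> n F F0; rewrite -totE; apply: (rK (uW (s m))) => //.
  split; first by exists F.
  by move=> y py; rewrite totE; exact: (F0 (mk_sub (S := ker_pred p) py)).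
have E1 : subrep_val x = s m.
  apply/eqP; rewrite -subr_eq0; apply/eqP/uK => a; rewrite linearB.
  by apply/eqP; rewrite subr_eq0; apply/eqP; exact: xE.
by rewrite -(sK m) -E1; exact: (subrepP x).
Qed.

End TensorialModels.

(** * The general affine group *)

Section TensorCoefficients.
Variable K : fieldType.

Lemma freeMod_lin_eq (T : choiceType) (W : lmodType K) (f g : freeMod K T -> W) :
  linear f -> linear g -> (forall x, f (evec x) = g (evec x)) -> f =1 g.
Proof.
move=> fl gl fg x; rewrite (lin_ext_unique fl) (lin_ext_unique gl).
by congr (lin_ext _ x); apply/funext.
Qed.

Lemma tensor_bound n (x : tensor_pow K n) :
  exists N, forall s, x s <> 0 -> forall l, (s l < N)%N.
Proof.
have [r _ xr] := freeMod_supp x; exists (\max_(s <- r) \max_l s l).+1 => s xs l.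
have sr : s \in r by apply: contrapT => /negP /xr.
rewrite ltnS; apply: leq_trans (leq_bigmax_seq s sr isT).
exact: (leq_bigmax l).
Qed.

Lemma tensor_family_bound (I : finType) (k : I -> nat) (x : forall a, tensor_pow K (k a)) :
  exists N, forall a s, x a s <> 0 -> forall l, (s l < N)%N.
Proof.
have bnd a : exists N, forall s, x a s <> 0 -> forall l, (s l < N)%N by exact: tensor_bound.
have [N NP] := choice bnd.
exists (\max_a N a) => a s xs l; apply: leq_trans (NP a s xs l) _; exact: leq_bigmax.
Qed.

Lemma tensor_map_coef n (L : Koo K -> Koo K) (x : tensor_pow K n) N t :
  (forall s, x s <> 0 -> forall l, (s l < N)%N) ->
  tensor_map L x t = \sum_(s <- tbox n N) x s * \prod_l L (evec (s l)) (t l).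
Proof.
move=> xN; rewrite /tensor_map (lin_extE _ (tbox_uniq n N)); last first.
  move=> s /notin_tbox[l Nl]; apply: contrapT => /xN /(_ l).
  by rewrite ltnNge Nl.
by rewrite Defs.coef_sum; apply: eq_bigr => s _; rewrite Defs.coefZ pureE.
Qed.

Lemma tbox_delta n (x : tensor_pow K n) N s0 :
  (forall s, x s <> 0 -> forall l, (s l < N)%N) ->
  \sum_(s <- tbox n N) x s * (s == s0)%:R = x s0.
Proof.
move=> xN; have [s0N|s0N] := boolP (s0 \in tbox n N).
  rewrite (bigD1_seq s0) ?tbox_uniq //= eqxx mulr1 big1 ?addr0 // => s /negPf ->.
  by rewrite mulr0.
rewrite big_seq big1 => [|s sN].
  have [l Nl] := notin_tbox s0N; apply/esym; apply: contrapT => /xN /(_ l).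
  by rewrite ltnNge Nl.
by case: eqP sN s0N => [->|]; rewrite ?mulr0 // => ->.
Qed.

(** The exponent of label i in the weight of e_s under the diagonal torus. *)
Definition mult n (i : nat) (s : {ffun 'I_n -> nat}) : nat := (\sum_l (s l == i))%N.

Definition upd n (t : {ffun 'I_n -> nat}) l p : {ffun 'I_n -> nat} :=
  [ffun i => if i == l then p else t i].

Lemma mult_le n i (s : {ffun 'I_n -> nat}) : (mult i s <= n)%N.
Proof.
rewrite -[X in (_ <= X)%N]card_ord -sum1_card; apply: leq_sum => l _.
exact: leq_b1.
Qed.

Lemma mult_gt0P n i (s : {ffun 'I_n -> nat}) : reflect (exists l, s l = i) (0 < mult i s)%N.
Proof.
rewrite lt0n sum_nat_eq0 negb_forall; apply: (iffP existsP) => -[l].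
  by rewrite /= eqb0 negbK => /eqP <-; exists l.
by move=> <-; exists l; rewrite /= eqxx.
Qed.

Lemma mult_le1 n i (s : {ffun 'I_n -> nat}) : injective s -> (mult i s <= 1)%N.
Proof.
move=> si; rewrite leqNgt; apply/negP => m2.
have /mult_gt0P[l sl] : (0 < mult i s)%N by exact: ltnW.
move: m2; rewrite /mult (bigD1 l) //= sl eqxx big1 // => l' l'l.
by apply/eqP; rewrite eqb0 -sl (inj_eq si).
Qed.

Lemma mult_ge2 n i (s : {ffun 'I_n -> nat}) l l' :
  l != l' -> s l = i -> s l' = i -> (1 < mult i s)%N.
Proof.
move=> ll' sl sl'; rewrite /mult (bigD1 l) //= (bigD1 l') 1?eq_sym //=.
by rewrite sl sl' eqxx.
Qed.

Lemma mult_inj n (s : {ffun 'I_n -> nat}) l l' i :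
  (mult i s <= 1)%N -> s l = i -> s l' = i -> l = l'.
Proof.
move=> m1 sl sl'; apply/eqP; apply: contraT => ll'.
by have := mult_ge2 ll' sl sl'; rewrite ltnNge m1.
Qed.

Lemma mult_upd n i (t : {ffun 'I_n -> nat}) l p :
  (mult i (upd t l p) + (t l == i) = mult i t + (p == i))%N.
Proof.
rewrite /mult (bigD1 l) //= [in RHS](bigD1 l) //= ffunE eqxx.
rewrite (eq_bigr (fun l => (t l == i) : nat)) => [|l' /negPf l'l]; last by rewrite ffunE l'l.
by rewrite [LHS]addnC [LHS]addnCA [RHS]addnC.
Qed.

(** The Leibniz rule at 0; it differentiates the action of a one-parameter family on a tensor
    power. *)
Lemma coef1_prod (I : eqType) (r : seq I) (a b : I -> K) : uniq r ->
  (\prod_(l <- r) ((a l)%:P + b l *: 'X))`_1 =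
  \sum_(l0 <- r) b l0 * \prod_(l <- r | l != l0) a l.
Proof.
have c0 s : (\prod_(l <- s) ((a l)%:P + b l *: 'X))`_0 = \prod_(l <- s) a l.
  elim: s => [|l s IH]; first by rewrite !big_nil coefC.
  by rewrite !big_cons coef0M IH coefD coefC coefZ coefX mulr0 addr0.
elim: r => [|l r IH /= /andP[lr ur]]; first by rewrite !big_nil coefC.
rewrite !big_cons coefM !big_ord_recl big_ord0 /= addr0 IH // c0.
rewrite !coefD !coefC !coefZ !coefX /= mulr0 mulr1 addr0 add0r eqxx /= addrC.
congr (_ * _ + _).
  rewrite [RHS]big_seq_cond [LHS]big_seq; apply: congr_big => // l' /=.
  by case: eqP lr => [->|]; rewrite ?andbT // => /negPf ->.
rewrite mulr_sumr; apply: eq_big_seq => l' l'r; rewrite big_cons.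
have -> : l != l' by apply: contraNneq lr => ->.
by rewrite mulrCA.
Qed.

End TensorCoefficients.

(** * Elementary affine elements and Lie algebra operators *)

Section AffineOperators.
Variable K : fieldType.
Hypothesis char0 : [pchar K] =i pred0.
Local Notation V := (tensor_rep (genaff_action K)).

Lemma natr_neq0 n : n.+1%:R != 0 :> K.
Proof. by rewrite (iffLR (pcharf0P _) char0). Qed.

(** Adding a multiple of e_j with j > 0 leaves the coordinate 0, which is t, unchanged. The case p =
    j is included, hence the nonvanishing condition. *)
Lemma elementary_affine p j (c : K) : (0 < j)%N -> 1 + c * (p == j)%:R != 0 ->
  exists g : GA_oo K, forall v, genaff_bij g v = v + (c * v p) *: evec j.
Proof.
move=> j0 cn; pose L (d : K) (v : Koo K) : Koo K := v + (d * v p) *: evec j.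
have LE d v i : L d v i = v i + d * v p * (i == j)%:R by [].
have LL d : linear (L d).
  move=> a u v; apply: freeModP => i; rewrite LE [RHS]Defs.coefD Defs.coefZ !LE !Defs.coefD !Defs.coefZ; ring.
(* [L d1] followed by [L d2] is [L] of d1 + d2 + d1 d2 [p = j]; d solves for the inverse. *)
pose d := - c / (1 + c * (p == j)%:R).
have LK d1 d2 : d1 + d2 + d1 * d2 * (p == j)%:R = 0 -> cancel (L d1) (L d2).
  move=> E v; apply: freeModP => i; rewrite !LE.
  have -> : v i + d1 * v p * (i == j)%:R + d2 * (v p + d1 * v p * (p == j)%:R) * (i == j)%:R
    = v i + (d1 + d2 + d1 * d2 * (p == j)%:R) * v p * (i == j)%:R by ring.
  by rewrite E !mul0r addr0.
have E1 : c + d + c * d * (p == j)%:R = 0 by rewrite /d; field.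
have E2 : d + c + d * c * (p == j)%:R = 0 by rewrite -[RHS]E1; ring.
have Lb : `[< bijective (L c) >] by apply/asboolP; exists (L d); exact: LK.
have La : affine_pred (Defs.Bij Lb).
  apply/asboolP; split; last first.
    by move=> v; rewrite -[LHS]/(L c v 0%N) LE eq_sym -[_ == _]negbK -lt0n j0 mulr0 addr0.
  exists (maxn p j).+1; split=> [|v vd i di|i di] /=; first exact: LL.
    rewrite -[LHS]/(L c v i) LE vd // add0r; case: eqP di => [->|_ _]; last by rewrite mulr0.
    by rewrite ltnNge leq_maxr.
  apply: freeModP => i'; rewrite -[LHS]/(L c (evec i) i') LE [evec i p]evecE; case: eqP di => [->|_ _].
    by rewrite ltnNge leq_maxl.
  by rewrite mulr0 mul0r addr0.
by exists (MkGA_oo La).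
Qed.

(** In characteristic 0 the nodes 0, ..., B are distinct, so the values there determine a polynomial
    of degree at most B, and every functional of it is a combination of them. *)
Lemma linear_coef_extraction B : exists w : 'I_B.+1 -> K,
  forall q : {poly K}, (size q <= B.+1)%N -> q`_1 = \sum_i w i * q.[i%:R].
Proof.
pose N := 'rV[K]_B.+1.
pose q_of (v : N) : {poly K} := rVpoly v.
have ql a u v : q_of (a *: u + v) = a *: q_of u + q_of v by rewrite /q_of linearP.
have [|||w wE] := @scalar_combination K N 'I_B.+1 (fun i v => (q_of v).[i%:R]) (fun v => (q_of v)`_1).
- by move=> i a u v; rewrite ql hornerD hornerZ.
- by move=> a u v; rewrite ql coefD coefZ.
- move=> v v0; suff -> : q_of v = 0 by rewrite coef0.
  apply/eqP; apply: contraT => qn.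
  have := @max_poly_roots K (q_of v) [seq (nat_of_ord i)%:R | i <- enum 'I_B.+1] qn.
  rewrite size_map size_enum_ord => H; have: (B.+1 < size (q_of v))%N.
    apply: H; first by apply/allP => _ /mapP[i _ ->]; apply/rootP; exact: v0.
    rewrite map_inj_uniq ?enum_uniq // => i i' E; apply/val_inj/eqP.
    wlog ii' : i i' E / (i <= i')%N.
      by move=> H'; case: (leqP i i') => [/H' -> //|/ltnW /H' ]; rewrite eq_sym => ->.
    rewrite eqn_leq ii' leqNgt; apply/negP => lt.
    have := natr_neq0 (i' - i).-1; rewrite prednK ?subn_gt0 // natrB // E subrr.
    by rewrite eqxx.
  by rewrite ltnNge size_poly.
exists w => q sq; have qE : q_of (poly_rV q) = q by exact: poly_rV_K.
by have := wE (poly_rV q); rewrite qE.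
Qed.

(* The action on polynomial representations of the Lie algebra element
   e_p |-> e_j (other e_i |-> 0), extracted from the one-parameter family
   1 + c E_jp as the coefficient of c. *)
Lemma lie_operator p j B : (0 < j)%N -> exists r : seq (K * GA_oo K),
  forall n (x : V n) t, (n <= B)%N ->
    (gring_act r x : tensor_pow K n) t = \sum_(l | t l == j) (x : tensor_pow K n) (upd t l p).
Proof.
move=> j0; have [w wE] := linear_coef_extraction B.+1.
have gE (i : 'I_B.+2) : exists g : GA_oo K, forall v, genaff_bij g v = v + (i%:R * v p) *: evec j.
  apply: elementary_affine => //; rewrite -natrM -(natrD _ 1) add1n; exact: natr_neq0.
have [g gP] := choice gE.
exists [seq (w i, g i) | i <- enum 'I_B.+2] => n x t nB.
have [N xN] := tensor_bound (x : tensor_pow K n).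
pose a (s : {ffun 'I_n -> nat}) l : K := (t l == s l)%:R.
pose b (s : {ffun 'I_n -> nat}) l : K := ((s l == p) && (t l == j))%:R.
(* The value of [q] at c is the coefficient at t of (1 + c E_jp) x. *)
pose q : {poly K} := \sum_(s <- tbox n N)
  (x : tensor_pow K n) s *: \prod_l ((a s l)%:P + b s l *: 'X).
have qE c : q.[c] = \sum_(s <- tbox n N) (x : tensor_pow K n) s * \prod_l (a s l + c * b s l).
  rewrite /q horner_sum; apply: eq_bigr => s _; rewrite hornerZ horner_prod.
  by congr (_ * _); apply: eq_bigr => l _; rewrite !hornerE mulrC.
have sq : (size q <= B.+2)%N.
  apply: leq_trans (size_sum _ _ _) _; apply/bigmax_leqP_seq => s _ _.
  apply: leq_trans (size_scale_leq _ _) _.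
  suff H (r : seq 'I_n) : (size (\prod_(l <- r) ((a s l)%:P + b s l *: 'X))%R <= (size r).+1)%N.
    apply: leq_trans (H _) _; rewrite /index_enum -enumT size_enum_ord ltnS.
    exact: leq_trans nB (leqnSn _).
  elim: r => [|l r IH]; first by rewrite big_nil size_poly1.
  rewrite big_cons; apply: leq_trans (size_polyMleq _ _) _.
  have s2 : (size ((a s l)%:P + b s l *: 'X)%R <= 2)%N.
    apply: leq_trans (size_polyD _ _) _; rewrite geq_max.
    rewrite (leq_trans (size_polyC_leq1 _)) //.
    by rewrite (leq_trans (size_scale_leq _ _)) // size_polyX.
  by rewrite -subn1 leq_subLR (leq_trans (leq_add s2 IH)).
transitivity (q`_1).
  rewrite (wE _ sq) /gring_act big_map big_enum Defs.coef_sum; apply: eq_bigr => i _.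
  rewrite Defs.coefZ qE /= (tensor_map_coef _ _ xN); congr (_ * _); apply: eq_bigr => s _.
  congr (_ * _); apply: eq_bigr => l _.
  rewrite /genaff_act gP Defs.coefD Defs.coefZ !evecE /a /b eq_sym [p == _]eq_sym.
  by rewrite -mulrA -natrM mulnb eq_sym.
rewrite /q coef_sum.
under eq_bigr => s _ do rewrite coefZ coef1_prod ?index_enum_uniq // mulr_sumr.
rewrite exchange_big /= [RHS]big_mkcond; apply: eq_bigr => l0 _.
case: eqP => [tl|tl]; last first.
  by rewrite big1 // => s _; rewrite /b (negbTE (introN eqP tl)) andbF mul0r mulr0.
rewrite -(tbox_delta _ xN); apply: eq_bigr => s _; congr (_ * _).
rewrite /b tl eqxx andbT -[\prod_(_ <- _ | _) _]/(\prod_(l | l != l0) a s l).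
(* In the term of l0 only the s that agrees with t off l0 and equals p there survives. *)
have [->|ns] := eqVneq s (upd t l0 p).
  rewrite ffunE !eqxx mul1r big1 // => l /negPf ll0.
  by rewrite /a ffunE ll0 eqxx.
case: eqP => [sl|_]; last by rewrite mul0r.
have /existsP[l sl'] : [exists l, s l != upd t l0 p l].
  apply: contraNT ns => /existsPn H; apply/eqP/ffunP => l; apply/eqP; exact/negPn/H.
have ll0 : l != l0 by apply: contraNneq sl' => ->; rewrite ffunE eqxx sl.
rewrite (bigD1 l) //= /a; move: sl'; rewrite ffunE (negPf ll0) eq_sym => /negPf ->.
by rewrite mul0r mulr0.
Qed.

End AffineOperators.

(** * Weight projections and reading one coefficient from another *)

Section WeightOperators.
Variable K : fieldType.
Hypothesis char0 : [pchar K] =i pred0.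
Local Notation V := (tensor_rep (genaff_action K)).
Local Notation co x := (coef (x : tensor_pow K _)).

Lemma natr_inj (a b : nat) : (a%:R == b%:R :> K) = (a == b).
Proof.
wlog ab : a b / (a <= b)%N.
  by move=> H; case: (leqP a b) => [/H//|/ltnW /H]; rewrite eq_sym => ->; rewrite eq_sym.
rewrite eq_sym -subr_eq0 -natrB // (iffLR (pcharf0P _) char0) subn_eq0.
by rewrite eqn_leq ab.
Qed.

(** For p = j = i the operator of [lie_operator] is diagonal with eigenvalue [mult i t]; the product
    is a Lagrange polynomial in it, normalized at e. *)
Lemma lagrange_weight_operator i e (s : seq nat) B : (0 < i)%N -> e \notin s ->
  exists r : seq (K * GA_oo K), forall n (x : V n) t, (n <= B)%N ->
    co (gring_act r x) t =
    (\prod_(m <- s) (((mult i t)%:R - m%:R) / (e%:R - m%:R))) * co x t.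
Proof.
move=> i0; elim: s => [_|m s IH].
  exists [:: (1, 1%g)] => n x t _; rewrite gring_act1 big_nil mul1r.
  by rewrite [raction _ _ _]lact1.
rewrite inE negb_or => /andP[em /IH[rs rsE]].
have [r0 r0E] := lie_operator char0 i B i0.
pose r1 := r0 ++ [seq (- m%:R * p.1, p.2) | p <- [:: (1 : K, 1%g : GA_oo K)]].
exists [seq ((e%:R - m%:R)^-1 * p.1, p.2) |
  p <- [seq (p.1 * q.1, (p.2 * q.2)%g) | p <- r1, q <- rs]] => n x t nB.
rewrite gring_act_scale gring_act_mul /r1 gring_act_cat gring_act_scale gring_act1.
rewrite [raction _ _ _]lact1 Defs.coefZ Defs.coefD Defs.coefZ r0E // big_cons.
rewrite (eq_bigr (fun=> co (gring_act rs x) t)).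
  rewrite sumr_const -(mulr_natl (co (gring_act rs x) t)) rsE //.
  have -> : #|[pred l | t l == i]| = mult i t.
    by rewrite -sum1_card /mult [LHS]big_mkcond; apply: eq_bigr => l _; rewrite inE; case: eqP.
  ring.
move=> l /eqP tl; congr (co _ _); apply/ffunP => l'; rewrite ffunE.
by case: eqP => // ->.
Qed.

Lemma weight_projection i e B : (0 < i)%N ->
  exists r : seq (K * GA_oo K), forall n (x : V n) t, (n <= B)%N ->
    co (gring_act r x) t = (mult i t == e)%:R * co x t.
Proof.
(* All eigenvalues are at most n, hence at most B, so these nodes suffice even if e exceeds B. *)
move=> i0; pose s := [seq m <- iota 0 B.+1 | m != e].
have [|r rE] := @lagrange_weight_operator i e s B i0.
  by rewrite mem_filter eqxx.
exists r => n x t nB; rewrite rE //; congr (_ * _).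
case: eqP => [->|/eqP me].
  rewrite big_seq big1 // => m; rewrite mem_filter => /andP[me _].
  by rewrite divff // subr_eq0 natr_inj eq_sym.
rewrite (big_rem (mult i t)) /= ?subrr ?mul0r //.
by rewrite mem_filter me mem_iota /= ltnS (leq_trans (mult_le _ _)).
Qed.

Lemma weight_projections (tau : nat -> nat) (s : seq nat) B : all (fun i => 0 < i)%N s ->
  exists r : seq (K * GA_oo K), forall n (x : V n) t, (n <= B)%N ->
    co (gring_act r x) t = (all (fun i => mult i t == tau i) s)%:R * co x t.
Proof.
elim: s => [_|i s IH /= /andP[i0 /IH[rs rsE]]].
  exists [:: (1, 1%g)] => n x t _; rewrite gring_act1 mul1r.
  by rewrite [raction _ _ _]lact1.
have [r0 r0E] := weight_projection (tau i) B i0.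
exists [seq (p.1 * q.1, (p.2 * q.2)%g) | p <- r0, q <- rs] => n x t nB.
by rewrite gring_act_mul r0E // rsE // mulrA -natrM mulnb.
Qed.

(** For a morphism, this turns vanishing of all coefficients at t of its values into vanishing of
    all coefficients at s. *)
Definition readable n (t s : {ffun 'I_n -> nat}) :=
  exists r : seq (K * GA_oo K), forall x : V n, co (gring_act r x) t = co x s.

Lemma readable_trans n (t s u : {ffun 'I_n -> nat}) :
  readable t s -> readable s u -> readable t u.
Proof.
move=> [r rE] [q qE]; exists [seq (a.1 * b.1, (a.2 * b.2)%g) | a <- r, b <- q] => x.
by rewrite gring_act_mul rE.
Qed.

(** The operator e_p |-> e_(t l) sums over the positions where t has the label [t l]; here there is
    only one. *)
Lemma readable_upd n (t : {ffun 'I_n -> nat}) l p :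
  (0 < t l)%N -> (forall l', t l' = t l -> l' = l) -> readable t (upd t l p).
Proof.
move=> t0 tl; have [r rE] := lie_operator char0 p n t0.
exists r => x; rewrite rE // (bigD1 l) //= big1 ?addr0 // => l' /andP[/eqP /tl ->].
by rewrite eqxx.
Qed.

(** Entries are replaced from left to right. The second hypothesis keeps those already replaced
    different from the one being replaced, so that its label stays unique, as [readable_upd]
    requires. *)
Lemma readable_steps n (t s : {ffun 'I_n -> nat}) :
  (forall l, 0 < t l)%N ->
  (forall l l' : 'I_n, (l' < l)%N -> s l' != t l) ->
  (forall l l' : 'I_n, t l' = t l -> l' = l) -> readable t s.
Proof.
move=> t0 ts ti.
pose c k : {ffun 'I_n -> nat} := [ffun l : 'I_n => if (l < k)%N then s l else t l].
have <- : c n = s by apply/ffunP => l; rewrite ffunE ltn_ord.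
suff H k : (k <= n)%N -> readable t (c k) by exact: H.
elim: k => [_|k IH kn].
  have -> : c 0%N = t by apply/ffunP => l; rewrite ffunE.
  by exists [:: (1, 1%g)] => x; rewrite gring_act1 [raction _ _ _]lact1.
apply: (readable_trans (IH (ltnW kn))).
have -> : c k.+1 = upd (c k) (Ordinal kn) (s (Ordinal kn)).
  apply/ffunP => l; rewrite !ffunE ltnS -val_eqE /= leq_eqVlt.
  by case: eqP => //= lk; congr (s _); apply: val_inj.
apply: readable_upd; rewrite !ffunE ltnn //.
move=> l'; rewrite ffunE; case: ltnP => [lk|_]; last exact: ti.
by have := ts (Ordinal kn) l' lk => /eqP.
Qed.

(* Pass through a multi-index with fresh distinct entries. *)
Lemma readable_inj n (t s : {ffun 'I_n -> nat}) :
  injective t -> (forall l, 0 < t l)%N -> readable t s.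
Proof.
move=> ti t0; pose M := (\max_l maxn (t l) (s l)).+1.
have tM l : (t l < M)%N.
  by rewrite ltnS (leq_trans (leq_maxl _ (s l))) // (leq_bigmax (F := fun l => maxn (t l) (s l))).
have sM l : (s l < M)%N.
  by rewrite ltnS (leq_trans (leq_maxr (t l) _)) // (leq_bigmax (F := fun l => maxn (t l) (s l))).
pose f : {ffun 'I_n -> nat} := [ffun l : 'I_n => (M + l)%N].
apply: (@readable_trans _ _ f); apply: readable_steps => [l|l l' _|l l'].
- exact: t0.
- by rewrite ffunE; apply: contraTneq (tM l) => <-; rewrite -leqNgt leq_addr.
- exact: ti.
- by rewrite ffunE addn_gt0.
- by rewrite ffunE; apply: contraTneq (sM l') => ->; rewrite -leqNgt leq_addr.
- by rewrite !ffunE => /addnI /val_inj.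
Qed.

Lemma affine_hom_eq0 (N : rep K (GA_oo K)) n (f : rep_hom N (V n)) (t : {ffun 'I_n -> nat}) :
  injective t -> (forall l, 0 < t l)%N ->
  (forall x, co (f x) t = 0) -> forall x, f x = 0.
Proof.
move=> ti t0 ft x; apply: freeModP => s; have [r rE] := readable_inj s ti t0.
by have := rE (f x); rewrite -gring_act_hom ft => <-.
Qed.

End WeightOperators.

(** * Contractions by the invariant functional *)

Section Contractions.
Variable K : fieldType.
Local Notation V := (tensor_rep (genaff_action K)).
Local Notation co x := (coef (x : tensor_pow K _)).

Section Fill.
Variables (n k : nat) (j : {ffun 'I_n -> 'I_k}).

(** The label 0 outside the range of [j] is the effect of t: applying the coordinate 0 in those
    positions of x leaves the coefficients [x (fill j t)]. *)
Definition fill (t : {ffun 'I_n -> nat}) : {ffun 'I_k -> nat} :=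
  [ffun i => if [pick l | j l == i] is Some l then t l else 0%N].

Lemma fill_out t i : (forall l, j l <> i) -> fill t i = 0%N.
Proof. by move=> ji; rewrite ffunE; case: pickP => // l /eqP /ji. Qed.

Hypothesis ji : injective j.

Lemma fill_in t l : fill t (j l) = t l.
Proof.
rewrite ffunE; case: pickP => [l' /eqP /ji -> //|/(_ l)].
by rewrite eqxx.
Qed.

Lemma fill_eq (s : {ffun 'I_k -> nat}) (t : {ffun 'I_n -> nat}) : (forall l, s (j l) = t l) -> (forall i, (forall l, j l <> i) -> s i = 0%N) ->
  s = fill t.
Proof.
move=> sj s0; apply/ffunP => i; have [[l <-]|nl] := pselect (exists l, j l = i).
  by rewrite fill_in.
rewrite fill_out ?s0 // => l jl; apply: nl; by exists l.
Qed.

End Fill.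

(** Each value of t occurs exactly once in s, and [j] records where; the other positions of s can
    only carry 0. *)
Lemma exists_fill n k (s : {ffun 'I_k -> nat}) (t : {ffun 'I_n -> nat}) :
  injective t -> (forall l, 0 < t l)%N ->
  (forall i, (0 < i)%N -> mult i s = mult i t) ->
  exists2 j : {ffun 'I_n -> 'I_k}, injective j & s = fill j t.
Proof.
move=> ti t0 st.
have ex l : exists i, s i = t l.
  by apply/mult_gt0P; rewrite st //; apply/mult_gt0P; exists l.
have [j jE] := choice ex; pose jf : {ffun 'I_n -> 'I_k} := [ffun l => j l].
have jfi : injective jf.
  by move=> l l'; rewrite !ffunE => E; apply: ti; rewrite -!jE E.
exists jf => //; apply: fill_eq => // [l|i ni]; first by rewrite ffunE jE.
apply/eqP; rewrite -leqn0 leqNgt; apply/negP => si0.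
have /mult_gt0P[l tl] : (0 < mult (s i) t)%N by rewrite -st //; apply/mult_gt0P; exists i.
apply: (ni l); apply: (@mult_inj _ s _ _ (s i)) => //.
  by rewrite st // mult_le1.
by rewrite ffunE jE.
Qed.

Lemma contr_finsupp n k (j : {ffun 'I_n -> 'I_k}) (ji : injective j) (x : tensor_pow K k) :
  finsupp_pred (fun t : {ffun 'I_n -> nat} => x (fill j t)).
Proof.
have /asboolP xf := coefP x; apply/asboolP.
apply: sub_finite_set (finite_image (fun s : {ffun 'I_k -> nat} => [ffun l => s (j l)]) xf).
move=> t /= xt; exists (fill j t) => //; apply/ffunP => l.
by rewrite ffunE fill_in.
Qed.

Definition contr_fun n k (j : {ffun 'I_n -> 'I_k}) (ji : injective j) (x : V k) : V n :=
  FreeMod (contr_finsupp ji (x : tensor_pow K k)) : tensor_pow K n.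

Lemma contr_fun_linear n k (j : {ffun 'I_n -> 'I_k}) (ji : injective j) :
  linear (contr_fun ji).
Proof. by move=> a u v; apply: freeModP => t. Qed.

Lemma contr_fun_equivariant n k (j : {ffun 'I_n -> 'I_k}) (ji : injective j) g x :
  contr_fun ji (raction (V k) g x) = raction (V n) g (contr_fun ji x).
Proof.
have /asboolP[_ gt] := genaffP g.
apply: (@freeMod_lin_eq K _ _ (fun x => contr_fun ji (raction (V k) g x))
    (fun x => raction (V n) g (contr_fun ji x))).
- by move=> a u v; rewrite lact_linear contr_fun_linear.
- by move=> a u v; rewrite contr_fun_linear lact_linear.
move=> s; apply: freeModP => t.
rewrite -[LHS]/(co (tensor_map (genaff_act g) (evec s)) (fill j t)).
rewrite -[RHS]/(co (tensor_map (genaff_act g) (contr_fun ji (evec s : tensor_pow K k))) t).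
rewrite {1}/tensor_map lin_ext_evec pureE.
rewrite (bigID (fun i => i \in j @: finset predT)) /= big_imset /=; last by move=> ? ? _ _ /ji.
rewrite (eq_bigl predT) => [|l]; last by rewrite inE.
rewrite (eq_bigr (fun l => genaff_act g (evec (s (j l))) (t l))); last first.
  by move=> l _; rewrite fill_in.
have out i : i \notin j @: finset predT -> forall l, j l <> i.
  by move=> ni l jl; case/negP: ni; apply/imsetP; exists l => //; rewrite inE.
(* Outside the range of [j] the factor is t (g e_(s i)) = t (e_(s i)): here the invariance of t
   enters. *)
rewrite (eq_bigr (fun i => (s i == 0%N)%:R)); last first.
  move=> i /out ni; rewrite fill_out // -[LHS]/(t_form (genaff_bij g (evec (s i)))) gt.
  by rewrite /t_form evecE eq_sym.
have [s0|/existsNP[i /not_implyP[/out ni si]]] := pselect (forall i, i \notin j @: finset predT -> s i = 0%N).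
  rewrite [X in _ * X]big1 ?mulr1; last by move=> i /s0 ->.
  have sE : s = fill j [ffun l => s (j l)].
    apply: fill_eq => // [l|i ni]; first by rewrite ffunE.
    by apply: s0; apply/imsetP => -[l _ il]; exact: (ni l).
  have -> : contr_fun ji (evec s : tensor_pow K k) = evec [ffun l => s (j l)] :> tensor_pow K n.
    apply: freeModP => u; rewrite -[LHS]/((fill j u == s)%:R : K) evecE; congr (_%:R).
    congr (nat_of_bool _); apply/eqP/eqP => [E|->]; last by rewrite -sE.
    by apply/ffunP => l; rewrite ffunE -E fill_in.
  rewrite /tensor_map lin_ext_evec pureE; apply: eq_bigr => l _.
  by rewrite ffunE.
have -> : contr_fun ji (evec s : tensor_pow K k) = 0 :> tensor_pow K n.
  apply: freeModP => u; rewrite -[LHS]/((fill j u == s)%:R : K) Defs.coef0.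
  by case: eqP => // E; case: si; rewrite -E fill_out.
have -> : tensor_map (genaff_act g) (0 : tensor_pow K n) = 0 by rewrite /tensor_map linear0.
rewrite Defs.coef0 (bigD1 i) /=; last first.
  by apply/imsetP => -[l _ il]; exact: (ni l).
by rewrite (negPf (introN eqP si)) mul0r mulr0.
Qed.

(* Contraction by the functional t in all tensor positions outside the range of [j];
   set to 0 when [j] is not injective. *)
Definition contr k n (j : {ffun 'I_n -> 'I_k}) : rep_hom (V k) (V n) :=
  if pselect (injective j) is left ji then
    mk_rep_hom (contr_fun_linear ji) (contr_fun_equivariant ji) else 0.

Lemma contrE k n (j : {ffun 'I_n -> 'I_k}) x t : injective j ->
  co (contr j x) t = co x (fill j t).
Proof. by rewrite /contr; case: pselect. Qed.

Lemma contr0 k n (j : {ffun 'I_n -> 'I_k}) : ~ injective j -> contr j = 0.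
Proof. by rewrite /contr; case: pselect. Qed.

End Contractions.

(** * Injectivity, separation and the FI model for the affine group *)

Section AffineModel.
Variable K : fieldType.
Hypothesis char0 : [pchar K] =i pred0.
Local Notation V := (tensor_rep (genaff_action K)).
Local Notation co x := (coef (x : tensor_pow K _)).

Lemma mult_notin n i (s : {ffun 'I_n -> nat}) : (forall l, s l <> i) -> mult i s = 0%N.
Proof. by move=> si; apply/eqP; rewrite -leqn0 leqNgt; apply/mult_gt0P => -[l /si]. Qed.

Lemma contr_fill n k (j i : {ffun 'I_n -> 'I_k}) (t : {ffun 'I_n -> nat}) :
  injective t -> (forall l, 0 < t l)%N -> injective j -> injective i ->
  (fill i t == fill j t) = (j == i).
Proof.
move=> ti t0 ji ii; apply/eqP/eqP => [/ffunP E|->//]; apply/ffunP => l.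
have := E (j l); rewrite fill_in //.
have [[l' il']|ni] := pselect (exists l', i l' = j l).
  by rewrite -il' fill_in // => /ti ->.
rewrite fill_out; last by move=> l' il'; apply: ni; exists l'.
by move=> E0; have := t0 l; rewrite -E0.
Qed.

Lemma contr_sum_coef (I : finType) (k : I -> nat) n (c : forall a, {ffun 'I_n -> 'I_(k a)} -> K)
    (z : forall a, V (k a)) t :
  co (\sum_a \sum_j c a j *: contr K j (z a)) t =
  \sum_(b : {a : I & {ffun 'I_n -> 'I_(k a)}}) c _ (tagged b) * co (contr K (tagged b) (z (tag b))) t.
Proof.
rewrite Defs.coef_sum -(sig_big_dep (fun=> true) (fun _ _ => true)
  (fun a j => c a j * co (contr K j (z a)) t)).
by apply: eq_bigr => a _; rewrite Defs.coef_sum; apply: eq_bigr => j _; rewrite Defs.coefZ.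
Qed.

(** The coefficient at a t with distinct positive labels determines a morphism. After projection to
    the weight of t, the only coefficients of [u a x] left are those at fills of t, which are
    coefficients at t of contractions; so [scalar_combination] expresses the coefficient of [f x] by
    these. *)
Lemma affine_injective (I : finType) (k : I -> nat) N
    (u : forall a, rep_hom N (V (k a))) n (f : rep_hom N (V n)) :
  (forall x, (forall a, u a x = 0) -> f x = 0) ->
  exists c : forall a, {ffun 'I_n -> 'I_(k a)} -> K,
    forall x, f x = \sum_a \sum_j c a j *: contr K j (u a x).
Proof.
move=> uf; pose t : {ffun 'I_n -> nat} := [ffun l : 'I_n => l.+1].
have ti : injective t by move=> l l'; rewrite !ffunE => -[/val_inj].
have t0 l : (0 < t l)%N by rewrite ffunE.
pose J : finType := {a : I & {ffun 'I_n -> 'I_(k a)}}.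
pose ell (b : J) x := co (contr K (tagged b) (u (tag b) x)) t.
have [|||c cE] := @scalar_combination K N J ell (fun x => co (f x) t).
- by move=> b a x y; rewrite /ell !rep_hom_linear.
- by move=> a x y; rewrite rep_hom_linear.
- move=> x ellx.
  pose B := maxn n (\max_a k a).
  have [M1 uM1] := tensor_family_bound (fun a => u a x : tensor_pow K (k a)).
  (* Beyond M no label occurs in t or in any [u a x], so finitely many projections fix the whole
     weight off 0. *)
  pose M := maxn M1 n.+1.
  have [|r rE] := @weight_projections K char0 (fun i => mult i t) (iota 1 M) B.
    by apply/allP => i; rewrite mem_iota => /andP[].
  have : co (f (gring_act r x)) t = 0.
    rewrite uf // => a; apply: freeModP => s; rewrite Defs.coef0 gring_act_hom rE; last first.
      by rewrite leq_max (leq_bigmax a) orbT.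
    case: allP => [sM|_]; last by rewrite mul0r.
    rewrite mul1r; apply: contrapT => us; have us' := us; case: us'.
    have st i : (0 < i)%N -> mult i s = mult i t.
      move=> i0; have [iM|Mi] := leqP i M.
        by apply/eqP/sM; rewrite mem_iota i0 add1n ltnS.
      have tn l : t l <> i.
        by rewrite ffunE => E; move: Mi; rewrite -E ltnNge leq_max (leq_trans (ltn_ord l) (leqnSn n)) orbT.
      have sn l : s l <> i.
        by move=> E; have := uM1 _ _ us l; rewrite E ltnNge (leq_trans (leq_maxl _ _) (ltnW Mi)).
      by rewrite !mult_notin.
    have [j ji sj] := exists_fill ti t0 st.
    by have := ellx (Tagged (fun a => {ffun 'I_n -> 'I_(k a)}) j); rewrite /ell /= contrE // -sj.
  rewrite gring_act_hom rE ?leq_maxl //.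
  by rewrite (_ : all _ _) ?mul1r //; apply/allP => i _ /=.
exists (fun a j => c (Tagged (fun a => {ffun 'I_n -> 'I_(k a)}) j)) => x.
pose h : rep_hom N (V n) := \sum_a \sum_j
  c (Tagged (fun a => {ffun 'I_n -> 'I_(k a)}) j) *: rep_comp (contr K j) (u a).
pose g : rep_hom N (V n) := f - h.
have gE y : g y = f y - \sum_a \sum_j
    c (Tagged (fun a => {ffun 'I_n -> 'I_(k a)}) j) *: contr K j (u a y).
  rewrite -[LHS]/(f y - h y) rep_hom_sum; congr (_ - _).
  by apply: eq_bigr => a _; rewrite rep_hom_sum.
apply/eqP; rewrite -subr_eq0 -gE; apply/eqP/(affine_hom_eq0 char0 ti t0) => y.
have cD (v w : V n) : co (v - w) t = co v t - co w t by [].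
rewrite gE cD cE contr_sum_coef; apply/eqP; rewrite subr_eq0.
by apply/eqP/eq_bigr => -[a j] _.
Qed.

Section Separation.
Variables (I : finType) (k : I -> nat) (N : rep K (GA_oo K)) (u : forall a, rep_hom N (V (k a))).
Local Notation B := (\max_a k a).
Local Notation W := (dprod_rep (fun a => V (k a))).
Local Notation cw z := (fun a => (z : dprod (fun a => V (k a) : lmodType K)) a).
Local Notation coz z a := (coef (cw z a : tensor_pow K _)).
Implicit Types z : W.

Definition in_image z := exists x, forall a, u a x = cw z a.

Definition killed z := forall n (F : forall a, rep_hom (V (k a)) (V n)),
  (forall x, \sum_a F a (u a x) = 0) -> \sum_a F a (cw z a) = 0.

Lemma in_image_gring r z : in_image z -> in_image (gring_act r z).
Proof.
move=> [x xE]; exists (gring_act r x) => a.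
by rewrite gring_act_hom xE -[RHS]/(dprod_proj _ a (gring_act r z)) gring_act_hom.
Qed.

Lemma in_imageP c z y : in_image z -> in_image y -> in_image (c *: z + y).
Proof. by move=> [x xE] [x' x'E]; exists (c *: x + x') => a; rewrite rep_hom_linear xE x'E. Qed.

Lemma in_image0 : in_image 0.
Proof. by exists 0 => a; rewrite linear0. Qed.

Lemma in_image_sum J (s : seq J) (z : J -> W) : (forall i, in_image (z i)) ->
  in_image (\sum_(i <- s) z i).
Proof.
move=> zi; elim/big_ind: _ => //; first exact: in_image0.
by move=> x y xi yi; rewrite -[x]scale1r; exact: in_imageP.
Qed.

Lemma gring_component r z a : cw (gring_act r z) a = gring_act r (cw z a).
Proof. by rewrite -[LHS]/(dprod_proj _ a (gring_act r z)) gring_act_hom. Qed.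

Lemma killed_gring r z : killed z -> killed (gring_act r z).
Proof.
move=> zk n F Fu; rewrite (eq_bigr (fun a => gring_act r (F a (cw z a)))); last first.
  by move=> a _; rewrite gring_component gring_act_hom.
transitivity (gring_act r (\sum_a F a (cw z a))); last first.
  by rewrite zk // /gring_act big1 // => p _; rewrite linear0 scaler0.
rewrite /gring_act exchange_big; apply: eq_bigr => p _.
by rewrite -scaler_sumr; congr (_ *: _); rewrite linear_sum.
Qed.

Lemma component_bound z : exists M, forall a s, coz z a s <> 0 -> forall l, (s l < M)%N.
Proof. exact: (tensor_family_bound (fun a => cw z a : tensor_pow K (k a))). Qed.

Lemma W_ext z y : (forall a s, coz z a s = coz y a s) -> z = y.
Proof. by move=> zy; apply: dprod_ext => a; apply: freeModP => s; exact: zy. Qed.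

(** In the labels from p on, z has a single weight and this weight is multilinear: e depends neither
    on a nor on s. For p = 1 only the label 0 is left free. *)
Definition thin p z := forall i, (p <= i)%N ->
  exists e : bool, forall a s, coz z a s <> 0 -> mult i s = e.

(** Such a z is determined by the coefficients at t of its contractions. A relation among these
    functionals on the image of N gives, by [affine_hom_eq0], a morphism that vanishes on the image
    and hence kills z; so the linear system for x is solvable, and projecting x to the weight of t
    gives a preimage. *)
Lemma in_image_thin1 z : killed z -> thin 1 z -> in_image z.
Proof.
move=> zk zt.
have [[a0 [s0 s0z]]|z0] := pselect (exists a s, coz z a s <> 0); last first.
  suff -> : z = 0 by exact: in_image0.
  by apply: W_ext => a s; apply: contrapT => zs; apply: z0; exists a, s.
(* t lists the nonzero labels of one multi-index in the support of z; by thinness they are distinct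
   and common to the whole support. *)
pose A := [set l | s0 l != 0%N]%SET.
pose t : {ffun 'I_#|A| -> nat} := [ffun l => s0 (enum_val l)].
have t0 l : (0 < t l)%N by rewrite ffunE lt0n; have := enum_valP l; rewrite inE.
have ti : injective t.
  move=> l l'; rewrite !ffunE => E; apply/enum_val_inj.
  have [|e eE] := zt (s0 (enum_val l)); first by have := t0 l; rewrite ffunE.
  apply: (@mult_inj _ s0 _ _ (s0 (enum_val l))) => //.
  by rewrite (eE _ _ s0z) leq_b1.
have mt i : (0 < i)%N -> mult i t = mult i s0.
  move=> i0; rewrite /mult [RHS](bigID (mem A)) /= [X in (_ + X)%N]big1 ?addn0.
    rewrite [RHS]big_enum_val; apply: eq_bigr => l _; by rewrite ffunE.
  move=> l; rewrite inE negbK => /eqP ->; apply/eqP; rewrite eqb0.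
  by rewrite eq_sym -lt0n.
have zm a s : coz z a s <> 0 -> forall i, (0 < i)%N -> mult i s = mult i t.
  by move=> zs i i0; have [e eE] := zt i i0; rewrite mt // (eE _ _ zs) (eE _ _ s0z).
pose n := #|A|.
pose J : finType := {a : I & {ffun 'I_n -> 'I_(k a)}}.
have [||x xE] := @scalar_separation K N J (fun b x => co (contr K (tagged b) (u (tag b) x)) t)
    (fun b => co (contr K (tagged b) (cw z (tag b))) t).
- by move=> b a x y; rewrite !rep_hom_linear.
- move=> c cu.
  pose c' (a : I) (j : {ffun 'I_n -> 'I_(k a)}) := c (Tagged (fun a => {ffun 'I_n -> 'I_(k a)}) j : J).
  have cE (y : forall a, V (k a)) :
      \sum_b c b * co (contr K (tagged b) (y (tag b))) t = co (\sum_a \sum_j c' a j *: contr K j (y a)) t.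
    by rewrite contr_sum_coef; apply: eq_bigr => -[a j].
  pose F a : rep_hom (V (k a)) (V n) := \sum_j c' a j *: contr K j.
  have FE (y : forall a, V (k a)) : \sum_a \sum_j c' a j *: contr K j (y a) = \sum_a F a (y a).
    by apply: eq_bigr => a _; rewrite rep_hom_sum.
  rewrite cE FE zk ?Defs.coef0 //.
  pose g : rep_hom N (V n) := \sum_a rep_comp (F a) (u a).
  have gE y : g y = \sum_a F a (u a y) by rewrite rep_hom_sum.
  move=> y; rewrite -gE; move: y; apply: (affine_hom_eq0 char0 ti t0) => y.
  by rewrite gE -FE -cE.
have [M1 uM1] := tensor_family_bound (fun a => u a x : tensor_pow K (k a)).
have [M2 zM2] := component_bound z.
pose M := maxn M1 (maxn M2 (\max_l t l).+1).
have [|r rE] := @weight_projections K char0 (fun i => mult i t) (iota 1 M) B.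
  by apply/allP => i; rewrite mem_iota => /andP[].
exists (gring_act r x) => a; apply: freeModP => s.
rewrite gring_act_hom rE; last exact: leq_bigmax.
case: allP => [sM|sM]; last first.
  rewrite mul0r; apply/esym; apply: contrapT => zs; apply: sM => i.
  by rewrite mem_iota => /andP[i0 _]; apply/eqP; exact: zm zs _ _.
rewrite mul1r.
have [sb|/existsNP[l sl]] := pselect (forall l, (s l < M)%N); last first.
  have bad M' : (M' <= M)%N -> ~ (s l < M')%N by move=> M'M lt; apply: sl; exact: leq_trans lt M'M.
  transitivity (0 : K).
    by apply: contrapT => /uM1 /(_ l); apply: bad; exact: leq_maxl.
  apply/esym; apply: contrapT => /zM2 /(_ l); apply: bad.
  by rewrite /M !leq_max leqnn orbT.
have st i : (0 < i)%N -> mult i s = mult i t.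
  move=> i0; have [iM|Mi] := leqP i M.
    by apply/eqP/sM; rewrite mem_iota i0 add1n ltnS.
  have tn l : t l <> i.
    move=> E; move: Mi; rewrite ltnNge -E; case/negP.
    rewrite (leq_trans (leq_bigmax (F := t) l)) // (leq_trans (leqnSn _)) //.
    by rewrite /M !leq_max leqnn !orbT.
  have sn l : s l <> i by move=> E; have := sb l; rewrite E ltnNge (ltnW Mi).
  by rewrite !mult_notin.
have [j ji ->] := exists_fill ti t0 st.
by have := xE (Tagged (fun a => {ffun 'I_n -> 'I_(k a)}) j); rewrite /= !contrE.
Qed.

(* Polarization: if p occurs m >= 2 times, replace one occurrence by a fresh index j;
   putting p back multiplies by m. *)
Lemma in_image_thin p z : (0 < p)%N -> killed z -> thin p z -> in_image z.
Proof.
case: p => // p _; elim: p z => [|p IHp] z; first exact: in_image_thin1.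
have [q qE] : exists q, q = p.+1 by exists p.+1.
rewrite -qE in IHp *; have q0 : (0 < q)%N by rewrite qE.
(* Induction on the multiplicity m of q; for m = 0 or 1 the vector is already thin from q on. *)
have homog m y : killed y -> thin q.+1 y -> (forall a s, coz y a s <> 0 -> mult q s = m) ->
    in_image y.
  elim: m y => [|m IHm] y yk yt ym.
    apply: IHp => // i; rewrite leq_eqVlt => /predU1P[<-|]; last exact: yt.
    by exists false.
  case: m IHm ym => [_ ym|m IHm ym].
    apply: IHp => // i; rewrite leq_eqVlt => /predU1P[<-|]; last exact: yt.
    by exists true.
  (* With j above q and above all labels of y, [y1] has q one time less and j exactly once, so it
     stays thin above q. *)
  have [M yM] := component_bound y; pose j := maxn M q.+1.
  have j0 : (0 < j)%N by rewrite leq_max orbT.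
  have qj : (q < j)%N by exact: leq_maxr.
  have yj a (s : {ffun 'I_(k a) -> nat}) l : s l = j -> coz y a s = 0.
    by move=> sl; apply: contrapT => /yM /(_ l); rewrite sl ltnNge leq_maxl.
  have [r1 r1E] := lie_operator char0 q B j0.
  have [r2 r2E] := lie_operator char0 j B q0.
  have kB a : (k a <= B)%N by exact: leq_bigmax.
  pose y1 := gring_act r1 y.
  have y1E a s : coz y1 a s = \sum_(l | s l == j) coz y a (upd s l q).
    by rewrite /y1 gring_component r1E.
  have y1n a s : coz y1 a s <> 0 -> exists2 l, s l = j & coz y a (upd s l q) <> 0.
    move=> ys; apply: contrapT => H; apply: ys; rewrite y1E big1 // => l /eqP sl.
    by apply: contrapT => yl; apply: H; exists l.
  have y1i : in_image y1.
    apply: IHm; first exact: killed_gring.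
      move=> i qi; have [->|ij] := eqVneq i j.
        exists true => a s /y1n[l sl yl]; have := mult_upd j s l q; rewrite sl eqxx.
        rewrite (ltn_eqF qj) addn0 mult_notin // => l' E.
        by apply: yl; exact: yj E.
      have [e eE] := yt i qi; exists e => a s /y1n[l sl yl].
      have := mult_upd i s l q; rewrite sl eq_sym (negPf ij) (ltn_eqF qi) !addn0 => <-.
      exact: eE yl.
    move=> a s /y1n[l sl yl]; have := mult_upd q s l q.
    by rewrite sl (gtn_eqF qj) eqxx addn0 addn1 (ym _ _ yl) => -[->].
  have yE : gring_act r2 y1 = m.+2%:R *: y.
    apply: W_ext => a s; rewrite -[coz (m.+2%:R *: y) a s]/(m.+2%:R * coz y a s).
    rewrite gring_component r2E // (eq_bigr (fun=> coz y a s)) => [|l /eqP sl].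
      rewrite sumr_const -(mulr_natl (coz y a s)).
      have -> : #|[pred l | s l == q]| = mult q s.
        by rewrite -sum1_card /mult [LHS]big_mkcond; apply: eq_bigr => l _; rewrite inE; case: eqP.
      have [->|/eqP ys] := eqVneq (coz y a s) 0; first by rewrite !mulr0.
      by rewrite (ym _ _ ys).
    rewrite y1E (bigD1 l) /=; last by rewrite ffunE eqxx.
    rewrite big1 ?addr0 => [|l' /andP[_ l'l]].
      by congr (coz y a _); apply/ffunP => i; rewrite !ffunE; case: eqP => // ->.
    by apply: (@yj _ _ l); rewrite !ffunE eq_sym (negPf l'l) eqxx.
  have -> : y = m.+2%:R^-1 *: gring_act r2 y1 + 0.
    by rewrite yE addr0 scalerA mulVf ?scale1r // (natr_neq0 char0).
  by apply: in_imageP; [exact: in_image_gring|exact: in_image0].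
move=> zk zt.
have rex (m : nat) : exists r : seq (K * GA_oo K), forall n (x : V n) t, (n <= B)%N ->
    co (gring_act r x) t = (mult q t == m)%:R * co x t by exact: weight_projection.
have [r rE] := choice rex.
(* A general z splits by the multiplicity of q, which never exceeds B. *)
have -> : z = \sum_(m <- iota 0 B.+1) gring_act (r m) z.
  apply: W_ext => a s.
  have kB : (k a <= B)%N by exact: leq_bigmax.
  transitivity (\sum_(m <- iota 0 B.+1) coz (gring_act (r m) z) a s); last first.
    rewrite -(Defs.coef_sum _ _ (fun m => cw (gring_act (r m) z) a : tensor_pow K _)).
    congr (co _ s); rewrite -[RHS]/(dprod_proj _ a (\sum_(m <- iota 0 B.+1) gring_act (r m) z)).
    by rewrite linear_sum.
  rewrite (bigD1_seq (mult q s)) ?iota_uniq //; last first.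
    by rewrite mem_iota /= ltnS (leq_trans (mult_le _ _)).
  rewrite gring_component rE // eqxx mul1r big1 => [|m /negPf ms].
    by rewrite [RHS]addr0.
  by rewrite gring_component rE // eq_sym ms mul0r.
apply: in_image_sum => m.
have rn a s : coz (gring_act (r m) z) a s <> 0 -> mult q s = m /\ coz z a s <> 0.
  rewrite gring_component rE; last exact: leq_bigmax.
  by case: eqP => [-> |_]; rewrite ?mul1r ?mul0r.
apply: (homog m); first exact: killed_gring.
  by move=> i qi; have [e eE] := zt i qi; exists e => a s /rn[_]; exact: eE.
by move=> a s /rn[].
Qed.

End Separation.

Lemma affine_separating (I : finType) (k : I -> nat) N
    (u : forall a, rep_hom N (V (k a))) (w : forall a, V (k a)) :
  (forall n (F : forall a, rep_hom (V (k a)) (V n)),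
     (forall x, \sum_a F a (u a x) = 0) -> \sum_a F a (w a) = 0) ->
  exists x, forall a, u a x = w a.
Proof.
move=> wk; pose z : dprod_rep (fun a => V (k a)) := (w : dprod (fun a => V (k a) : lmodType K)).
have [M zM] := component_bound z.
apply: (@in_image_thin I k N u M.+1 z) => // i Mi; exists false => a s zs.
apply: mult_notin => l sl; have := zM a s zs l; rewrite sl ltnNge.
by rewrite (ltnW Mi).
Qed.

(** On the basis vector of [fill j t] with t = (1, ..., m), the contraction along an injective i has
    coefficient [j = i] at t, so this reads off the coefficient of [contr K j]. *)
Definition affine_cf n m (j : {ffun 'I_m -> 'I_n}) (f : rep_hom (V n) (V m)) : K :=
  let t := [ffun l : 'I_m => l.+1] in co (f (evec (fill j t) : tensor_pow K n)) t.

Definition affine_model : fi_model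
  (fun M : rep K (GA_oo K) => exists ns, subquotient M (tensor_dsum (genaff_action K) ns)).
Proof.
have ti n : injective [ffun l : 'I_n => l.+1] by move=> l l'; rewrite !ffunE => -[/val_inj].
have t0 n l : (0 < [ffun l : 'I_n => l.+1] l)%N by rewrite ffunE.
have contr_gt k n (j : {ffun 'I_n -> 'I_k}) : (k < n)%N -> contr K j = 0.
  move=> kn; apply: contr0 => /leq_card; rewrite !card_ord leqNgt kn; by [].
have cf_contr n m (j i : {ffun 'I_m -> 'I_n}) : injectiveb j -> injectiveb i ->
    affine_cf j (contr K i) = (j == i)%:R.
  by move=> /injectiveP ji /injectiveP ii; rewrite /affine_cf contrE // evecE contr_fill.
have cf_lin n m (j : {ffun 'I_m -> 'I_n}) : scalar (affine_cf j) by [].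
refine (@FiModel K _ _ V (fun n m j => contr K j) affine_cf cf_lin _ cf_contr _ _ _ _ _).
- move=> n m f.
  have [|c cE] := @affine_injective unit (fun=> n) (V n) (fun=> rep_id _) m f.
    by move=> x /(_ tt) /= ->; rewrite linear0.
  have fE : f = \sum_(j : {ffun 'I_m -> 'I_n} | injectiveb j) c tt j *: contr K j.
    apply: rep_hom_ext => x; rewrite cE rep_hom_sum.
    rewrite (bigD1 tt) //= addrC big1 ?add0r => [|[]//].
    rewrite (bigID (fun j : {ffun 'I_m -> 'I_n} => injectiveb j)) /= [X in _ + X]big1 ?addr0 //.
    by move=> j /injectiveP jn; rewrite contr0 // scaler0.
  rewrite [LHS]fE; apply: eq_bigr => j ji; congr (_ *: _).
  rewrite [in RHS]fE (scalar_big _ _ _ _ (cf_lin _ _ j)) (bigD1 j) //= cf_contr // eqxx mulr1 big1 ?addr0 //.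
  by move=> i /andP[ii ij]; rewrite cf_contr // eq_sym (negPf ij) mulr0.
- move=> n; apply: rep_hom_ext => x; apply: freeModP => s.
  have ii : injective [ffun i : 'I_n => i] by move=> l l'; rewrite !ffunE.
  rewrite contrE //=; congr (co x _); apply/esym; apply: fill_eq => // [l|i ni].
    by rewrite ffunE.
  by case: (ni i); rewrite ffunE.
- move=> n m p j i /injectiveP ji /injectiveP ii; apply: rep_hom_ext => x; apply: freeModP => s.
  have jii : injective [ffun x => j (i x)] by move=> l l'; rewrite !ffunE => /ji /ii.
  rewrite /= !contrE //; congr (co x _); apply: fill_eq => // [l|q nq].
    have -> : [ffun x => j (i x)] l = j (i l) by rewrite ffunE.
    by rewrite !fill_in.
  have [[l jl]|nj] := pselect (exists l, j l = q); last first.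
    by apply: fill_out => l jl; apply: nj; exists l.
  rewrite -jl fill_in // fill_out // => l' il'; apply: (nq l').
  by rewrite ffunE il'.
- by apply: (tensorial_injective (inc := fun n => rep_id (V n)) _ affine_injective) => n x y.
- by apply: (tensorial_separating (inc := fun n => rep_id (V n)) _ affine_separating) => n x y.
- by apply: (tensorial_embedding (inc := fun n => rep_id (V n)) _ contr_gt affine_injective affine_separating) => n x y.
Defined.

End AffineModel.

(** * The infinite symmetric group *)

Section FinitaryPermutations.

(** Points are treated one at a time: composing with the transposition of [s (f x)] and [g x]
    corrects x and, by the hypothesis on coincidences, moves no [g y] already reached. *)
Lemma perm_extension (I T : finType) (f g : I -> T) :
  (forall x y, (f x == f y) = (g x == g y)) -> exists s : {perm T}, forall x, s (f x) = g x.
Proof.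
move=> fg; suff H (r : seq I) : exists s : {perm T}, forall x, x \in r -> s (f x) = g x.
  by have [s sE] := H (enum I); exists s => x; rewrite sE // mem_enum.
elim: r => [|x r [s sE]]; first by exists 1%g.
have [sx|sx] := eqVneq (s (f x)) (g x).
  by exists s => y; rewrite inE => /predU1P[->|/sE].
exists (s * tperm (s (f x)) (g x))%g => y; rewrite inE permM => /predU1P[->|yr].
  by rewrite tpermL.
rewrite (sE y yr) tpermD //.
  by apply: contraNneq sx => E; move: E; rewrite -(sE y yr) => /perm_inj E; rewrite E (sE y yr); move/eqP: E; rewrite fg => /eqP ->.
by apply: contraNneq sx => /eqP; rewrite -fg => /eqP E; rewrite E (sE y yr); move/eqP: E; rewrite fg => /eqP ->.
Qed.

Lemma perm_to_sym N (s : {perm 'I_N}) : exists g : Sym_oo,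
  (forall i : 'I_N, sym_bij g i = s i) /\ (forall i, (N <= i)%N -> sym_bij g i = i).
Proof.
pose e (s : {perm 'I_N}) i := if insub i is Some i' then s i' : nat else i.
have eI (s' : {perm 'I_N}) (i : 'I_N) : e s' i = s' i by rewrite /e valK.
have eO (s' : {perm 'I_N}) i : (N <= i)%N -> e s' i = i.
  by move=> Ni; rewrite /e insubF // ltnNge Ni.
have eK (s1 s2 : {perm 'I_N}) : (s1 * s2 = 1)%g -> cancel (e s1) (e s2).
  move=> s12 i; have [iN|Ni] := ltnP i N; last by rewrite !eO.
  by rewrite (_ : i = nat_of_ord (Ordinal iN)) // !eI -permM s12 perm1.
have eb : `[< bijective (e s) >].
  by apply/asboolP; exists (e s^-1%g); apply: eK; rewrite ?mulgV ?mulVg.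
have ef : finitary (Defs.Bij eb).
  apply/asboolP; apply: (@sub_finite_set _ _ `I_N); last exact: finite_II.
  by move=> i /= ; have [//|Ni] := ltnP i N; rewrite -[X in X != _]/(e s i) eO // eqxx.
by exists (MkSym_oo ef); split=> i; [exact: eI|exact: eO].
Qed.

Definition sym_of_perm N (s : {perm 'I_N}) : Sym_oo := sval (cid (perm_to_sym s)).

Lemma sym_of_permE N (s : {perm 'I_N}) (i : 'I_N) : sym_bij (sym_of_perm s) i = s i.
Proof. by have [H _] := svalP (cid (perm_to_sym s)); exact: H. Qed.

Lemma sym_of_perm_out N (s : {perm 'I_N}) i : (N <= i)%N -> sym_bij (sym_of_perm s) i = i.
Proof. by have [_ H] := svalP (cid (perm_to_sym s)); exact: H. Qed.

Lemma sym_mulE (g h : Sym_oo) i : sym_bij (g * h)%g i = sym_bij g (sym_bij h i).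
Proof. by rewrite [sym_bij (g * h)%g]valM. Qed.

Lemma sym_ext (g h : Sym_oo) : (forall i, sym_bij g i = sym_bij h i) -> g = h.
Proof. by move=> gh; apply/val_inj/bij_ext. Qed.

Lemma symK (g : Sym_oo) : cancel (sym_bij g) (sym_bij g^-1%g).
Proof. by move=> i; rewrite -sym_mulE mulVg [sym_bij _]val1. Qed.

Lemma symVK (g : Sym_oo) : cancel (sym_bij g^-1%g) (sym_bij g).
Proof. by move=> i; rewrite -sym_mulE mulgV [sym_bij _]val1. Qed.

(** The order is reversed because [permM] composes from left to right, [Sym_oo] from right to
    left. *)
Lemma sym_of_permM N (s t : {perm 'I_N}) :
  (sym_of_perm s * sym_of_perm t)%g = sym_of_perm (t * s)%g.
Proof.
apply: sym_ext => i; rewrite sym_mulE; have [iN|Ni] := ltnP i N.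
  by rewrite (_ : i = nat_of_ord (Ordinal iN)) // !sym_of_permE permM.
by rewrite !sym_of_perm_out.
Qed.

Lemma sym_extension (I : finType) N (u v : I -> nat) :
  (forall x, u x < N)%N -> (forall x, v x < N)%N ->
  (forall x y, (u x == u y) = (v x == v y)) ->
  exists s : {perm 'I_N}, forall x, sym_bij (sym_of_perm s) (u x) = v x.
Proof.
move=> uN vN uv.
have [|s sE] := @perm_extension I 'I_N (fun x => Ordinal (uN x)) (fun x => Ordinal (vN x)).
  by move=> x y; rewrite -!val_eqE /= uv.
exists s => x; by rewrite (_ : u x = nat_of_ord (Ordinal (uN x))) // sym_of_permE sE.
Qed.

Definition sact n (g : Sym_oo) (s : {ffun 'I_n -> nat}) : {ffun 'I_n -> nat} :=
  [ffun l => sym_bij g (s l)].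

Lemma sactK n g : cancel (@sact n g) (@sact n g^-1%g).
Proof. by move=> s; apply/ffunP => l; rewrite !ffunE symK. Qed.

Lemma sactVK n g : cancel (@sact n g^-1%g) (@sact n g).
Proof. by move=> s; apply/ffunP => l; rewrite !ffunE symVK. Qed.

Lemma sact_inj n g (s : {ffun 'I_n -> nat}) : injective s -> injective (sact g s).
Proof. by move=> si l l'; rewrite !ffunE => /(can_inj (symK g)) /si. Qed.

Definition iota_ffun n : {ffun 'I_n -> nat} := [ffun l : 'I_n => l : nat].

Lemma iota_ffun_inj n : injective (iota_ffun n).
Proof. by move=> l l'; rewrite !ffunE => /val_inj. Qed.

Lemma sact_transitive n (t s : {ffun 'I_n -> nat}) : injective t -> injective s ->
  exists g, sact g t = s.
Proof.
move=> ti si; pose N := (\max_l maxn (t l) (s l)).+1.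
have lt l : (maxn (t l) (s l) < N)%N by rewrite ltnS (leq_bigmax (F := fun l => maxn (t l) (s l))).
have [|||p pE] := @sym_extension 'I_n N t s.
- by move=> l; apply: leq_ltn_trans (lt l); exact: leq_maxl.
- by move=> l; apply: leq_ltn_trans (lt l); exact: leq_maxr.
- by move=> l l'; rewrite (inj_eq ti) (inj_eq si).
by exists (sym_of_perm p); apply/ffunP => l; rewrite ffunE.
Qed.

End FinitaryPermutations.

(** * Diagram functionals and averaging *)

Section SymmetricTensors.
Variable K : fieldType.
Hypothesis char0 : [pchar K] =i pred0.
Local Notation V := (tensor_rep (sym_action K)).
Local Notation co x := (coef (x : tensor_pow K _)).

Lemma sym_act_evec n g (s : {ffun 'I_n -> nat}) :
  raction (V n) g (evec s : tensor_pow K n) = (evec (sact g s) : tensor_pow K n).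
Proof.
rewrite -[LHS]/(tensor_map (sym_act g) (evec s)) /tensor_map lin_ext_evec -pure_evec.
by congr pure; apply/funext => l; rewrite /sym_act lin_ext_evec /= ffunE.
Qed.

Lemma lin_ext_sym (W : lmodType K) n (b : {ffun 'I_n -> nat} -> W) g (x : V n) :
  lin_ext b (raction (V n) g x : tensor_pow K n) =
  lin_ext (fun s => b (sact g s)) (x : tensor_pow K n).
Proof.
apply: (@freeMod_lin_eq K _ W (fun x : tensor_pow K n => lin_ext b (raction (V n) g x : tensor_pow K n))
  (lin_ext (fun s => b (sact g s)))).
- by move=> a y z; rewrite lact_linear lin_ext_linear.
- exact: lin_ext_linear.
by move=> s; rewrite sym_act_evec !lin_ext_evec.
Qed.

Lemma lin_ext_supp (W : lmodType K) n (b b' : {ffun 'I_n -> nat} -> W) (x : tensor_pow K n) :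
  (forall s, x s <> 0 -> b s = b' s) -> lin_ext b x = lin_ext b' x.
Proof.
move=> bb; have [q uq xq] := freeMod_supp x; rewrite !(lin_extE _ uq xq).
apply: eq_bigr => s _; have [->|/eqP xs] := eqVneq (x s) 0; first by rewrite !scale0r.
by rewrite bb.
Qed.

Lemma coefE_lin_ext n (x : tensor_pow K n) t :
  x t = lin_ext (fun s => (t == s)%:R : K^o) x.
Proof.
apply: (@freeMod_lin_eq K _ K^o (fun x : tensor_pow K n => x t)) => //.
  exact: lin_ext_linear.
by move=> s; rewrite lin_ext_evec.
Qed.

Lemma sym_coef n g (x : V n) t : co (raction (V n) g x) t = co x (sact g^-1%g t).
Proof.
rewrite coefE_lin_ext lin_ext_sym [RHS]coefE_lin_ext.
apply: (@lin_ext_supp K^o) => s _.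
congr (_%:R); congr nat_of_bool.
by apply/eqP/eqP => [->|<-]; rewrite ?sactK ?sactVK.
Qed.

Lemma lin_ext_comb n I (r : seq I) (c : I -> K) (b : I -> {ffun 'I_n -> nat} -> K) (x : tensor_pow K n) :
  lin_ext (fun s => \sum_(i <- r) c i * b i s : K^o) x =
  \sum_(i <- r) c i * lin_ext (fun s => b i s : K^o) x.
Proof.
have [q uq xq] := freeMod_supp x; rewrite (lin_extE _ uq xq).
under eq_bigr do rewrite scaler_sumr.
rewrite exchange_big; apply: eq_bigr => i _; rewrite (lin_extE _ uq xq) mulr_sumr.
by apply: eq_bigr => s _; rewrite /GRing.scale /= mulrCA.
Qed.

(** The set partition of the positions by equality of labels, not a linear kernel. *)
Definition kernel k (s : {ffun 'I_k -> nat}) : {ffun 'I_k * 'I_k -> bool} :=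
  [ffun p => s p.1 == s p.2].

Lemma kernel_sact k g (s : {ffun 'I_k -> nat}) : kernel (sact g s) = kernel s.
Proof. by apply/ffunP => p; rewrite !ffunE (inj_eq (can_inj (symK g))). Qed.

(* Combinatorial data cutting out the basis vectors e_s of V^(x)k with a given kernel
   such that s i = t l whenever j l = Some i; see [match_data]. *)
Definition diagram k n : finType := ({ffun 'I_k * 'I_k -> bool} * {ffun 'I_n -> option 'I_k})%type.

Definition match_data k n (t : {ffun 'I_n -> nat}) (e : diagram k n) (s : {ffun 'I_k -> nat}) : bool :=
  (kernel s == e.1) && [forall l, if e.2 l is Some i then s i == t l else true].

Definition match_form k n (t : {ffun 'I_n -> nat}) (e : diagram k n) (x : V k) : K :=
  lin_ext (fun s => (match_data t e s)%:R : K^o) (x : tensor_pow K k).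

Lemma match_form_scalar k n t (e : diagram k n) : scalar (match_form t e).
Proof. by move=> a x y; rewrite /match_form lin_ext_linear. Qed.

Lemma match_data_sact k n g t (e : diagram k n) s :
  match_data t e (sact g s) = match_data (sact g^-1%g t) e s.
Proof.
rewrite /match_data kernel_sact; congr (_ && _); apply: eq_forallb => l.
by case: (e.2 l) => // i; rewrite !ffunE (can2_eq (symK g) (symVK g)).
Qed.

Lemma match_form_sym k n g t (e : diagram k n) x :
  match_form t e (raction (V k) g x) = match_form (sact g^-1%g t) e x.
Proof.
rewrite /match_form lin_ext_sym; apply: (@lin_ext_supp K^o) => s _.
by rewrite match_data_sact.
Qed.

(** A complete invariant of s under the permutations fixing 0, ..., n-1; see
    [orbit_data_transitive]. *)
Definition orbit_data k n (s : {ffun 'I_k -> nat}) : diagram k n :=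
  (kernel s, [ffun l : 'I_n => [pick i | s i == l]]).

(** Position i is the chosen representative of its block. Summing over representatives counts each
    label of s once. *)
Definition kernel_rep k (ka : {ffun 'I_k * 'I_k -> bool}) i := [pick i' | ka (i', i)] == Some i.

Lemma pick_kernel k (s : {ffun 'I_k -> nat}) m i :
  ([pick i' | s i' == m] == Some i) = kernel_rep (kernel s) i && (s i == m).
Proof.
apply/eqP/andP => [E|[/eqP <- /eqP <-]].
  have im : s i == m by move: E; case: pickP => // i' ? [<-].
  split=> //; rewrite /kernel_rep -E; apply/eqP; apply: eq_pick => i'.
  by rewrite ffunE /= (eqP im).
by apply: eq_pick => i'; rewrite ffunE.
Qed.

Lemma pick_none k (s : {ffun 'I_k -> nat}) m :
  (([pick i | s i == m] == None)%:R : K) =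
  1 - \sum_(i | kernel_rep (kernel s) i) (s i == m)%:R.
Proof.
have E i : kernel_rep (kernel s) i -> ((s i == m)%:R : K) = ([pick i | s i == m] == Some i)%:R.
  by move=> ir; rewrite pick_kernel ir.
rewrite (eq_bigr _ E); case D: [pick i | s i == m] => [i|] /=; last by rewrite big1 ?subr0.
have ir : kernel_rep (kernel s) i by move/eqP: D; rewrite pick_kernel => /andP[].
rewrite (bigD1 i) //= eqxx big1 ?addr0 ?subrr // => i' /andP[_ /negPf ii'].
by rewrite (inj_eq Some_inj) eq_sym ii'.
Qed.

Lemma prod_bool (J : finType) (b : J -> bool) : \prod_l (b l)%:R = [forall l, b l]%:R :> K.
Proof.
case: forallP => [bl|/existsNP[l bl]]; first by rewrite big1 // => l _; rewrite bl.
by rewrite (bigD1 l) //= (negbTE (introN idP bl)) mul0r.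
Qed.

(* Expand the conditions "l is not a value of s" by 1 - sum_i [s i = l]. *)
Lemma orbit_data_expansion k n (e : diagram k n) :
  exists c : {ffun 'I_n -> option 'I_k} -> K, forall s,
    (orbit_data n s == e)%:R = \sum_j c j * (match_data (iota_ffun n) (e.1, j) s)%:R.
Proof.
case: e => ka p.
(* The coefficient of the condition o' when, at one label, the indicator of pick = o is expanded:
   the condition at a representative for [Some i], and 1 minus the sum over representatives for
   [None]. *)
pose coe (o o' : option 'I_k) : K :=
  if o is Some i then (kernel_rep ka i && (o' == Some i))%:R
  else if o' is Some i then - (kernel_rep ka i)%:R else 1.
exists (fun j => \prod_l coe (p l) (j l)) => s /=.
rewrite -[orbit_data n s == _]/((kernel s == ka) && ([ffun l : 'I_n => [pick i | s i == l]] == p)).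
rewrite /match_data /=; case: eqP => [sk|_] /=; last by rewrite big1 // => j _; rewrite mulr0.
pose psi (l : 'I_n) (o : option 'I_k) := if o is Some i then s i == l else true.
transitivity (\prod_(l : 'I_n) \sum_o coe (p l) o * (psi l o)%:R).
  transitivity (\prod_(l : 'I_n) ([pick i | s i == l] == p l)%:R : K).
    rewrite prod_bool; congr (_%:R); congr nat_of_bool.
    by apply/eqP/forallP => [<- l|H]; [rewrite ffunE|apply/ffunP => l; rewrite ffunE; exact/eqP].
  apply: eq_bigr => l _; case: (p l) => [i|] /=.
    rewrite pick_kernel sk (bigD1 (Some i)) //= eqxx andbT -natrM mulnb big1 ?addr0 //.
    by move=> o /negPf ->; rewrite andbF mul0r.
  rewrite pick_none (bigD1 None) //= mulr1 sk; congr (_ + _).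
  rewrite (reindex_omap Some id) //=; last by case.
  rewrite -sumrN [RHS](eq_bigl predT); last by move=> i; rewrite /= eqxx.
  rewrite [LHS]big_mkcond /=; apply: eq_bigr => i _.
  by case: (kernel_rep ka i); rewrite ?mulN1r // oppr0 mul0r.
rewrite bigA_distr_bigA; apply: eq_bigr => j _; rewrite big_split; congr (_ * _).
rewrite prod_bool; congr (_%:R); congr nat_of_bool; apply: eq_forallb => l.
by rewrite /psi; case: (j l) => // i; rewrite ffunE.
Qed.

Lemma orbit_form0 k n (x : V k) :
  (forall e : diagram k n, match_form (iota_ffun n) e x = 0) ->
  forall e : diagram k n, lin_ext (fun s => (orbit_data n s == e)%:R : K^o) (x : tensor_pow K k) = 0.
Proof.
move=> x0 e; have [c cE] := orbit_data_expansion e.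
rewrite (_ : lin_ext _ _ = lin_ext (fun s => \sum_j c j * (match_data (iota_ffun n) (e.1, j) s)%:R : K^o)
  (x : tensor_pow K k)); last by apply: (@lin_ext_supp K^o) => s _; exact: cE.
by rewrite lin_ext_comb big1 // => j _; rewrite [lin_ext _ _]x0 mulr0.
Qed.

Definition fixing n N : pred {perm 'I_N} := fun p => [forall i : 'I_N, (i < n)%N ==> (p i == i)].

Definition averaging n N : seq (K * Sym_oo) :=
  [seq (1, sym_of_perm p) | p <- enum (@fixing n N)].

Lemma averagingE n N (M : rep K Sym_oo) (x : M) :
  gring_act (averaging n N) x = \sum_(p : {perm 'I_N} | fixing n p) raction M (sym_of_perm p) x.
Proof.
by rewrite /gring_act big_map big_enum; apply: eq_bigr => p _; rewrite scale1r.
Qed.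

Lemma fixing_sym n N (p : {perm 'I_N}) l : (n <= N)%N -> fixing n p -> (l < n)%N ->
  sym_bij (sym_of_perm p) l = l.
Proof.
move=> nN /forallP pf ln; have lN := leq_trans ln nN.
rewrite (_ : l = nat_of_ord (Ordinal lN)) // sym_of_permE.
by have /implyP/(_ ln)/eqP -> := pf (Ordinal lN).
Qed.

Lemma averaging_sym n N (M : rep K Sym_oo) (x : M) (p : {perm 'I_N}) : fixing n p ->
  gring_act (averaging n N) (raction M (sym_of_perm p) x) = gring_act (averaging n N) x.
Proof.
move=> /forallP pf; rewrite !averagingE [RHS](reindex_inj (mulgI p)) /=.
apply: eq_big => [q|q _]; last by rewrite -sym_of_permM lactM.
apply: eq_forallb => i; rewrite permM; case: ltnP => //= ilt.
by have /implyP/(_ ilt)/eqP -> := pf i.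
Qed.

Lemma orbit_data_transitive k n N (s s' : {ffun 'I_k -> nat}) : (n <= N)%N ->
  (forall i, s i < N)%N -> (forall i, s' i < N)%N -> orbit_data n s = orbit_data n s' ->
  exists2 p : {perm 'I_N}, fixing n p & sact (sym_of_perm p) s = s'.
Proof.
move=> nN sN s'N [ks os].
have inc i (l : 'I_n) (u : {ffun 'I_k -> nat}) :
    (u i == l) = if [pick i' | u i' == l] is Some i' then kernel u (i', i) else false.
  by case: pickP => [i' /eqP ui'|/(_ i)//]; rewrite ffunE /= ui' eq_sym.
have osl (l : 'I_n) : [pick i | s i == l] = [pick i | s' i == l].
  by move/ffunP/(_ l): os; rewrite !ffunE.
(* The labels 0, ..., n-1 are adjoined to the family so that the permutation fixes them. *)
pose u (v : {ffun 'I_k -> nat}) (y : 'I_k + 'I_n) : nat := match y with inl i => v i | inr l => l end.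
have [|||p pE] := @sym_extension ('I_k + 'I_n)%type N (u s) (u s').
- by case=> [i|l] //=; apply: leq_trans nN.
- by case=> [i|l] //=; apply: leq_trans nN.
- move=> [i|l] [i'|l'] //=.
  + by move/ffunP/(_ (i, i')): ks; rewrite !ffunE.
  + by rewrite !inc osl ks.
  + by rewrite eq_sym [RHS]eq_sym !inc osl ks.
exists p; last by apply/ffunP => i; rewrite ffunE; exact: pE (inl i).
apply/forallP => i; apply/implyP => ilt; apply/eqP/val_inj.
by rewrite -[LHS]sym_of_permE; exact: pE (inr (Ordinal ilt)).
Qed.

(* The average of e_s depends only on the orbit of s, so that of x is a combination
   of orbit averages whose coefficients are the orbit sums of x. *)
Lemma averaging_eq0 k n N (x : V k) : (n <= N)%N ->
  (forall s, co x s <> 0 -> forall l, (s l < N)%N) ->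
  (forall e : diagram k n, match_form (iota_ffun n) e x = 0) ->
  gring_act (averaging n N) x = 0.
Proof.
move=> nN xN /orbit_form0 x0.
have x_out s : s \notin tbox k N -> co x s = 0.
  move=> /notin_tbox[l Nl]; apply: contrapT => /xN /(_ l).
  by rewrite ltnNge Nl.
pose A (y : V k) : V k := gring_act (averaging n N) y.
have AL : linear (A : tensor_pow K k -> V k) by move=> a y z; exact: gring_actP.
rewrite -/(A x) (lin_ext_unique AL) (lin_extE _ (tbox_uniq k N) x_out).
rewrite (partition_big (fun s => orbit_data n s) predT) //= big1 // => e _.
have [/hasP[s0 s0N /eqP s0e]|/hasPn none] := boolP (has (fun s => orbit_data n s == e) (tbox k N)); last first.
  by rewrite big_seq_cond big1 // => s /andP[/none /negPf ->].
rewrite big_seq_cond (eq_bigr (fun s => co x s *: A (evec s0 : tensor_pow K k))); last first.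
  move=> s /andP[sN /eqP se]; congr (_ *: _).
  have box s' : s' \in tbox k N -> forall i, (s' i < N)%N.
    by move=> /mapP[f _ ->] i; rewrite ffunE.
  have [p pf <-] := orbit_data_transitive nN (box _ sN) (box _ s0N) (etrans se (esym s0e)).
  by rewrite -sym_act_evec /A averaging_sym.
rewrite -big_seq_cond -scaler_suml; have := x0 e; rewrite (lin_extE _ (tbox_uniq k N) x_out) => E.
rewrite (_ : \sum_(_ <- _ | _) _ = 0) ?scale0r // -[RHS]E big_mkcond.
by apply: eq_bigr => s _; case: eqP => _; rewrite /GRing.scale /= ?mulr1 ?mulr0.
Qed.

Lemma averaging_fix k n N (x : V k) : (n <= N)%N ->
  (forall s, co x s <> 0 -> forall l, (s l < n)%N) ->
  gring_act (averaging n N) x = #|@fixing n N|%:R *: x.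
Proof.
move=> nN xn; rewrite averagingE (eq_bigr (fun=> x)) ?sumr_const ?scaler_nat // => p pf.
apply: freeModP => t; rewrite sym_coef.
set t' := sact _ t; have tE : t = sact (sym_of_perm p) t' by rewrite sactVK.
have fx (s : {ffun 'I_k -> nat}) : (forall l, s l < n)%N -> sact (sym_of_perm p) s = s.
  by move=> sn; apply/ffunP => l; rewrite ffunE (fixing_sym nN pf).
have [ht|ht] := eqVneq (co x t) 0; last first.
  by rewrite /t' -{1}(fx t (xn _ (elimN eqP ht))) sactK.
rewrite ht; apply: contrapT => ht'; move: (ht'); rewrite -(fx _ (xn _ ht')) -tE ht.
by case.
Qed.

Lemma fixing_card_neq0 n N : #|@fixing n N|%:R != 0 :> K.
Proof.
rewrite (iffLR (pcharf0P _) char0) -lt0n; apply/card_gt0P; exists 1%g.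
by apply/forallP => i; apply/implyP => _; rewrite perm1.
Qed.

End SymmetricTensors.

(** * Tensors supported on injective multi-indices, and diagram maps *)

Section InjectiveTensors.
Variable K : fieldType.
Local Notation V := (tensor_rep (sym_action K)).
Local Notation co x := (coef (x : tensor_pow K _)).

Definition inj_supp_pred n : subrep_pred (V n).
Proof.
refine (@SubrepPred _ _ (V n) (fun x => forall s : {ffun 'I_n -> nat}, ~ injective s -> co x s = 0) _ _ _) => //.
- by move=> a x y x0 y0 s ns; rewrite Defs.coefD Defs.coefZ x0 // y0 // mulr0 addr0.
- move=> g x x0 s ns; rewrite sym_coef x0 // => si; apply: ns.
  by rewrite -(sactVK g s); exact: sact_inj.
Defined.

Definition inj_tensor n : rep K Sym_oo := subrep (inj_supp_pred n).

Definition inj_inc n : rep_hom (inj_tensor n) (V n) := subrep_inc _.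

Lemma inj_inc_inj n : injective (@inj_inc n).
Proof. exact: subrep_inc_inj. Qed.

Lemma inj_inc_out n (x : inj_tensor n) (s : {ffun 'I_n -> nat}) : ~ injective s -> co (inj_inc n x) s = 0.
Proof. by move: s; exact: (subrepP x). Qed.

(** Finitary permutations act transitively on injective multi-indices, the only ones in the
    support. *)
Lemma inj_hom_eq0 (N : rep K Sym_oo) n (f : rep_hom N (inj_tensor n)) (t : {ffun 'I_n -> nat}) :
  injective t -> (forall x, co (inj_inc n (f x)) t = 0) -> forall x, f x = 0.
Proof.
move=> ti ft x; apply: (@inj_inc_inj n); apply: freeModP => s; rewrite linear0 Defs.coef0.
have [si|ns] := pselect (injective s); last exact: inj_inc_out.
have [g <-] := sact_transitive ti si.
have := ft (raction N g^-1%g x); rewrite !rep_hom_equiv sym_coef.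
by rewrite invgK.
Qed.

Definition dom k n (e : diagram k n) : {set 'I_n} := [set l | e.2 l != None]%SET.

Definition diagram_value k n (j : {ffun 'I_n -> option 'I_k}) (s : {ffun 'I_k -> nat}) :
  {ffun 'I_n -> nat} := [ffun l => if j l is Some i then s i else 0%N].

(** When the domain is not full, some labels of the result would be unconstrained and the sum over
    them infinite, so the value is set to 0. *)
Definition diagram_basis k n (e : diagram k n) (s : {ffun 'I_k -> nat}) : tensor_pow K n :=
  if [&& kernel s == e.1, dom e == [set: 'I_n]%SET & injectiveb (diagram_value e.2 s)]
  then evec (diagram_value e.2 s) else 0.

Lemma dom_full k n (e : diagram k n) l : dom e == [set: 'I_n]%SET -> exists i, e.2 l = Some i.
Proof.
move=> /eqP/setP/(_ l); rewrite !inE; case: (e.2 l) => // i _.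
by exists i.
Qed.

Lemma diagram_value_sact k n (e : diagram k n) g s : dom e == [set: 'I_n]%SET ->
  diagram_value e.2 (sact g s) = sact g (diagram_value e.2 s).
Proof.
move=> De; apply/ffunP => l; rewrite !ffunE; have [i ->] := dom_full l De.
by rewrite ffunE.
Qed.

Lemma diagram_basis_sact k n (e : diagram k n) g s :
  diagram_basis e (sact g s) = raction (V n) g (diagram_basis e s).
Proof.
have act0 : raction (V n) g (0 : tensor_pow K n) = 0 by exact: linear0.
rewrite /diagram_basis kernel_sact; case De: (dom e == _); last by rewrite andbF act0.
rewrite diagram_value_sact //.
have -> : injectiveb (sact g (diagram_value e.2 s)) = injectiveb (diagram_value e.2 s).
  apply/injectiveP/injectiveP => [H|]; last exact: sact_inj.
  by rewrite -(sactK g (diagram_value e.2 s)); exact: sact_inj.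
by case: ifP => _; rewrite ?sym_act_evec // act0.
Qed.

Lemma diagram_fun_equivariant k n (e : diagram k n) g (x : V k) :
  (lin_ext (diagram_basis e) (raction (V k) g x : tensor_pow K k) : V n) =
  raction (V n) g (lin_ext (diagram_basis e) (x : tensor_pow K k) : tensor_pow K n).
Proof.
rewrite lin_ext_sym.
apply: (@freeMod_lin_eq K _ (V n) (lin_ext (fun s => diagram_basis e (sact g s)))
  (fun x : tensor_pow K k => raction (V n) g (lin_ext (diagram_basis e) x : tensor_pow K n))).
- exact: lin_ext_linear.
- by move=> a y z; rewrite lin_ext_linear lact_linear.
by move=> s; rewrite !lin_ext_evec diagram_basis_sact.
Qed.

Definition diagram_map0 k n (e : diagram k n) : rep_hom (V k) (V n) :=
  @mk_rep_hom K _ (V k) (V n) (fun x => lin_ext (diagram_basis e) (x : tensor_pow K k) : V n)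
    (lin_ext_linear (diagram_basis e)) (diagram_fun_equivariant e).

(** With full domain, an s with kernel [e.1] matches t exactly when its diagram value is t; the
    matching functionals of full diagrams are therefore coefficients of morphisms. *)
Lemma diagram_map0E k n (e : diagram k n) (x : V k) t :
  co (diagram_map0 e x) t =
  if (dom e == [set: 'I_n]%SET) && injectiveb t then match_form t e x else 0.
Proof.
have -> : co (diagram_map0 e x) t = lin_ext (fun s => diagram_basis e s t : K^o) (x : tensor_pow K k).
  apply: (@freeMod_lin_eq K _ K^o (fun x : tensor_pow K k => co (diagram_map0 e x) t)).
  - by move=> a y z; rewrite rep_hom_linear.
  - exact: lin_ext_linear.
  by move=> s; rewrite /= !lin_ext_evec.
case De: (dom e == _) => /=; last first.
  have [q uq xq] := freeMod_supp (x : tensor_pow K k).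
  rewrite (lin_extE _ uq xq) big1 // => s _.
  by rewrite /diagram_basis De andbF Defs.coef0 scaler0.
case: ifP => ti; last first.
  have [q uq xq] := freeMod_supp (x : tensor_pow K k).
  rewrite (lin_extE _ uq xq) big1 // => s _; rewrite /diagram_basis De /=.
  case: ifP => [/andP[_ si]|_]; last by rewrite Defs.coef0 scaler0.
  rewrite evecE; case: eqP => [E|_]; last by rewrite scaler0.
  by move: si; rewrite -E ti.
apply: (@lin_ext_supp K K^o) => s _; rewrite /diagram_basis De /match_data.
case: (kernel s == e.1) => //=.
have -> : [forall l, if e.2 l is Some i then s i == t l else true] = (t == diagram_value e.2 s).
  apply/forallP/eqP => [H|-> l].
    apply/ffunP => l; have := H l; rewrite ffunE; have [i ->] := dom_full l De.
    by move/eqP.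
  by rewrite ffunE; case: (e.2 l).
case: ifP => [_|si]; first by rewrite evecE.
by case: eqP si => // <-; rewrite ti.
Qed.

Definition diagram_map k n (e : diagram k n) : rep_hom (V k) (inj_tensor n).
Proof.
refine (@corestrict _ _ _ (inj_supp_pred n) _ (diagram_map0 e) _) => x s ns.
by rewrite diagram_map0E; case: injectiveP => //; rewrite andbF.
Defined.

Lemma diagram_mapE k n (e : diagram k n) (x : V k) t :
  co (inj_inc n (diagram_map e x)) t =
  if (dom e == [set: 'I_n]%SET) && injectiveb t then match_form t e x else 0.
Proof. by rewrite -diagram_map0E. Qed.

Lemma diagram_map_gt k n (e : diagram k n) : (k < n)%N -> diagram_map e = 0.
Proof.
move=> kn; apply: rep_hom_ext => x; apply: (@inj_inc_inj n); apply: freeModP => t.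
rewrite diagram_mapE linear0 Defs.coef0; case: ifP => // /andP[De /injectiveP ti].
rewrite /match_form; have [q uq xq] := freeMod_supp (x : tensor_pow K k).
rewrite (lin_extE _ uq xq) big1 // => s _.
case: (boolP (match_data t e s)) => [|_]; last by rewrite scaler0.
move=> /andP[_ /forallP st].
have [j jE] := choice (fun l => dom_full l De).
have ji : injective j.
  move=> l l' E; apply: ti; have := st l; have := st l'.
  by rewrite !jE E => /eqP <- /eqP <-.
by have := leq_card j ji; rewrite !card_ord leqNgt kn.
Qed.

Definition far n (D : {set 'I_n}) M : {ffun 'I_n -> nat} :=
  [ffun l : 'I_n => if l \in D then l : nat else (M + l)%N].

Lemma far_inj n (D : {set 'I_n}) M : (n <= M)%N -> injective (far D M).
Proof.
move=> nM l l'; rewrite !ffunE.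
have lM (q q' : 'I_n) : (q : nat) <> (M + q')%N.
  by move=> E; have := ltn_ord q; rewrite E ltnNge (leq_trans nM) ?leq_addr.
by case: (l \in D); case: (l' \in D); [move=> /val_inj|move=> /lM|move=> /esym /lM|move=> /addnI /val_inj].
Qed.

(** A condition s i = M + l cannot hold when all labels of x are below M, and the conditions inside
    D do not involve M. *)
Lemma match_form_far k n (e : diagram k n) D M (x : V k) :
  (forall s, co x s <> 0 -> forall l, (s l < M)%N) ->
  match_form (far D M) e x = if dom e \subset D then match_form (iota_ffun n) e x else 0.
Proof.
move=> xM; case: ifP => [/fintype.subsetP sD|nD].
  apply: (@lin_ext_supp K K^o) => s _; congr (_%:R); congr nat_of_bool; congr (_ && _).
  apply: eq_forallb => l; case El: (e.2 l) => [i|//]; rewrite !ffunE sD //.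
  by rewrite inE El.
have [l] := subsetPn (negbT nD); rewrite inE => el lD.
rewrite /match_form; have [q uq xq] := freeMod_supp (x : tensor_pow K k).
rewrite (lin_extE _ uq xq) big1 // => s _.
have [->|/eqP xs] := eqVneq (co x s) 0; first by rewrite scale0r.
case: (boolP (match_data _ e s)) => [|_]; last by rewrite scaler0.
move=> /andP[_ /forallP/(_ l)]; case: (e.2 l) el => // i _.
rewrite ffunE (negPf lD) => /eqP si; have := xM s xs i.
by rewrite si ltnNge leq_addr.
Qed.

Section Forms.
Variables (I : finType) (k : I -> nat) (n : nat) (c : forall a, diagram (k a) n -> K).

Definition diagram_form t (v : forall a, V (k a)) := \sum_a \sum_e c e * match_form t e (v a).

Definition diagram_part (D : {set 'I_n}) (v : forall a, V (k a)) :=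
  \sum_a \sum_(e | dom e == D) c e * match_form (iota_ffun n) e (v a).

Lemma form_part v : diagram_form (iota_ffun n) v = \sum_D diagram_part D v.
Proof.
rewrite /diagram_part exchange_big; apply: eq_bigr => a _.
by rewrite (partition_big (@dom (k a) n) predT).
Qed.

Lemma form_far D v : exists M, forall M', (M <= M')%N ->
  diagram_form (far D M') v = \sum_(D' : {set 'I_n} | D' \subset D) diagram_part D' v.
Proof.
have [M vM] := tensor_family_bound (fun a => v a : tensor_pow K (k a)).
exists M => M' MM'; rewrite /diagram_part exchange_big; apply: eq_bigr => a _.
rewrite (eq_bigr (fun e => if dom e \subset D then c e * match_form (iota_ffun n) e (v a) else 0)).
  rewrite -big_mkcond (partition_big (@dom (k a) n) (fun D' => D' \subset D)) //=.
  apply: eq_bigr => D' sD'; apply: eq_bigl => e.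
  by case: eqP => [->|]; rewrite ?andbF // sD'.
move=> e _; rewrite match_form_far; first by case: ifP; rewrite ?mulr0.
by move=> s vs l; apply: leq_trans MM'; exact: vM vs l.
Qed.

(* Moving the labels outside D far away isolates the diagrams with domain in D. *)
Lemma part_eq0 (R : {set 'I_n} -> Prop) v :
  (forall D D' : {set 'I_n}, D' \subset D -> R D -> R D') ->
  (forall D, R D -> exists M, forall M', (M <= M')%N -> diagram_form (far D M') v = 0) ->
  forall D, R D -> diagram_part D v = 0.
Proof.
move=> Rsub Rfar D; have [m] := ubnP #|D|; elim: m D => // m IH D; rewrite ltnS => Dm RD.
have [M1 M1E] := Rfar D RD; have [M2 M2E] := form_far D v.
have := M1E (maxn M1 M2) (leq_maxl _ _); rewrite M2E ?leq_maxr // (bigD1 D) //= big1 ?addr0 //.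
move=> D' /andP[sD' nD']; apply: IH; last exact: Rsub RD.
by apply: leq_trans Dm; apply: proper_card; rewrite finset.properEneq nD' sD'.
Qed.

End Forms.

End InjectiveTensors.

(** * Injectivity, separation and the FI model for the symmetric group *)

Section SymmetricModel.
Variable K : fieldType.
Hypothesis char0 : [pchar K] =i pred0.
Local Notation V := (tensor_rep (sym_action K)).
Local Notation P := (inj_tensor K).
Local Notation co x := (coef (x : tensor_pow K _)).

Lemma form_sigma (I : finType) (k : I -> nat) n (c : {a : I & diagram (k a) n} -> K) t
    (v : forall a, V (k a)) :
  diagram_form (fun a e => c (Tagged (fun a => diagram (k a) n) e)) t v =
  \sum_b c b * match_form t (tagged b) (v (tag b)).
Proof.
rewrite /diagram_form (sig_big_dep (fun=> true) (fun _ _ => true)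
  (fun a e => c (Tagged (fun a => diagram (k a) n) e) * match_form t e (v a))).
by apply: eq_bigr => -[a e].
Qed.

Lemma form_sym (I : finType) (k : I -> nat) n (c : forall a, diagram (k a) n -> K) N
    (u : forall a, rep_hom N (V (k a))) g t x :
  diagram_form c t (fun a => u a (raction N g^-1%g x)) = diagram_form c (sact g t) (fun a => u a x).
Proof.
apply: eq_bigr => a _; apply: eq_bigr => e _.
by rewrite rep_hom_equiv match_form_sym invgK.
Qed.

Lemma averaging_image (I : finType) (k : I -> nat) n N (x : forall a, V (k a)) :
  (forall a (e : diagram (k a) n), match_form (iota_ffun n) e (x a) = 0) ->
  (forall a s, co (x a) s <> 0 -> forall l, (s l < N)%N) ->
  forall a, gring_act (averaging K n (maxn n N)) (x a) = 0.
Proof.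
move=> x0 xN a; apply: averaging_eq0 => //; first exact: leq_maxl.
by move=> s xs l; rewrite leq_max (xN _ _ xs) orbT.
Qed.

(** If all matching functionals vanish on the [u a x], averaging kills these, hence f kills the
    average of x; but the coefficient there at (0, ..., n-1) is that of [f x] times the number of
    permutations. So it is a combination of matching functionals, and those of full diagrams come
    from morphisms. *)
Lemma sym_tensor_injective (I : finType) (k : I -> nat) N
    (u : forall a, rep_hom N (V (k a))) n (f : rep_hom N (P n)) :
  (forall x, (forall a, u a x = 0) -> f x = 0) ->
  exists c : forall a, diagram (k a) n -> K,
    forall x, f x = \sum_a \sum_e c a e *: diagram_map K e (u a x).
Proof.
move=> uf; pose t := iota_ffun n.
pose lam x := co (inj_inc K n (f x)) t.
pose J : finType := {a : I & diagram (k a) n}.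
have [|||c0 c0E] := @scalar_combination K N J (fun b x => match_form t (tagged b) (u (tag b) x)) lam.
- by move=> b a x y; rewrite rep_hom_linear match_form_scalar.
- by move=> a x y; rewrite /lam !rep_hom_linear.
- move=> x x0.
  have [M uM] := tensor_family_bound (fun a => u a x : tensor_pow K (k a)).
  have av0 a : gring_act (averaging K n (maxn n M)) (u a x) = 0.
    by move: a; apply: averaging_image uM => a e; exact: (x0 (Tagged (fun a => diagram (k a) n) e)).
  have : lam (gring_act (averaging K n (maxn n M)) x) = 0.
    by rewrite /lam uf ?linear0 // => a; rewrite gring_act_hom av0.
  rewrite /lam gring_act_hom gring_act_hom averagingE Defs.coef_sum (eq_bigr (fun=> lam x)).
    by rewrite sumr_const -mulr_natl => /eqP; rewrite mulf_eq0 (negPf (fixing_card_neq0 char0 _ _)) => /eqP.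
  move=> p pf; rewrite sym_coef; congr (co _ _); apply/ffunP => l; rewrite ffunE.
  apply: (can_inj (symK (sym_of_perm p))); rewrite symVK !ffunE.
  by rewrite (fixing_sym (leq_maxl n M) pf).
pose c (a : I) (e : diagram (k a) n) := c0 (Tagged (fun a => diagram (k a) n) e).
have lamE x : lam x = diagram_form c t (fun a => u a x) by rewrite c0E; apply/esym; exact: form_sigma.
(* The other parts vanish: by symmetry the form at [far D M'] is a coefficient of [f x], which is 0
   for large M' because [f x] has finite support and D is not everything. *)
have lamP x : lam x = diagram_part c [set: 'I_n]%SET (fun a => u a x).
  rewrite lamE form_part (bigD1 [set: 'I_n]%SET) //= big1 ?addr0 // => D.
  apply: (part_eq0 (R := fun D => D != [set: 'I_n]%SET)) => {D}.
    by move=> D D' sD; apply: contraNneq => D'T; rewrite -finset.subTset -D'T.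
  move=> D nD; have [M fM] := tensor_bound (inj_inc K n (f x) : tensor_pow K n).
  exists (maxn n M) => M' MM'.
  have fi : injective (far D M') by apply: far_inj; exact: leq_trans (leq_maxl _ _) MM'.
  have [g gE] := sact_transitive (@iota_ffun_inj n) fi.
  rewrite -gE -form_sym -lamE /lam !rep_hom_equiv sym_coef invgK gE.
  apply: contrapT => /fM H.
  have /subsetPn[l _ lD] : ~~ ([set: 'I_n]%SET \subset D) by rewrite finset.subTset.
  have := H l; rewrite ffunE (negPf lD) ltnNge; case/negP.
  by rewrite (leq_trans _ (leq_addr _ _)) // (leq_trans _ MM') // leq_maxr.
exists c => x.
pose h : rep_hom N (P n) := \sum_a \sum_e c a e *: rep_comp (diagram_map K e) (u a).
have hE y : h y = \sum_a \sum_e c a e *: diagram_map K e (u a y).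
  by rewrite rep_hom_sum; apply: eq_bigr => a _; rewrite rep_hom_sum.
rewrite -hE; apply/eqP; rewrite -subr_eq0; apply/eqP.
apply: (inj_hom_eq0 (f := f - h) (@iota_ffun_inj n)) => y.
have -> : inj_inc K n ((f - h) y) = inj_inc K n (f y) - inj_inc K n (h y).
  by rewrite -linearB.
have cD (v w : V n) : co (v - w) t = co v t - co w t by [].
rewrite cD -/(lam y) lamP hE linear_sum Defs.coef_sum; apply/eqP; rewrite subr_eq0.
apply/eqP/eq_bigr => a _; rewrite big_mkcond linear_sum Defs.coef_sum; apply: eq_bigr => e _.
rewrite linearZ Defs.coefZ diagram_mapE; case: ifP => _ /=; last by rewrite mulr0.
by have /injectiveP -> := @iota_ffun_inj n.
Qed.

(** Restricting a diagram with domain D to the labels in D makes its domain full, so its functional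
    becomes a coefficient of a morphism. *)
Lemma part_diagram_map (I : finType) (k : I -> nat) n (c : forall a, diagram (k a) n -> K)
    (D : {set 'I_n}) :
  exists (F : forall a, rep_hom (V (k a)) (P #|D|)) (t : {ffun 'I_#|D| -> nat}),
    injective t /\
    forall v : forall a, V (k a), co (inj_inc K _ (\sum_a F a (v a))) t = diagram_part c D v.
Proof.
pose t : {ffun 'I_#|D| -> nat} := [ffun l : 'I_#|D| => nat_of_ord (enum_val l)].
have ti : injective t by move=> l l'; rewrite !ffunE => /val_inj /enum_val_inj.
pose rd a (e : diagram (k a) n) : diagram (k a) #|D| := (e.1, [ffun l : 'I_#|D| => e.2 (enum_val l)]).
exists (fun a => \sum_(e : diagram (k a) n | dom e == D) c a e *: diagram_map K (rd a e)), t; split=> // v.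
rewrite linear_sum Defs.coef_sum; apply: eq_bigr => a _.
rewrite rep_hom_sum linear_sum Defs.coef_sum; apply: eq_bigr => e /eqP eD.
rewrite rep_homZ linearZ Defs.coefZ diagram_mapE.
have -> : dom (rd a e) == [set: 'I_#|D|]%SET.
  apply/eqP/setP => l; rewrite !inE ffunE /=.
  have De y : y \in D -> e.2 y != None by rewrite -eD inE.
  by rewrite De // enum_valP.
have /injectiveP -> := ti; congr (_ * _).
apply: (@lin_ext_supp K K^o) => s _; congr (_%:R); congr nat_of_bool; congr (_ && _).
apply/forallP/forallP => H l.
  case El: (e.2 l) => [i|//].
  have lD : l \in D by rewrite -eD inE El.
  by have := H (enum_rank_in lD l); rewrite !ffunE enum_rankK_in // El.
by have := H (enum_val l); rewrite !ffunE.
Qed.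

(** With n above all labels of w, averaging multiplies w by a nonzero number, so it suffices to
    match the functionals of all diagrams. A relation among them on the image of N splits by
    [part_eq0] into parts, each a coefficient of a morphism that then vanishes on the image and
    hence on w. *)
Lemma sym_tensor_separating (I : finType) (k : I -> nat) N
    (u : forall a, rep_hom N (V (k a))) (w : forall a, V (k a)) :
  (forall n (F : forall a, rep_hom (V (k a)) (P n)),
     (forall x, \sum_a F a (u a x) = 0) -> \sum_a F a (w a) = 0) ->
  exists x, forall a, u a x = w a.
Proof.
move=> wk; have [n wn] := tensor_family_bound (fun a => w a : tensor_pow K (k a)).
pose J : finType := {a : I & diagram (k a) n}.
have [||x xE] := @scalar_separation K N J
    (fun b x => match_form (iota_ffun n) (tagged b) (u (tag b) x))
    (fun b => match_form (iota_ffun n) (tagged b) (w (tag b))).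
- by move=> b a x y; rewrite rep_hom_linear match_form_scalar.
- move=> c0 c0E.
  pose c (a : I) (e : diagram (k a) n) := c0 (Tagged (fun a => diagram (k a) n) e).
  have cu x : diagram_form c (iota_ffun n) (fun a => u a x) = 0 by rewrite -[RHS](c0E x); exact: form_sigma.
  transitivity (diagram_form c (iota_ffun n) w); first by apply/esym; exact: form_sigma.
  rewrite form_part big1 // => D _.
  have [F [t [ti FE]]] := part_diagram_map c D.
  rewrite -FE wk ?linear0 ?Defs.coef0 // => x.
  pose h : rep_hom N (P #|D|) := \sum_a rep_comp (F a) (u a).
  have hE y : h y = \sum_a F a (u a y) by rewrite rep_hom_sum.
  rewrite -hE; move: x; apply: (inj_hom_eq0 ti) => x; rewrite hE FE.
  apply: (part_eq0 (R := fun=> True)) => // {F FE h hE t ti}D _; exists n => M' nM'.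
  have [g <-] := sact_transitive (@iota_ffun_inj n) (far_inj (D := D) nM').
  by rewrite -form_sym cu.
have [N1 uN1] := tensor_family_bound (fun a => (u a x - w a : V (k a)) : tensor_pow K (k a)).
have av0 a : gring_act (averaging K n (maxn n N1)) (u a x - w a) = 0.
  move: a; apply: averaging_image uN1 => a e.
  have := xE (Tagged (fun a => diagram (k a) n) e); rewrite /= => E.
  by rewrite scalarB ?E ?subrr //; exact: match_form_scalar.
pose q : K := #|@fixing n (maxn n N1)|%:R.
have q0 : q != 0 := fixing_card_neq0 char0 _ _.
exists (q^-1 *: gring_act (averaging K n (maxn n N1)) x) => a.
rewrite linearZ /= gring_act_hom.
have -> : gring_act (averaging K n (maxn n N1)) (u a x) = q *: w a.
  have := av0 a; rewrite addrC -scaleN1r gring_actP scaleN1r addrC => /eqP.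
  rewrite subr_eq0 => /eqP ->; apply: averaging_fix; [exact: leq_maxl|exact: wn].
by rewrite scalerA mulVf // scale1r.
Qed.

Lemma inj_evec_supp n (s : {ffun 'I_n -> nat}) : injective s ->
  inj_supp_pred K n (evec s : tensor_pow K n).
Proof. by move=> si t nt; rewrite evecE; case: eqP nt => // ->. Qed.

(* The basis vector e_s; junk value 0 when [s] is not injective. *)
Definition inj_evec n (s : {ffun 'I_n -> nat}) : P n :=
  if pselect (injective s) is left si then mk_sub (inj_evec_supp si) else 0.

Lemma inj_evecE n (s : {ffun 'I_n -> nat}) : injective s ->
  inj_inc K n (inj_evec s) = evec s :> tensor_pow K n.
Proof. by rewrite /inj_evec; case: pselect. Qed.

(** The translates of e_(0, ..., n-1) span [P n]. *)
Lemma inj_hom_ext n (M : rep K Sym_oo) (f h : rep_hom (P n) M) :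
  f (inj_evec (iota_ffun n)) = h (inj_evec (iota_ffun n)) -> f = h.
Proof.
move=> fh; apply: rep_hom_ext => x.
have [q uq xq] := freeMod_supp (inj_inc K n x : tensor_pow K n).
have -> : x = \sum_(s <- q) co (inj_inc K n x) s *: inj_evec s.
  apply: (@inj_inc_inj K n); rewrite linear_sum [LHS](freeMod_sum uq xq).
  apply: eq_bigr => s _; rewrite linearZ /=.
  have [si|ns] := pselect (injective s); first by rewrite -[in LHS](inj_evecE si).
  by rewrite inj_inc_out // !scale0r.
rewrite !linear_sum; apply: eq_bigr => s _; rewrite !linearZ /=; congr (_ *: _).
have [si|ns] := pselect (injective s); last first.
  by rewrite /inj_evec; case: pselect => // _; rewrite !linear0.
have [g gs] := sact_transitive (@iota_ffun_inj n) si.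
have -> : inj_evec s = raction (P n) g (inj_evec (iota_ffun n)).
  apply: (@inj_inc_inj K n); rewrite rep_hom_equiv (inj_evecE si).
  by rewrite (inj_evecE (@iota_ffun_inj n)) sym_act_evec gs.
by rewrite !rep_hom_equiv fh.
Qed.

Definition inj_diagram n m (j : {ffun 'I_m -> 'I_n}) : diagram n m :=
  (kernel (iota_ffun n), [ffun l => Some (j l)]).

Definition inj_restr n m (j : {ffun 'I_m -> 'I_n}) : rep_hom (P n) (P m) :=
  rep_comp (diagram_map K (inj_diagram j)) (inj_inc K n).

Lemma inj_restr_evec n m (j : {ffun 'I_m -> 'I_n}) (s : {ffun 'I_n -> nat}) :
  injective j -> injective s -> inj_restr j (inj_evec s) = inj_evec [ffun l => s (j l)].
Proof.
move=> ji si; apply: (@inj_inc_inj K m); apply: freeModP => t.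
have sji : injective [ffun l => s (j l)] by move=> l l'; rewrite !ffunE => /si /ji.
rewrite diagram_mapE (inj_evecE sji) evecE.
have -> : dom (inj_diagram j) == [set: 'I_m]%SET.
  by apply/eqP/setP => l; rewrite !inE ffunE.
case: injectiveP => /= ti; last first.
  by case: eqP => // E; case: ti; rewrite E.
rewrite -[LHS]/(match_form t (inj_diagram j) (inj_inc K n (inj_evec s))) (inj_evecE si).
rewrite /match_form lin_ext_evec; congr (_%:R); congr nat_of_bool.
rewrite /match_data /=.
have -> : kernel s == kernel (iota_ffun n).
  by apply/eqP/ffunP => p; rewrite !ffunE (inj_eq si) val_eqE.
apply/forallP/eqP => [H|-> l]; last by rewrite !ffunE.
by apply/ffunP => l; have := H l; rewrite !ffunE => /eqP.
Qed.

Definition inj_cf n m (j : {ffun 'I_m -> 'I_n}) (f : rep_hom (P n) (P m)) : K :=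
  co (inj_inc K m (f (inj_evec (iota_ffun n)))) [ffun l => j l : nat].

Lemma inj_cf_linear n m (j : {ffun 'I_m -> 'I_n}) : scalar (inj_cf j).
Proof. by move=> a f h; rewrite /inj_cf rep_homD rep_homZ linearP. Qed.

Lemma ord_ffun_inj n m (j : {ffun 'I_m -> 'I_n}) :
  injective j -> injective [ffun l => j l : nat].
Proof. by move=> ji l l'; rewrite !ffunE => /val_inj /ji. Qed.

Lemma inj_restr_iota n m (j : {ffun 'I_m -> 'I_n}) : injective j ->
  inj_restr j (inj_evec (iota_ffun n)) = inj_evec [ffun l => j l : nat].
Proof.
move=> ji; rewrite (inj_restr_evec ji (@iota_ffun_inj n)); congr inj_evec.
by apply/ffunP => l; rewrite !ffunE.
Qed.

Lemma inj_cf_restr n m (j i : {ffun 'I_m -> 'I_n}) : injectiveb j -> injectiveb i ->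
  inj_cf j (inj_restr i) = (j == i)%:R.
Proof.
move=> /injectiveP ji /injectiveP ii; rewrite /inj_cf inj_restr_iota //.
rewrite (inj_evecE (ord_ffun_inj ii)) evecE; congr (_%:R); congr nat_of_bool.
apply/eqP/eqP => [/ffunP E|->//]; apply/ffunP => l; apply: val_inj.
by have := E l; rewrite !ffunE.
Qed.

(** By [sym_tensor_injective] for the inclusion into [V n], f is a combination of diagram maps, and
    these only copy labels of the source. *)
Lemma inj_hom_supp n m (f : rep_hom (P n) (P m)) t :
  co (inj_inc K m (f (inj_evec (iota_ffun n)))) t <> 0 ->
  exists2 j : {ffun 'I_m -> 'I_n}, injective j & t = [ffun l => j l : nat].
Proof.
have [|c cE] := @sym_tensor_injective unit (fun=> n) (P n) (fun=> inj_inc K n) m f.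
  move=> x /(_ tt) x0; have -> : x = 0 by apply: (@inj_inc_inj K n); rewrite linear0.
  exact: linear0.
move=> ft; have [ti|nt] := pselect (injective t); last by case: ft; exact: inj_inc_out.
have [tn|/existsNP[l tl]] := pselect (forall l, (t l < n)%N).
  exists [ffun l => Ordinal (tn l)]; last by apply/ffunP => l; rewrite !ffunE.
  by move=> l l'; rewrite !ffunE => /(congr1 val) /= /ti.
case: ft; rewrite cE linear_sum Defs.coef_sum big1 // => a _.
rewrite linear_sum Defs.coef_sum big1 // => e _.
rewrite linearZ Defs.coefZ diagram_mapE; case: ifP => [/andP[De _]|_]; last by rewrite mulr0.
rewrite (inj_evecE (@iota_ffun_inj n)) /match_form lin_ext_evec.
case: (boolP (match_data t e _)) => [/andP[_ /forallP/(_ l)]|_]; last by rewrite mulr0.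
have [i ->] := dom_full l De; rewrite ffunE => /eqP E.
by case: tl; rewrite -E.
Qed.

Lemma inj_cf_expand n m (f : rep_hom (P n) (P m)) :
  f = \sum_(j : {ffun 'I_m -> 'I_n} | injectiveb j) inj_cf j f *: inj_restr j.
Proof.
apply: inj_hom_ext; apply: (@inj_inc_inj K m); apply: freeModP => t.
rewrite rep_hom_sum rep_hom_bigsum Defs.coef_sum.
transitivity (\sum_(j : {ffun 'I_m -> 'I_n} | injectiveb j)
    inj_cf j f * (t == [ffun l => j l : nat])%:R); last first.
  apply: eq_bigr => j /injectiveP ji.
  rewrite rep_homZ rep_hom_scale Defs.coefZ inj_restr_iota //.
  by rewrite (inj_evecE (ord_ffun_inj ji)) evecE.
have [ft|/eqP ft] := eqVneq (co (inj_inc K m (f (inj_evec (iota_ffun n)))) t) 0.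
  rewrite ft big1 // => j _; case: eqP => [tj|_]; last by rewrite mulr0.
  by rewrite /inj_cf -tj ft mul0r.
have [j ji tj] := inj_hom_supp ft.
rewrite (bigD1 j) /=; last exact/injectiveP.
rewrite -tj eqxx mulr1 big1 ?addr0 => [|i /andP[_ ij]]; first by rewrite /inj_cf -tj.
case: eqP => [E|_]; last by rewrite mulr0.
case/eqP: ij; apply/ffunP => l; apply: val_inj.
by move/ffunP/(_ l): E; rewrite tj !ffunE.
Qed.

Definition sym_model : fi_model
  (fun M : rep K Sym_oo => exists ns, subquotient M (tensor_dsum (sym_action K) ns)).
Proof.
refine (@FiModel K _ _ P inj_restr inj_cf inj_cf_linear inj_cf_expand inj_cf_restr _ _ _ _ _).
- move=> n; apply: inj_hom_ext; rewrite inj_restr_iota; last by move=> l l'; rewrite !ffunE.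
  by congr inj_evec; apply/ffunP => l; rewrite !ffunE.
- move=> n m p j i /injectiveP ji /injectiveP ii; apply: inj_hom_ext.
  have jii : injective [ffun x => j (i x)] by move=> l l'; rewrite !ffunE => /ji /ii.
  rewrite -[LHS]/(inj_restr i (inj_restr j (inj_evec (iota_ffun n)))).
  rewrite (inj_restr_iota ji) (inj_restr_evec ii (ord_ffun_inj ji)) (inj_restr_iota jii); congr inj_evec.
  by apply/ffunP => l; rewrite !ffunE.
- exact: (tensorial_injective (@inj_inc_inj K) sym_tensor_injective).
- exact: (tensorial_separating (@inj_inc_inj K) sym_tensor_separating).
- exact: (tensorial_embedding (@inj_inc_inj K) (@diagram_map_gt K) sym_tensor_injective sym_tensor_separating).
Defined.

End SymmetricModel.

Theorem mainTheorem17 (R : realType) : equivalent (Rep_Sym R[i]) (Rep_pol_GA R[i]).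
Proof.
have char0 : [pchar R[i]] =i pred0 by exact: Num.Theory.pchar_num.
exact: fi_models_equivalent (sym_model char0) (affine_model char0).
Qed.
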